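(* There is a deterministic algorithm that solves \textsc{List Colouring} on $n$-vertex trees (with lists $L(v)\subseteq\{1,\dots,n\}$) in polynomial time using $O(\log^2 n)$ bits of work space.
   Context: An $L$-colouring of a graph with lists $L(v)$ is a proper colouring $c$ with $c(v)\in L(v)$ for all vertices $v$; \textsc{List Colouring} asks whether one exists. Space is measured as bits on the work tape of a deterministic Turing machine with the tree and lists on a read-only input tape; vertices are numbered $1,\dots,n$ and equality of the $i$th colour of $L(v)$ and $i'$th colour of $L(v')$ is assumed checkable in $O(\log n)$ space. *)

(* Defs.v *)
From mathcomp Require Import all_boot.
Set Implicit Arguments. Unset Strict Implicit. Unset Printing Implicit Defensive.

(* A tree on the vertex set 'I_n (vertex i stands for vertex i+1 of the
   paper): a nonempty, simple (symmetric, irreflexive), connected graph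
   with exactly n-1 edges (= 2(n-1) ordered adjacent pairs). *)
Definition is_tree (n : nat) (e : rel 'I_n) : Prop :=
  [/\ 0 < n,
      (forall u v, e u v = e v u),
      (forall v, ~~ e v v),
      (forall u v, connect e u v)
    & #|[set p : 'I_n * 'I_n | e p.1 p.2]| = 2 * (n - 1)].

(* Lists L(v) \subseteq {1,...,n}; colour c : 'I_n stands for colour c+1. *)
Definition L_colouring (n : nat) (e : rel 'I_n) (L : 'I_n -> {set 'I_n})
    (c : 'I_n -> 'I_n) : Prop :=
  (forall v, c v \in L v) /\ (forall u v, e u v -> c u != c v).

Definition list_colourable (n : nat) (e : rel 'I_n) (L : 'I_n -> {set 'I_n}) :=
  exists c, L_colouring e L c.

(* Input alphabet: two bits, a separator; End is the end marker read
   outside the input word (positions 0 and |w|+1). *)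
Inductive isym := I0 | I1 | ISep | IEnd.

Inductive move := MoveL | MoveS | MoveR.

Unset Implicit Arguments.

Record TM := {
  tm_state : finType;
  tm_work  : finType;
  tm_blank : tm_work;
  tm_start : tm_state;
  tm_accept : pred tm_state;
  (* None = halt *)
  tm_delta : tm_state -> isym -> tm_work ->
             option (tm_state * tm_work * move * move)
}.

Record config (M : TM) := Config {
  cf_state : tm_state M;
  cf_ipos  : nat;                     (* input head, in [0, |w|+1] *)
  cf_tape  : nat -> tm_work M;
  cf_wpos  : nat
}.

Arguments Config {M}.
Arguments cf_state {M}.
Arguments cf_ipos {M}.
Arguments cf_tape {M}.
Arguments cf_wpos {M}.
Set Implicit Arguments.

Section Run.
Variable M : TM.
Variable w : seq isym.

Definition read_input (i : nat) : isym :=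
  if (i == 0) || (size w < i) then IEnd else nth IEnd w i.-1.

Definition move_input (m : move) (i : nat) : nat :=
  match m with
  | MoveL => i.-1
  | MoveS => i
  | MoveR => minn i.+1 (size w).+1
  end.

Definition move_work (m : move) (i : nat) : nat :=
  match m with
  | MoveL => i.-1
  | MoveS => i
  | MoveR => i.+1
  end.

Definition init_config : config M :=
  Config (tm_start M) 0 (fun _ => tm_blank M) 0.

Definition next (c : config M) :
    option (tm_state M * tm_work M * move * move) :=
  tm_delta M (cf_state c) (read_input (cf_ipos c)) (cf_tape c (cf_wpos c)).

Definition step (c : config M) : config M :=
  match next c with
  | None => c
  | Some (q, g, mi, mw) =>
      Config q (move_input mi (cf_ipos c))
             (fun j => if j == cf_wpos c then g else cf_tape c j)
             (move_work mw (cf_wpos c))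
  end.

Definition run (t : nat) : config M := iter t step init_config.

Definition halts_at (t : nat) : Prop :=
  (forall t', t' < t -> next (run t') <> None) /\ next (run t) = None.

Definition space_within (t s : nat) : Prop :=
  forall t', t' <= t -> cf_wpos (run t') < s.

Definition accepts_at (t : nat) : bool := tm_accept M (cf_state (run t)).

End Run.

Definition bitsym (b : bool) : isym := if b then I1 else I0.

Definition encode (n : nat) (e : rel 'I_n) (L : 'I_n -> {set 'I_n}) : seq isym :=
  flatten [seq rcons [seq bitsym (e u v) | v <- enum 'I_n] ISep | u <- enum 'I_n]
  ++ flatten [seq rcons [seq bitsym (c \in L u) | c <- enum 'I_n] ISep
             | u <- enum 'I_n].

(* Main.v *)
Require Import Defs.
From mathcomp Require Import all_boot.
From mathcomp Require Import zify.
Set Implicit Arguments. Unset Strict Implicit. Unset Printing Implicit Defensive.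

(** Root the tree. A vertex constrains its parent only if it has no feasible
    colour or exactly one. The heavy path of a vertex is evaluated bottom-up
    from its head alone, and only the evaluation of a light child, whose subtree
    is at most half as large, pushes a frame of O(log n) bits; so O(log n)
    frames suffice. To evaluate a vertex, each colour of its list is tested
    against the light children in increasing order of size until one of them
    blocks it. Different colours are blocked by different children, and the test
    stops at the second unblocked colour, so the k-th largest child is evaluated
    at most k + 1 times, and the largest (the heavy one) once. As the k-th
    largest subtree has at most a k-th of the size, the number of steps is at
    most cubic in the size, up to a polynomial factor in n. Sizes are computed
    by walking along Euler tours, which needs only the current edge. The
    procedure is a program over stacks of naturals, stored as stacks of binary
    digits on the tracks of one work tape. *)

(** * Programs over stacks of digits and their compilation to a Turing machine *)

(** The codes of all light children of a vertex do not fit into O(log n) bits, so nothing learned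
    about them survives from one colour to the next. Re-evaluating every light child for every
    colour would only give n^(O(log n)) time. The exponent 3 comes from the recurrence: let a light
    child have tour length t, let p >= 2 children be at least as large, itself and the heavy one
    included, and let s be the tour length of the parent. Then p t <= s, and (p + 1) t^3 <= 2p t^3
    <= (p t)^2 t <= s^2 t; with exponent 2 a factor (p + 1)/p would remain. Over all children the
    terms s^2 t sum to at most s^3 - s^2, and the surplus pays for the steps at the vertex itself.
    Time is carried mostly as an exponent of N = 2n + 4, every constant being absorbed by raising
    the exponent. Space would not survive such rounding: it is fixed by the height of a track, the
    number of its numerals times their length, and the number of tracks is constant. *)

Notation sym := (option bool).

Definition upd (V : finType) (T : Type) (f : {ffun V -> T}) v x : {ffun V -> T} :=
  [ffun u => if u == v then x else f u].

Lemma upd_same (V : finType) T (f : {ffun V -> T}) v x : upd f v x v = x.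
Proof. by rewrite ffunE eqxx. Qed.

Lemma upd_other (V : finType) T (f : {ffun V -> T}) v x u :
  u != v -> upd f v x u = f u.
Proof. by rewrite ffunE => /negbTE ->. Qed.

Section StackLanguage.
Variable V : finType.

Inductive act := Push of V & sym | Pop of V | Mv of move.
Inductive test := Top of V & pred (option sym) | In of pred isym.
Inductive cmd :=
  | Skip
  | Act of act
  | Seq of cmd & cmd
  | If of test & cmd & cmd
  | While of test & cmd.

Record store := Store { stk : {ffun V -> seq sym}; ipos : nat }.

Variables (w : seq isym) (H : nat).

Definition do_act a s :=
  match a with
  | Push v x => Store (upd (stk s) v (x :: stk s v)) (ipos s)
  | Pop v => Store (upd (stk s) v (behead (stk s v))) (ipos s)
  | Mv m => Store (stk s) (move_input w m (ipos s))
  end.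

Definition ev_test b s :=
  match b with
  | Top v p => p (ohead (stk s v))
  | In p => p (read_input w (ipos s))
  end.

Definition fits s := forall v, size (stk s v) <= H.

(** The time index counts compiled instructions: the first branch of [If] also pays for its test and
    the jump over the second, an iteration of [While] for its test and the jump back. The height
    bound is demanded after every action, so a derivation certifies space as well. *)
Inductive exec : cmd -> store -> nat -> store -> Prop :=
  | XSkip s : exec Skip s 0 s
  | XAct a s : fits (do_act a s) -> exec (Act a) s 1 (do_act a s)
  | XSeq c1 c2 s1 s2 s3 t1 t2 :
      exec c1 s1 t1 s2 -> exec c2 s2 t2 s3 -> exec (Seq c1 c2) s1 (t1 + t2) s3
  | XIfT b c1 c2 s1 s2 t :
      ev_test b s1 -> exec c1 s1 t s2 -> exec (If b c1 c2) s1 t.+2 s2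
  | XIfF b c1 c2 s1 s2 t :
      ~~ ev_test b s1 -> exec c2 s1 t s2 -> exec (If b c1 c2) s1 t.+1 s2
  | XWhileF b c s : ~~ ev_test b s -> exec (While b c) s 1 s
  | XWhileT b c s1 s2 s3 t1 t2 :
      ev_test b s1 -> exec c s1 t1 s2 -> exec (While b c) s2 t2 s3 ->
      exec (While b c) s1 (t1 + t2).+2 s3.

Inductive instr := IAct of act | ITest of test & nat | IJump of nat.

Fixpoint clen c :=
  match c with
  | Skip => 0
  | Act _ => 1
  | Seq c1 c2 => clen c1 + clen c2
  | If _ c1 c2 => (clen c1 + clen c2).+2
  | While _ c => (clen c).+2
  end.

(** Addresses are absolute, [pc] being that of the first emitted instruction. An [ITest] falls
    through when its test holds and jumps otherwise. *)
Fixpoint compile pc c :=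
  match c with
  | Skip => [::]
  | Act a => [:: IAct a]
  | Seq c1 c2 => compile pc c1 ++ compile (pc + clen c1) c2
  | If b c1 c2 =>
      ITest b (pc + clen c1).+2 :: compile pc.+1 c1
        ++ IJump (pc + clen c1 + clen c2).+2 :: compile (pc + clen c1).+2 c2
  | While b c => ITest b (pc + clen c).+2 :: compile pc.+1 c ++ [:: IJump pc]
  end.

Lemma size_compile c pc : size (compile pc c) = clen c.
Proof.
elim: c pc => //= [c1 IH1 c2 IH2|b c1 IH1 c2 IH2|b c IH] pc;
  rewrite !size_cat /= ?IH1 ?IH2 ?IH; lia.
Qed.

Definition iopt (prog : seq instr) pc := ohead (drop pc prog).

Lemma iopt_cat l1 x l2 : iopt (l1 ++ x :: l2) (size l1) = Some x.
Proof. by rewrite /iopt drop_size_cat. Qed.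

(** * A one-tape machine with one track per stack *)

Section Program.
Variable prog : seq instr.

(** The Boolean marks the home cell: a left move at position 0 is silently stationary, so the end of
    the tape has to be recognised by its contents. *)
Definition cell := (bool * {ffun V -> option sym})%type.

(* Control phases: go = (false, false) at the home cell or searching for the
   end of a track, (false, true) on the top cell of the track, (true, false)
   returning home, (true, true) initial. *)
Definition mstate := ('I_(size prog).+2 * (bool * bool))%type.

Definition pcst pc (ph : bool * bool) : mstate := (inord pc, ph).

(** A push acts on the first free cell, whereas pop and test step back by one. On an empty track
    that step lands on the home cell, whose track entries are all [None], so the empty stack needs
    no case of its own. *)
Definition delta_track (v : V) (i : instr) pc (g : cell) : mstate * cell * move :=
  if g.1 || (g.2 v != None) then (pcst pc (false, false), g, MoveR) else
  match i with
  | IAct (Push _ x) => (pcst pc.+1 (true, false), (g.1, upd g.2 v (Some x)), MoveL)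
  | _ => (pcst pc (false, true), g, MoveL)
  end.

Definition delta_go (i : instr) pc (a : isym) (g : cell) :
    mstate * cell * move * move :=
  match i with
  | IJump pc' => (pcst pc' (false, false), g, MoveS, MoveS)
  | ITest (In p) pc' =>
      (pcst (if p a then pc.+1 else pc') (false, false), g, MoveS, MoveS)
  | IAct (Mv m) => (pcst pc.+1 (false, false), g, m, MoveS)
  | IAct (Push v _) | IAct (Pop v) | ITest (Top v _) _ =>
      let: (q, g', m) := delta_track v i pc g in (q, g', MoveS, m)
  end.

Definition delta_top (i : instr) pc (g : cell) : mstate * cell * move * move :=
  match i with
  | IAct (Pop v) => (pcst pc.+1 (true, false), (g.1, upd g.2 v None), MoveS, MoveS)
  | ITest (Top v p) pc' =>
      (pcst (if p (g.2 v) then pc.+1 else pc') (true, false), g, MoveS, MoveS)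
  | _ => (pcst pc (true, false), g, MoveS, MoveS)
  end.

Definition delta (q : mstate) (a : isym) (g : cell) :
    option (mstate * cell * move * move) :=
  let: (pc, ph) := q in
  match ph with
  | (true, true) => Some (pcst 0 (false, false), (true, g.2), MoveS, MoveS)
  | (true, false) =>
      Some (if g.1 then (pcst pc (false, false), g, MoveS, MoveS)
            else (pcst pc (true, false), g, MoveS, MoveL))
  | (false, top) =>
      omap (fun i => if top then delta_top i pc g else delta_go i pc a g)
           (iopt prog pc)
  end.

Definition mach : TM :=
  {| tm_state := mstate; tm_work := cell;
     tm_blank := (false, [ffun=> None]); tm_start := pcst 0 (true, true);
     tm_accept := fun q => q.1 == size prog :> nat; tm_delta := delta |}.

Definition tape_of (s : store) (j : nat) : cell :=
  (j == 0, [ffun v => if j is j'.+1 then onth (rev (stk s v)) j' else None]).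

Definition holds (q : mstate) (s : store) p (c : config mach) :=
  [/\ cf_state c = q, cf_ipos c = ipos s, cf_tape c =1 tape_of s & cf_wpos c = p].

(** The last configuration is exempt from both conditions: it is covered as the first one of the
    next piece, and at the very end it must be allowed to halt. *)
Definition reaches b (c : config mach) k c' :=
  c' = iter k (step w) c /\
  forall i, i < k -> Defs.next w (iter i (step w) c) <> None
                  /\ cf_wpos (iter i (step w) c) <= b.

Lemma reaches_trans b c1 c2 c3 k1 k2 :
  reaches b c1 k1 c2 -> reaches b c2 k2 c3 -> reaches b c1 (k1 + k2) c3.
Proof.
move=> [-> h1] [-> h2]; split; first by rewrite addnC iterD.
move=> i lti; case: (ltnP i k1) => [|le]; first exact: h1.
have -> : i = (i - k1) + k1 by lia.
by rewrite iterD; apply: h2; lia.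
Qed.

Lemma holds_next q s p c :
  holds q s p c -> Defs.next w c = delta q (read_input w (ipos s)) (tape_of s p).
Proof. by case=> [eq ei et ep]; rewrite /Defs.next /= eq ei et ep. Qed.

Lemma holds_step b q s p c q' g mi mw s' p' :
  holds q s p c -> p <= b ->
  delta q (read_input w (ipos s)) (tape_of s p) = Some (q', g, mi, mw) ->
  move_input w mi (ipos s) = ipos s' -> move_work mw p = p' ->
  (forall j, (if j == p then g else tape_of s j) = tape_of s' j) ->
  exists2 c', reaches b c 1 c' & holds q' s' p' c'.
Proof.
move=> r le_p ed ei ew et; have en := holds_next r; rewrite ed in en.
have [e1 e2 e3 e4] := r.
exists (step w c).
  split=> // i; rewrite ltnS leqn0 => /eqP -> ; rewrite -[iter 0 _ _]/c en e4.
  by split.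
rewrite /step en; split; rewrite /= ?e2 ?e4 // => j.
by rewrite -et; case: eqP.
Qed.

Lemma same_tape s p j : (if j == p then tape_of s p else tape_of s j) = tape_of s j.
Proof. by case: eqP => [->|]. Qed.

Lemma step_home b pc s p c :
  holds (pcst pc (true, false)) s p c -> p <= b -> pc < (size prog).+2 ->
  exists2 c', reaches b c p.+1 c' & holds (pcst pc (false, false)) s 0 c'.
Proof.
elim: p c => [|p IH] c r le_p ltpc.
  apply: (holds_step (p' := 0) (s' := s) (mi := MoveS) (mw := MoveS) r _ _ _ _
            (same_tape s 0)) => //.
  by rewrite /= inordK.
have [|c1 r1 p1] := @holds_step b _ _ _ _ (pcst pc (true, false))
   (tape_of s p.+1) MoveS MoveL s p r le_p _ erefl erefl (same_tape s p.+1).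
  by rewrite /= inordK.
have [c2 r2 p2] := IH c1 p1 (ltnW le_p) ltpc.
by exists c2 => //; have := reaches_trans r1 r2; rewrite add1n.
Qed.

Definition track_of i : option V :=
  match i with
  | IAct (Push v _) | IAct (Pop v) | ITest (Top v _) _ => Some v
  | _ => None
  end.

Lemma tape_ofE s v j :
  (tape_of s j).2 v = if j is j'.+1 then onth (rev (stk s v)) j' else None.
Proof. by rewrite ffunE. Qed.

Lemma seek b i v pc s p c :
  holds (pcst pc (false, false)) s p c -> p <= (size (stk s v)).+1 ->
  iopt prog pc = Some i -> track_of i = Some v -> pc < (size prog).+2 ->
  size (stk s v) < b ->
  exists2 c', reaches b c ((size (stk s v)).+1 - p) c'
            & holds (pcst pc (false, false)) s (size (stk s v)).+1 c'.
Proof.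
move=> r le_p ei ti ltpc lt_b.
have [k ek] : exists k, (size (stk s v)).+1 - p = k by eexists.
rewrite ek; elim: k p c r le_p ek => [|k IH] p c r le_p ek.
  have -> : (size (stk s v)).+1 = p by lia.
  by exists c.
have [||c1 r1 p1] := @holds_step b _ _ _ _ (pcst pc (false, false))
   (tape_of s p) MoveS MoveR s p.+1 r _ _ erefl erefl (same_tape s p).
- by lia.
- have et : (tape_of s p).1 || ((tape_of s p).2 v != None).
    rewrite tape_ofE; case: (p) ek => [//|j] ek /=.
    have : onth (rev (stk s v)) j by rewrite onthTE size_rev; lia.
    by case: onth.
  rewrite /delta /pcst inordK // ei /=.
  case: i ei ti => [[v' x|v'|m]|[v' p'|p'] pc'|pc'] //= ei [->];
    by rewrite /delta_track et.
have [||c2 r2 p2] := IH _ _ p1; try lia.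
by exists c2 => //; have := reaches_trans r1 r2; rewrite add1n.
Qed.

Lemma end_blank s v : (tape_of s (size (stk s v)).+1).1 ||
  ((tape_of s (size (stk s v)).+1).2 v != None) = false.
Proof. by rewrite tape_ofE /= onth_default // size_rev. Qed.

Lemma top_cell s v : (tape_of s (size (stk s v))).2 v = ohead (stk s v).
Proof.
rewrite tape_ofE; case: (stk s v) => [//|x l] /=.
by rewrite rev_cons -cats1 onth_cat size_rev ltnn subnn.
Qed.

Lemma push_tape s v x j :
  (if j == (size (stk s v)).+1
   then ((tape_of s (size (stk s v)).+1).1,
         upd (tape_of s (size (stk s v)).+1).2 v (Some x))
   else tape_of s j) = tape_of (do_act (Push v x) s) j.
Proof.
case: eqP => [->|ne]; rewrite /tape_of /=; congr pair; apply/ffunP=> u;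
  rewrite !ffunE; case: eqP => [eu|//]; rewrite ?eu.
  by rewrite rev_cons -cats1 onth_cat size_rev ltnn subnn.
case: j ne => // j ne; rewrite rev_cons -cats1 onth_cat size_rev.
case: ltnP => // le; rewrite onth_default ?size_rev //.
by rewrite onth_default //=; lia.
Qed.

Lemma pop_tape s v j :
  (if j == size (stk s v)
   then ((tape_of s (size (stk s v))).1, upd (tape_of s (size (stk s v))).2 v None)
   else tape_of s j) = tape_of (do_act (Pop v) s) j.
Proof.
case: eqP => [->|ne]; rewrite /tape_of /=; congr pair; apply/ffunP=> u;
  rewrite !ffunE; case: eqP => [eu|//]; rewrite ?eu.
  by case: (stk s v) => //= x l; rewrite onth_default // size_rev.
case: j ne => // j; case: (stk s v) => //= x l ne.
rewrite rev_cons -cats1 onth_cat size_rev.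
case: ltnP => // le; rewrite [RHS]onth_default ?size_rev //.
by rewrite onth_default //=; lia.
Qed.

Definition istep i pc s : nat * store :=
  match i with
  | IAct a => (pc.+1, do_act a s)
  | ITest b pc' => (if ev_test b s then pc.+1 else pc', s)
  | IJump pc' => (pc', s)
  end.

(** The constant [2 * H + 6] pays for a sweep to the free end of a track, a step back, the action,
    and a sweep home; each sweep crosses at most [H.+1] cells. *)
Lemma instr_ok i pc s c :
  holds (pcst pc (false, false)) s 0 c -> fits s -> iopt prog pc = Some i ->
  pc < (size prog).+1 -> (istep i pc s).1 < (size prog).+2 ->
  exists k c', [/\ reaches H.+1 c k c', k <= (2 * H) + 6 &
    holds (pcst (istep i pc s).1 (false, false)) (istep i pc s).2 0 c'].
Proof.
move=> r fs ei ltpc; have ltpc' : pc < (size prog).+2 by lia.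
have one q s' mi : 
    delta (pcst pc (false, false)) (read_input w (ipos s)) (tape_of s 0)
      = Some (q, tape_of s 0, mi, MoveS) ->
    move_input w mi (ipos s) = ipos s' -> stk s' = stk s ->
    exists k c', [/\ reaches H.+1 c k c', k <= (2 * H) + 6 & holds q s' 0 c'].
  move=> ed em es.
  have [||c1 r1 p1] := holds_step (b := H.+1) r _ ed em erefl _ => //.
    by move=> j; rewrite same_tape /tape_of es.
  by exists 1, c1; split=> //; lia.
(* The tail shared by the three instructions that touch a track: return home and add up the
   steps. *)
have fin v q s' p c1 : p <= size (stk s v) -> holds (pcst q (true, false)) s' p c1 ->
    (exists2 k, k <= (size (stk s v)).+3 & reaches H.+1 c k c1) -> q < (size prog).+2 ->
    exists k c', [/\ reaches H.+1 c k c', k <= (2 * H) + 6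
        & holds (pcst q (false, false)) s' 0 c'].
  move=> le_p p1 [k le_k r1] ltq; have := fs v => le_v.
  have [|c2 r2 p2] := step_home (b := H.+1) p1 _ ltq; first by lia.
  exists (k + p.+1), c2; split=> //; last by lia.
  exact: reaches_trans r1 r2.
case: (track_of i =P None) => [|/eqP]; last first.
  case ti: (track_of i) => [v|] // _; have := fs v => le_v.
  have [//|//|c1 r1 p1] := seek (b := H.+1) r _ ei ti ltpc'.
  rewrite subn0 in r1; have e1 := end_blank s v.
  have top : (forall x, i <> IAct (Push v x)) ->
    exists2 c2, reaches H.+1 c (size (stk s v)).+2 c2
              & holds (pcst pc (false, true)) s (size (stk s v)) c2.
    move=> ni; have [||c2 r2 p2] := holds_step (b := H.+1) p1 _ _ erefl erefl
      (same_tape s (size (stk s v)).+1) (q' := pcst pc (false, true)) (mi := MoveS)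
      (mw := MoveL).
    - by [].
    - rewrite /delta /pcst inordK // ei /=.
      case: i ei ti ni => [[v' x|v'|m]|[v' p'|p'] pc'|pc'] //= ei [->] ni;
      by [case: (ni x)|rewrite /delta_track e1].
    by exists c2 => //; have := reaches_trans r1 r2; rewrite addn1.
  case: i ei ti top => [[v' x|v'|m]|[v' p'|p'] pc'|pc'] //= ei [ev] top ltq;
    rewrite ev in ei ltq *.
  - have [||c2 r2 p2] := holds_step (b := H.+1) p1 _ _ erefl erefl
      (push_tape s v x) (s' := do_act (Push v x) s) (q' := pcst pc.+1 (true, false)) (mi := MoveS) (mw := MoveL).
    + by [].
    + by rewrite /delta /pcst inordK // ei /= /delta_track e1.
    apply: (fin v _ _ _ c2) p2 _ _ => //; exists ((size (stk s v)).+2) => //.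
    by have := reaches_trans r1 r2; rewrite addn1.
  - have [//|c1' r1' p1'] := top.
    have [||c2 r2 p2] := holds_step (b := H.+1) p1' _ _ erefl erefl
      (pop_tape s v) (s' := do_act (Pop v) s) (q' := pcst pc.+1 (true, false)) (mi := MoveS) (mw := MoveS).
    + by lia.
    + by rewrite /delta /pcst inordK // ei.
    apply: (fin v _ _ _ c2) p2 _ _ => //; exists ((size (stk s v)).+3) => //.
    by have := reaches_trans r1' r2; rewrite addn1.
  - have [//|c1' r1' p1'] := top.
    have [||c2 r2 p2] := holds_step (b := H.+1) p1' _ _ erefl erefl
      (same_tape s (size (stk s v))) (mi := MoveS) (mw := MoveS)
      (q' := pcst (if p' (ohead (stk s v)) then pc.+1 else pc') (true, false)).
    + by lia.
    + by rewrite /delta /pcst inordK // ei /= top_cell.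
    apply: (fin v _ _ _ c2) p2 _ _ => //; exists ((size (stk s v)).+3) => //.
    by have := reaches_trans r1' r2; rewrite addn1.
move=> ti; case: i ei ti => [[v' x|v'|m]|[v' p'|p'] pc'|pc'] //= ei _ ltq.
- by apply: (one _ _ m); rewrite // /delta /pcst inordK // ei.
- by apply: (one _ _ MoveS); rewrite // /delta /pcst inordK // ei.
- by apply: (one _ _ MoveS); rewrite // /delta /pcst inordK // ei.
Qed.

Definition goes pc s n pc' s' := forall c, holds (pcst pc (false, false)) s 0 c ->
  exists k c', [/\ reaches H.+1 c k c', k <= n * (2 * H + 6) &
    holds (pcst pc' (false, false)) s' 0 c'].

Lemma goes_trans pc1 s1 n1 pc2 s2 n2 pc3 s3 :
  goes pc1 s1 n1 pc2 s2 -> goes pc2 s2 n2 pc3 s3 -> goes pc1 s1 (n1 + n2) pc3 s3.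
Proof.
move=> g1 g2 c /g1[k1 [c1 [r1 le1 /g2[k2 [c2 [r2 le2 p2]]]]]].
exists (k1 + k2), c2; split=> //; last by rewrite mulnDl leq_add.
exact: reaches_trans r1 r2.
Qed.

Lemma goes_instr l1 i l2 s : prog = l1 ++ i :: l2 -> fits s ->
  (istep i (size l1) s).1 <= (size prog).+1 ->
  goes (size l1) s 1 (istep i (size l1) s).1 (istep i (size l1) s).2.
Proof.
move=> ep fs le c r.
have [|||k [c' [h1 h2 h3]]] := instr_ok r fs (i := i).
- by rewrite [X in iopt X _]ep iopt_cat.
- by rewrite ep size_cat /=; lia.
- by [].
by exists k, c'; split=> //; rewrite mul1n.
Qed.

(** The context [l1], [l2] is quantified inside the induction because a subcommand runs in place,
    within the code of the whole program. *)
Lemma goes_exec c s t s' : exec c s t s' -> fits s -> forall l1 l2,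
  prog = l1 ++ compile (size l1) c ++ l2 ->
  goes (size l1) s t (size l1 + clen c) s' /\ fits s'.
Proof.
elim=> {c s t s'} /=.
- move=> s fs l1 l2 _; split=> // c r; exists 0, c; split=> //.
  by rewrite addn0.
- move=> a s fs' fs l1 l2 ep; split=> //; rewrite addn1.
  apply: (goes_instr (i := IAct a) (l2 := l2)) => //=.
  by rewrite ep size_cat /=; lia.
- move=> c1 c2 s1 s2 s3 t1 t2 _ IH1 _ IH2 fs l1 l2.
  rewrite -catA => ep; have [g1 f1] := IH1 fs _ _ ep.
  have [|g2 f2] := IH2 f1 (l1 ++ compile (size l1) c1) l2.
    by rewrite size_cat size_compile -catA.
  split=> //; rewrite addnA; apply: goes_trans g1 _.
  by rewrite size_cat size_compile in g2.
- move=> b c1 c2 s1 s2 t hb _ IH fs l1 l2 ep.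
  have := goes_instr ep fs; rewrite /= hb => /(_ _) g0.
  have [|g1 f1] := IH fs (rcons l1 (ITest b (size l1 + clen c1).+2))
    (IJump (size l1 + clen c1 + clen c2).+2 :: compile (size l1 + clen c1).+2 c2 ++ l2).
    by rewrite size_rcons cat_rcons ep /= -catA.
  split=> //; rewrite size_rcons in g1.
  have sp : size prog = size l1 + (clen c1 + clen c2).+2 + size l2.
    by rewrite ep !size_cat /= !size_cat /= !size_compile; lia.
  have g2 : goes (size l1 + (clen c1).+1) s2 1 (size l1 + clen c1 + clen c2).+2 s2.
    have := @goes_instr (l1 ++ ITest b (size l1 + clen c1).+2 ::
      compile (size l1).+1 c1) (IJump (size l1 + clen c1 + clen c2).+2)
      (compile (size l1 + clen c1).+2 c2 ++ l2) s2.
    rewrite size_cat /= size_compile; apply=> //; last by rewrite sp; lia.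
    by rewrite ep -catA /= -catA.
  have -> : t.+2 = 1 + (t + 1) by lia.
  apply: goes_trans (g0 _) _; first by rewrite sp; lia.
  apply: goes_trans g1 _.
  have -> : (size l1).+1 + clen c1 = size l1 + (clen c1).+1 by lia.
  by have -> : size l1 + (clen c1 + clen c2).+2
     = (size l1 + clen c1 + clen c2).+2 by lia.
- move=> b c1 c2 s1 s2 t hb _ IH fs l1 l2 ep.
  have := goes_instr ep fs; rewrite /= (negbTE hb) => /(_ _) g0.
  have sp : size prog = size l1 + (clen c1 + clen c2).+2 + size l2.
    by rewrite ep !size_cat /= !size_cat /= !size_compile; lia.
  have [|g1 f1] := IH fs (l1 ++ ITest b (size l1 + clen c1).+2 ::
      rcons (compile (size l1).+1 c1) (IJump (size l1 + clen c1 + clen c2).+2)) l2.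
    rewrite size_cat /= size_rcons size_compile !addnS ep -(catA l1) /= cat_rcons.
    by rewrite -catA.
  split=> //; rewrite -add1n; apply: goes_trans (g0 _) _; first by rewrite sp; lia.
  rewrite size_cat /= size_rcons size_compile in g1.
  have -> : (size l1 + clen c1).+2 = size l1 + (clen c1).+2 by lia.
  by have -> : size l1 + (clen c1 + clen c2).+2
     = size l1 + (clen c1).+2 + clen c2 by lia.
- move=> b c s hb fs l1 l2 ep; split=> //.
  have := goes_instr ep fs; rewrite /= (negbTE hb) => /(_ _) g0.
  have -> : size l1 + (clen c).+2 = (size l1 + clen c).+2 by lia.
  by apply: g0; rewrite ep !size_cat /= !size_cat size_compile /=; lia.
move=> b c s1 s2 s3 t1 t2 hb _ IH1 _ IH2 fs l1 l2 ep.
have sp : size prog = size l1 + (clen c).+2 + size l2.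
  by rewrite ep !size_cat /= !size_cat /= !size_compile /=; lia.
have := goes_instr ep fs; rewrite /= hb => /(_ _) g0.
have [|g1 f1] := IH1 fs (rcons l1 (ITest b (size l1 + clen c).+2))
    (IJump (size l1) :: l2).
  by rewrite size_rcons cat_rcons ep /= -catA.
have [g3 f3] := IH2 f1 _ _ ep; split=> //.
have g2 : goes (size l1 + (clen c).+1) s2 1 (size l1) s2.
  have := @goes_instr (l1 ++ ITest b (size l1 + clen c).+2 ::
      compile (size l1).+1 c) (IJump (size l1)) l2 s2.
  rewrite size_cat /= size_compile; apply=> //; last by rewrite sp; lia.
  by rewrite ep -catA /= -catA.
have -> : (t1 + t2).+2 = 1 + (t1 + (1 + t2)) by lia.
apply: goes_trans (g0 _) _; first by rewrite sp; lia.
rewrite size_rcons in g1; apply: goes_trans g1 _.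
apply: goes_trans g3.
by have -> : (size l1).+1 + clen c = size l1 + (clen c).+1 by lia.
Qed.

End Program.

Definition init_store := Store [ffun=> [::]] 0.

(** The closing test leads to one of two addresses beyond the code: [size prog], which accepts, or
    its successor, which rejects. Neither holds an instruction, so both halt; this is why the
    control has [(size prog).+2] addresses. *)
Definition decider c b := mach (compile 0 c ++ [:: ITest b (clen c).+2]).

Lemma decider_run c b t s' : exec c init_store t s' ->
  exists T, [/\ T <= t.+2 * (2 * H + 6), halts_at (decider c b) w T,
                space_within (decider c b) w T (H.+2)
              & accepts_at (decider c b) w T = ev_test b s'].
Proof.
move=> ex; set prog := compile 0 c ++ [:: ITest b (clen c).+2].
have sp : size prog = (clen c).+1 by rewrite size_cat size_compile addn1.
have f0 : fits init_store by move=> v; rewrite ffunE.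
have [g1 f1] := goes_exec ex f0 (l1 := [::]) (erefl prog).
have g2 : goes prog (clen c) s' 1 (if ev_test b s' then (clen c).+1 else (clen c).+2) s'.
  have := @goes_instr prog (compile 0 c) (ITest b (clen c).+2) [::] s'.
  by rewrite /= sp size_compile; apply=> //; case: ifP.
(* The very first step only writes the home mark. It and the closing test account for the two extra
   units in [t.+2]. *)
have [c1 [r1 e1]] : exists c1, reaches H.+1 (init_config (mach prog)) 1 c1 /\
   holds (pcst prog 0 (false, false)) init_store 0 c1.
  exists (step w (init_config (mach prog))); split; first by split=> // -[].
  split=> //= j; rewrite /tape_of; case: j => [|j] /=; congr pair;
    by apply/ffunP => v; rewrite !ffunE ?onth0n.
have [k [c2 [r2 le2 p2]]] := goes_trans g1 g2 e1.
have [e2 ne2] := reaches_trans r1 r2.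
have nn : Defs.next w c2 = None.
  rewrite (holds_next p2) /= /pcst inordK; last by rewrite sp; case: ifP.
  by rewrite /iopt drop_oversize //= sp; case: ifP => _ //; lia.
exists (1 + k); split.
- lia.
- by split; [move=> t' /ne2[]|rewrite /run -e2].
- move=> t'; rewrite leq_eqVlt => /orP[/eqP->|/ne2[] //].
  by rewrite /run -e2; case: p2 => _ _ _ ->.
rewrite /accepts_at /run -e2 /=; case: p2 => -> _ _ _ /=.
rewrite inordK; last by rewrite sp; case: ifP.
by rewrite sp; case: ifP => _; rewrite ?eqxx //; lia.
Qed.

End StackLanguage.

(** * Binary counters *)

(* Bijective base-2 numerals, least significant digit first: [false] is the
   digit 1, [true] the digit 2, and zero is the empty numeral. *)
Fixpoint incb (s : seq bool) : seq bool :=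
  match s with
  | [::] => [:: false]
  | false :: s' => true :: s'
  | true :: s' => false :: incb s'
  end.

Fixpoint decb (s : seq bool) : seq bool :=
  match s with
  | [::] | [:: false] => [::]
  | false :: s' => true :: decb s'
  | true :: s' => false :: s'
  end.

Definition bin n := iter n incb [::].

Fixpoint bval (s : seq bool) : nat := if s is b :: s' then 1 + b + 2 * bval s' else 0.

Lemma incbK : cancel incb decb.
Proof.
elim=> [//|[] s IH] //=; have : incb s != [::] by case: s {IH} => [|[]].
by case: (incb s) IH => [|c l] //= ->.
Qed.

Lemma bin_pred n : bin n.-1 = decb (bin n).
Proof. by case: n => [|n] //=; rewrite incbK. Qed.

Lemma bval_bin n : bval (bin n) = n.
Proof.
have bi s : bval (incb s) = (bval s).+1 by elim: s => [|[] s IH] /=; lia.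
by elim: n => //= n IH; rewrite bi IH.
Qed.

(** This is the gain of bijective numerals: without leading zeros, a zero test only looks at the top
    symbol of the stack. *)
Lemma bin_eq0 n : (bin n == [::]) = (n == 0).
Proof. by rewrite -{2}(bval_bin n); case: (bin n). Qed.

(** The least value with k digits has all digits 1 and equals 2^k - 1. *)
Lemma size_bin n : size (bin n) <= trunc_log 2 n.+1.
Proof.
apply: trunc_log_max => //; rewrite -{2}(bval_bin n).
by elim: (bin n) => //= b s IH; rewrite expnS; case: b; lia.
Qed.

Lemma true_prefix (s : seq bool) b :
  exists k r, s = nseq k b ++ r /\ ohead r <> Some b.
Proof.
elim: s => [|c s [k [r [-> h]]]]; first by exists 0, [::].
have [->|/eqP ne] := c =P b; first by exists k.+1, r.
by exists 0, (c :: nseq k b ++ r); split=> //= -[/eqP]; rewrite (negbTE ne).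
Qed.

(** * Counter arithmetic on raw stacks *)

Section Raw.
Variables (V : finType) (w : seq isym) (H : nat).
Implicit Types (c : cmd V) (s : store V).

Definition does c s n s' := exists2 t, t <= n & exec w H c s t s'.

Lemma does_le c s n n' s' : does c s n s' -> n <= n' -> does c s n' s'.
Proof. by case=> t le ex le'; exists t => //; apply: leq_trans le'. Qed.

Lemma does_seq c1 c2 s1 n1 s2 n2 s3 :
  does c1 s1 n1 s2 -> does c2 s2 n2 s3 -> does (Seq c1 c2) s1 (n1 + n2) s3.
Proof.
by case=> t1 l1 e1 [t2 l2 e2]; exists (t1 + t2); [exact: leq_add|exact: XSeq e1 e2].
Qed.

Lemma does_act a s : fits H (do_act w a s) -> does (Act a) s 1 (do_act w a s).
Proof. by exists 1 => //; exact: XAct. Qed.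

Lemma does_skip s : does (Skip V) s 0 s.
Proof. by exists 0 => //; exact: XSkip. Qed.

Lemma does_if b c1 c2 s n s' :
  (if ev_test w b s then does c1 s n s' else does c2 s n s') ->
  does (If b c1 c2) s n.+2 s'.
Proof.
case: ifP => hb [t le ex]; first by exists t.+2 => //; exact: XIfT.
by exists t.+1; [lia|apply: XIfF => //; rewrite hb].
Qed.

Lemma does_whileF b c s : ~~ ev_test w b s -> does (While b c) s 1 s.
Proof. by exists 1 => //; exact: XWhileF. Qed.

Lemma does_whileT b c s1 n1 s2 n2 s3 : ev_test w b s1 ->
  does c s1 n1 s2 -> does (While b c) s2 n2 s3 ->
  does (While b c) s1 (n1 + n2).+2 s3.
Proof.
move=> hb [t1 l1 e1] [t2 l2 e2]; exists (t1 + t2).+2; first by lia.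
exact: XWhileT hb e1 e2.
Qed.

Definition set s v l := Store (upd (stk s) v l) (ipos s).

Lemma fits_set s v l : fits H s -> size l <= H -> fits H (set s v l).
Proof. by move=> fs le u; rewrite /set /= ffunE; case: ifP. Qed.

Lemma stk_set s v l u : stk (set s v l) u = if u == v then l else stk s u.
Proof. by rewrite /set ffunE. Qed.

Lemma set_set s v l l' : set (set s v l) v l' = set s v l'.
Proof.
by rewrite /set; congr Store; apply/ffunP=> u; rewrite !ffunE; case: (u == v).
Qed.

Lemma setC s v l u l' : u != v -> set (set s v l) u l' = set (set s u l') v l.
Proof.
move=> ne; rewrite /set; congr Store; apply/ffunP=> x; rewrite !ffunE; case: eqP => // ->.
by rewrite (negbTE ne).
Qed.

Lemma set_id s v : set s v (stk s v) = s.
Proof.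
case: s => f p; rewrite /set; congr Store; apply/ffunP=> u; rewrite !ffunE /=.
by case: eqP => // ->.
Qed.

Definition is_digit (o : option sym) := if o is Some (Some _) then true else false.

Lemma stk_set_same s v l : stk (set s v l) v = l.
Proof. by rewrite stk_set eqxx. Qed.

Lemma stk_set_other s v l u : u != v -> stk (set s v l) u = stk s u.
Proof. by rewrite stk_set => /negbTE->. Qed.

Lemma does_push s v x : fits H s -> size (stk s v) < H ->
  does (Act (Push v x)) s 1 (set s v (x :: stk s v)).
Proof. by move=> fs lt; apply: (does_act (a := Push v x)); exact: fits_set. Qed.

Lemma does_pop s v : fits H s ->
  does (Act (Pop v)) s 1 (set s v (behead (stk s v))).
Proof.
move=> fs; apply: (does_act (a := Pop v)); apply: fits_set => //.
by rewrite size_behead (leq_trans (leq_pred _)).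
Qed.

Lemma shift_loop s (a b : V) (p : pred (option sym)) x k y r : a != b -> fits H s ->
  p (Some (Some x)) -> ~~ p (ohead r) ->
  stk s a = nseq k (Some x) ++ r -> size (stk s b) + k <= H ->
  does (While (Top a p) (Seq (Act (Pop a)) (Act (Push b y)))) s (4 * k + 1)
    (set (set s a r) b (nseq k y ++ stk s b)).
Proof.
move=> ne; have nba : b != a by rewrite eq_sym.
elim: k s => [|k IH] s fs px pr ea le.
  by move: ea => /= ea; rewrite -ea !set_id; apply: does_whileF; rewrite /= ea.
have le_n : 2 + (4 * k + 1) + 2 <= 4 * k.+1 + 1 by lia.
apply: does_le le_n; rewrite addn2.
have f1 : fits H (set s a (nseq k (Some x) ++ r)).
  by apply: fits_set => //; move: (fs a); rewrite ea /=; lia.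
have f2 : fits H (set (set s a (nseq k (Some x) ++ r)) b (y :: stk s b)).
  by apply: fits_set => //=; lia.
apply: does_whileT.
- by rewrite /= ea.
- apply: (does_seq (n1 := 1) (n2 := 1)); first exact: does_pop.
  apply: does_push; rewrite ea ?stk_set_other //=; lia.
rewrite ea stk_set_other //=.
have := IH _ f2 px pr; rewrite stk_set_other // !stk_set_same => /(_ erefl) /=.
rewrite (setC _ _ _ ne) !set_set.
rewrite !cat_nseq /ncons -iterSr iterS; apply; lia.
Qed.
Definition eqd b (o : option sym) := o == Some (Some b).

Definition shift (v u : V) p y := While (Top v p) (Seq (Act (Pop v)) (Act (Push u (Some y)))).

(** The carry turns the leading 2s into 1s while they move to [u]; the next digit is raised, or a
    digit 1 is appended, and the prefix moves back. Passing through [u] reverses it, which is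
    invisible because it is constant. *)
Definition inc_cmd (v u : V) : cmd V :=
  Seq (shift v u (eqd true) false)
 (Seq (If (Top v (eqd false)) (Seq (Act (Pop v)) (Act (Push v (Some true))))
          (Act (Push v (Some false))))
      (shift u v is_digit false)).

(** The borrow turns leading 1s into 2s. If no 2 follows, the numeral consisted of 1s only and its
    predecessor is one digit shorter, hence the pop of [u]; for zero that pop meets an empty stack,
    so zero stays zero. *)
Definition dec_cmd (v u : V) : cmd V :=
  Seq (shift v u (eqd false) true)
 (Seq (If (Top v (eqd true)) (Seq (Act (Pop v)) (Act (Push v (Some false))))
          (Act (Pop u)))
      (shift u v is_digit true)).

Lemma incb_prefix k l :
  incb (nseq k true ++ l) =
  nseq k false ++ (if l is false :: l' then true :: l' else incb l).
Proof. by elim: k => /= [|k ->] //; case: l => [|[]]. Qed.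

Lemma decb_prefix k l : ohead l <> Some false ->
  decb (nseq k false ++ l) =
  if l is true :: l' then nseq k true ++ false :: l' else nseq k.-1 true.
Proof.
case: l => [|[] l] //= _; last first.
  elim: k => // k IH /=; rewrite {}IH; by case: k.
by elim: k => //= k ->; case: k.
Qed.

Lemma set_back s (u v : V) a b e d : v != u -> stk s u = [::] ->
  set (set (set (set (set s v a) u b) v e) u [::]) v d = set s v d.
Proof.
move=> ne eu; rewrite /set; congr Store; apply/ffunP=> x; rewrite !ffunE.
by case: (x =P v) => // _; case: (x =P u) => // ->; rewrite eu.
Qed.

Lemma inc_cmdP s (v u : V) l r : v != u -> fits H s -> stk s u = [::] ->
  stk s v = map Some l ++ r -> ~~ is_digit (ohead r) -> size (stk s v) < H ->
  does (inc_cmd v u) s (8 * H + 10) (set s v (map Some (incb l) ++ r)).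
Proof.
move=> ne fs eu ev hr lt; have ne' : u != v by rewrite eq_sym.
have [k [l' [el hl]]] := true_prefix l true.
move: ev; rewrite el incb_prefix !map_cat !map_nseq -!catA => ev.
have lt' : k + (size l' + size r) < H.
  by move: lt; rewrite ev !size_cat size_map size_nseq.
set r1 := map Some l' ++ r in ev.
have nr1 : ~~ eqd true (ohead r1).
  rewrite /r1; case: (l') hl => [_|b l2] /=; first by case: (ohead r) hr => [[[]|]|].
  by case: b.
have le_u : size (stk s u) + k <= H by rewrite eu /=; lia.
have d1 := shift_loop (x := true) (p := eqd true) (Some false) ne fs isT nr1 ev le_u.
rewrite eu cats0 in d1.
have fs1 : fits H (set (set s v r1) u (nseq k (Some false))).
  apply: fits_set; first apply: fits_set => //; rewrite /r1 ?size_cat ?size_map ?size_nseq; lia.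
set s1 := (set _ u _) in d1 fs1.
set y := (if l' is false :: _ then _ else _).
have d2 : does (If (Top v (eqd false)) (Seq (Act (Pop v)) (Act (Push v (Some true))))
    (Act (Push v (Some false)))) s1 4 (set s1 v (map Some y ++ r)).
  have e1 : stk s1 v = r1 by rewrite /s1 stk_set_other // stk_set_same.
  move: hl e1 lt'; rewrite /y /r1; case: (l') => [|[] l2] //= _ e1 lt'';
    apply: (does_if (n := 2)); rewrite /= e1 /=.
    have -> : eqd false (ohead r) = false by case: (ohead r) hr => [[[]|]|].
    apply: (does_le (n := 1)) => //.
    have := does_push (v := v) (Some false) fs1; rewrite e1; apply=> /=; lia.
  apply: (does_seq (n1 := 1) (n2 := 1)); first exact: does_pop.
  have := @does_push (set s1 v (behead (stk s1 v))) v (Some true).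
  rewrite stk_set_same set_set e1 /=; apply; last by rewrite size_cat size_map; lia.
  by apply: fits_set => //; rewrite size_cat size_map; lia.
have le_y : k + size (map Some y ++ r) <= H.
  by rewrite size_cat size_map /y; move: hl; case: (l') lt' => [|[] l2] //= *; lia.
have fs2 : fits H (set s1 v (map Some y ++ r)) by apply: fits_set => //; lia.
have := shift_loop (s := set s1 v (map Some y ++ r)) (x := false) (k := k)
   (r := [::]) (p := is_digit) (Some false) ne' fs2 isT isT.
rewrite cats0 stk_set_other // stk_set_same stk_set_same => /(_ erefl) d3.
have -> : set s v (nseq k (Some false) ++ map Some y ++ r) =
   set (set (set s1 v (map Some y ++ r)) u [::]) v
     (nseq k (Some false) ++ map Some y ++ r) by rewrite set_back.
apply: (does_le (n := (4 * k + 1) + (4 + (4 * k + 1)))); last by lia.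
apply: does_seq d1 (does_seq d2 (d3 _)); lia.
Qed.

Lemma dec_cmdP s (v u : V) l r : v != u -> fits H s -> stk s u = [::] ->
  stk s v = map Some l ++ r -> ~~ is_digit (ohead r) ->
  does (dec_cmd v u) s (8 * H + 10) (set s v (map Some (decb l) ++ r)).
Proof.
move=> ne fs eu ev hr; have ne' : u != v by rewrite eq_sym.
have [k [l' [el hl]]] := true_prefix l false.
have := fs v; move: ev; rewrite el decb_prefix // !map_cat !map_nseq -!catA => ev.
rewrite ev !size_cat size_map size_nseq => lt'.
set r1 := map Some l' ++ r in ev.
have nr1 : ~~ eqd false (ohead r1).
  rewrite /r1; case: (l') hl => [_|b l2] /=; first by case: (ohead r) hr => [[[]|]|].
  by case: b.
have le_u : size (stk s u) + k <= H by rewrite eu /=; lia.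
have d1 := shift_loop (x := false) (p := eqd false) (Some true) ne fs isT nr1 ev le_u.
rewrite eu cats0 in d1.
have fs1 : fits H (set (set s v r1) u (nseq k (Some true))).
  apply: fits_set; first apply: fits_set => //; rewrite /r1 ?size_cat ?size_map ?size_nseq; lia.
set s1 := (set _ u _) in d1 fs1.
have e1 : stk s1 v = r1 by rewrite /s1 stk_set_other // stk_set_same.
have e2 : stk s1 u = nseq k (Some true) by rewrite /s1 stk_set_same.
(* Both outcomes of the borrow in one form: [y] is what remains on [v], and [j] is the number of 2s
   to be moved back from [u]. *)
have [y [j [ey le_j d2]]] : exists y j,
    [/\ map Some (if l' is true :: l2 then nseq k true ++ false :: l2 else nseq k.-1 true)
          ++ r = nseq j (Some true) ++ y, j + size y <= H &
     does (If (Top v (eqd true)) (Seq (Act (Pop v)) (Act (Push v (Some false))))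
       (Act (Pop u))) s1 4 (set (set s1 v y) u (nseq j (Some true)))].
  move: hl e1 lt'; rewrite /r1; case: (l') => [|[] l2] //= _ e1 lt''.
    exists r, k.-1; rewrite map_nseq; split=> //; first by lia.
    apply: (does_if (n := 2)); rewrite /= e1 /=.
    have -> : eqd true (ohead r) = false by case: (ohead r) hr => [[[]|]|].
    apply: (does_le (n := 1)) => //; have := does_pop u fs1.
    by rewrite e2 -[in X in _ -> X]e1 set_id; case: (k).
  exists (map Some (false :: l2) ++ r), k; rewrite map_cat map_nseq -catA; split=> //.
    by rewrite /= size_cat size_map; lia.
  apply: (does_if (n := 2)); rewrite /= e1 /= -e2.
  rewrite -(stk_set_other s1 (Some false :: [seq Some i | i <- l2] ++ r) ne') set_id.
  apply: (does_seq (n1 := 1) (n2 := 1)); first exact: does_pop.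
  have := @does_push (set s1 v (behead (stk s1 v))) v (Some false).
  rewrite stk_set_same set_set e1 /=; apply; last by rewrite size_cat size_map; lia.
  by apply: fits_set => //; rewrite size_cat size_map; lia.
have fs2 : fits H (set (set s1 v y) u (nseq j (Some true))).
  by apply: fits_set; first apply: fits_set => //; rewrite ?size_nseq; lia.
have := shift_loop (s := set (set s1 v y) u (nseq j (Some true))) (x := true) (k := j)
   (r := [::]) (p := is_digit) (Some true) ne' fs2 isT isT.
rewrite cats0 stk_set_same stk_set_other // stk_set_same set_set => /(_ erefl) d3.
have -> : set s v (map Some (if l' is true :: l2 then nseq k true ++ false :: l2 else nseq k.-1 true) ++ r) =
   set (set (set s1 v y) u [::]) v (nseq j (Some true) ++ y) by rewrite ey set_back.
apply: (does_le (n := (4 * k + 1) + (4 + (4 * j + 1)))); last by lia.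
apply: does_seq d1 (does_seq d2 (d3 _)); lia.
Qed.

End Raw.

(** * Stacks of natural numbers *)

Lemma upd_upd (V : finType) T (f : {ffun V -> T}) v x y :
  upd (upd f v x) v y = upd f v y.
Proof. by apply/ffunP=> u; rewrite !ffunE; case: (u == v). Qed.

Lemma updC (V : finType) T (f : {ffun V -> T}) v x u y :
  u != v -> upd (upd f v x) u y = upd (upd f u y) v x.
Proof.
by move=> ne; apply/ffunP=> z; rewrite !ffunE; case: eqP => // ->; rewrite (negbTE ne).
Qed.

Lemma upd_id (V : finType) T (f : {ffun V -> T}) v : upd f v (f v) = f.
Proof. by apply/ffunP=> z; rewrite !ffunE; case: eqP => // ->. Qed.

Section NatStacks.
Variables (V : finType) (w : seq isym) (u0 : V) (Bv Dp : nat).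

(* Every track stores a nonempty stack of naturals, [(top, rest)]. *)
Notation env := {ffun V -> nat * seq nat}.
Implicit Types (F : env) (v u : V) (p : nat).

Definition enc1 (a : nat * seq nat) : seq sym :=
  map Some (bin a.1) ++ flatten [seq None :: map Some (bin k) | k <- a.2].

Definition enc (F : env) p : store V := Store [ffun v => enc1 (F v)] p.

Definition height := Dp.+1 * (trunc_log 2 Bv.+1).+1.+1.

Definition okn (a : nat * seq nat) :=
  [&& a.1 <= Bv, size a.2 <= Dp & all (fun k => k <= Bv) a.2].

(** Track [u0] is the auxiliary stack of increments and decrements; it is empty between commands. *)
Definition okF (F : env) := F u0 = (0, [::]) /\ forall v, okn (F v).

(** Strictness leaves a free cell for a new digit or a separator, so [fits] survives each push. *)
Lemma size_enc1 a : okn a -> size (enc1 a) < height.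
Proof.
case: a => x l /and3P[/= hx hl /allP al].
have sb y : y <= Bv -> size (bin y) <= trunc_log 2 Bv.+1.
  by move=> le; rewrite (leq_trans (size_bin y)) // leq_trunc_log.
rewrite /enc1 size_cat size_map /= /height.
have : size (flatten [seq None :: [seq Some i | i <- bin k] | k <- l])
   <= size l * (trunc_log 2 Bv.+1).+1.
  elim: l al {hl} => //= y l IH al; rewrite size_cat size_map mulSn -addSn leq_add //.
    by rewrite ltnS sb // al // mem_head.
  by apply: IH => z hz; rewrite al // inE hz orbT.
move: (sb x hx) (leq_mul hl (leqnn (trunc_log 2 Bv.+1).+1)).
set t := trunc_log _ _; set f := size (flatten _).
rewrite mulSn [Dp * t.+2]mulnS; lia.
Qed.

Lemma fits_enc F p : okF F -> fits height (enc F p).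
Proof. by case=> _ h v; rewrite ffunE ltnW // size_enc1. Qed.

Lemma okF_upd F v a : okF F -> v != u0 -> okn a -> okF (upd F v a).
Proof.
case=> e h ne ha; split; first by rewrite upd_other // eq_sym.
by move=> z; rewrite ffunE; case: ifP.
Qed.

Lemma set_enc F p v a : set (enc F p) v (enc1 a) = enc (upd F v a) p.
Proof. by congr Store; apply/ffunP=> z; rewrite !ffunE; case: ifP. Qed.

(** Validity of the environment is both premise and conclusion, so that it passes through sequences
    without side conditions. *)
Definition run c F p n F' p' :=
  okF F -> does w height c (enc F p) n (enc F' p') /\ okF F'.

Lemma run_le c F p n n' F' p' : run c F p n F' p' -> n <= n' -> run c F p n' F' p'.
Proof. by move=> r le /r[d o]; split=> //; apply: does_le le. Qed.

Lemma run_seq c1 c2 F1 p1 n1 F2 p2 n2 F3 p3 :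
  run c1 F1 p1 n1 F2 p2 -> run c2 F2 p2 n2 F3 p3 ->
  run (Seq c1 c2) F1 p1 (n1 + n2) F3 p3.
Proof. by move=> r1 r2 /r1[d1 /r2[d2 o]]; split=> //; apply: does_seq d1 d2. Qed.

Definition Nz v : test V := Top v is_digit.

Lemma digit_rest (l : seq nat) :
  ~~ is_digit (ohead (flatten [seq None :: [seq Some i | i <- bin k] | k <- l])).
Proof. by case: l. Qed.

Lemma ev_Nz F p v : ev_test w (Nz v) (enc F p) = (0 < (F v).1).
Proof.
rewrite /= ffunE /enc1 lt0n -bin_eq0.
by case: (bin _) => //=; apply/negbTE/digit_rest.
Qed.

Definition cK := 8 * height + 10.

Definition Inc v := inc_cmd v u0.
Definition Dec v := dec_cmd v u0.
Definition PushV v : cmd V := Act (Push v None).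
Definition Clear v : cmd V := While (Nz v) (Act (Pop v)).
Definition PopV v : cmd V := Seq (Clear v) (Act (Pop v)).

Lemma run_inc F p v : v != u0 -> (F v).1 < Bv ->
  run (Inc v) F p cK (upd F v ((F v).1.+1, (F v).2)) p.
Proof.
move=> ne lt ok; have [e h] := ok; have /and3P[_ h2 h3] := h v; split.
  have := inc_cmdP w (s := enc F p) (l := bin (F v).1) (r := flatten
    [seq None :: [seq Some i | i <- bin k] | k <- (F v).2]) ne (fits_enc p ok).
  by rewrite -(set_enc _ _ _ (_, _)); apply; rewrite ?ffunE ?e ?digit_rest ?size_enc1.
by apply: okF_upd => //; apply/and3P; split.
Qed.

Lemma run_dec F p v : v != u0 ->
  run (Dec v) F p cK (upd F v ((F v).1.-1, (F v).2)) p.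
Proof.
move=> ne ok; have [e h] := ok; have /and3P[h1 h2 h3] := h v; split.
  have := dec_cmdP w (s := enc F p) (l := bin (F v).1) (r := flatten
    [seq None :: [seq Some i | i <- bin k] | k <- (F v).2]) ne (fits_enc p ok).
  rewrite -(set_enc _ _ _ (_, _)) /enc1 bin_pred.
  by apply; rewrite ?ffunE ?e ?digit_rest ?size_enc1.
apply: okF_upd => //; apply/and3P; split=> //=; lia.
Qed.

Lemma run_pushv F p v : v != u0 -> size (F v).2 < Dp ->
  run (PushV v) F p cK (upd F v (0, (F v).1 :: (F v).2)) p.
Proof.
move=> ne lt ok; have [e h] := ok; have /and3P[h1 h2 h3] := h v; split.
  apply: (does_le (n := 1)); last by rewrite /cK; lia.
  rewrite -set_enc; have := @does_push _ w height (enc F p) v None (fits_enc p ok).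
  by rewrite ffunE; apply; exact: size_enc1.
by apply: okF_upd => //; apply/and3P; split=> //=; rewrite h1.
Qed.

Lemma clear_raw s v l r : fits height s -> stk s v = map Some l ++ r ->
  ~~ is_digit (ohead r) -> does w height (Clear v) s (3 * size l + 1) (set s v r).
Proof.
move=> fs + hr; elim: l s fs => [|b l IH] s fs /= ev.
  by rewrite -ev set_id; apply: does_whileF; rewrite /= ev.
have f1 : fits height (set s v (map Some l ++ r)).
  by apply: fits_set => //; move: (fs v); rewrite ev /=; lia.
have d1 := does_pop w v fs; rewrite ev /= in d1.
have := IH _ f1; rewrite stk_set_same set_set => /(_ erefl) d2.
have -> : 3 * (size l).+1 + 1 = (1 + (3 * size l + 1)).+2 by lia.
by apply: does_whileT d1 d2; rewrite /= ev.
Qed.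

Lemma run_clear F p v : v != u0 -> run (Clear v) F p cK (upd F v (0, (F v).2)) p.
Proof.
move=> ne ok; have [e h] := ok; have := h v; have := size_enc1 (h v).
rewrite /enc1 size_cat size_map => lt /and3P[h1 h2 h3]; split.
  have := @clear_raw (enc F p) v (bin (F v).1) _ (fits_enc p ok) _ (digit_rest (F v).2).
  rewrite -(set_enc _ _ _ (_, _)) ffunE => /(_ erefl) d.
  by apply: does_le d _; rewrite /cK; lia.
by apply: okF_upd => //; apply/and3P; split.
Qed.

Lemma run_popv F p v k l : v != u0 -> (F v).2 = k :: l ->
  run (PopV v) F p cK (upd F v (k, l)) p.
Proof.
move=> ne ev ok; have [e h] := ok; have := h v; have := size_enc1 (h v).
rewrite /enc1 size_cat size_map => lt /and3P[h1 h2 h3]; rewrite ev in h2 h3; split.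
  have d1 := @clear_raw (enc F p) v (bin (F v).1) _ (fits_enc p ok) _ (digit_rest (F v).2).
  rewrite ffunE in d1; have {}d1 := d1 erefl.
  have f1 : fits height (set (enc F p) v
     (flatten [seq None :: [seq Some i | i <- bin k] | k <- (F v).2])).
    apply: fits_set; first exact: fits_enc.
    by apply: ltnW; apply: leq_ltn_trans lt; apply: leq_addl.
  have := does_pop w v f1; rewrite stk_set_same set_set ev /= => d2.
  rewrite -(set_enc _ _ _ (_, _)).
  apply: (does_le (n := (3 * size (bin (F v).1) + 1) + 1)); last by rewrite /cK; lia.
  by rewrite ev in d1; apply: does_seq d1 d2.
move: h2 h3 => /= h2 /andP[hk hl].
by apply: okF_upd => //; apply/and3P; split=> //=; apply: ltnW.
Qed.

Lemma run_mv F p m : run (Act (Mv _ m)) F p 1 F (move_input w m p).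
Proof.
move=> ok; split=> //; apply: (does_act (a := Mv _ m)).
by move=> v; apply: fits_enc.
Qed.

Lemma run_skip F p : run (Skip V) F p 0 F p.
Proof. by move=> ok; split=> //; apply: does_skip. Qed.

Lemma run_if b c1 c2 F p n F' p' :
  (if ev_test w b (enc F p) then run c1 F p n F' p' else run c2 F p n F' p') ->
  run (If b c1 c2) F p n.+2 F' p'.
Proof.
by move=> h ok; move: h; case: ifP => hb /(_ ok)[d o]; split=> //;
  apply: does_if; rewrite hb.
Qed.

Lemma run_whileF b c F p : ~~ ev_test w b (enc F p) -> run (While b c) F p 1 F p.
Proof. by move=> hb ok; split=> //; apply: does_whileF. Qed.

Lemma run_whileT b c F1 p1 n1 F2 p2 n2 F3 p3 : ev_test w b (enc F1 p1) ->
  run c F1 p1 n1 F2 p2 -> run (While b c) F2 p2 n2 F3 p3 ->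
  run (While b c) F1 p1 (n1 + n2).+2 F3 p3.
Proof.
by move=> hb r1 r2 /r1[d1 /r2[d2 o]]; split=> //; apply: does_whileT d1 d2.
Qed.

(** [G i] and [P i] describe environment and input head when [i] iterations remain; a counting loop
    is verified by exhibiting these two families. *)
Lemma run_loop b c (G : nat -> env) (P : nat -> nat) n x :
  (forall i, i <= x -> ev_test w b (enc (G i) (P i)) = (0 < i)) ->
  (forall i, i < x -> run c (G i.+1) (P i.+1) n (G i) (P i)) ->
  run (While b c) (G x) (P x) (x * n.+2 + 1) (G 0) (P 0).
Proof.
elim: x => [|x IH] ht hb; first by apply: run_whileF; rewrite ht.
have -> : x.+1 * n.+2 + 1 = (n + (x * n.+2 + 1)).+2 by lia.
apply: run_whileT (hb x _) _; rewrite ?ht //; apply: IH => i lt.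
  by apply: ht; lia.
by apply: hb; lia.
Qed.

Definition AddTo v u := While (Nz v) (Seq (Dec v) (Inc u)).
Definition SubTo v u := While (Nz v) (Seq (Dec v) (Dec u)).

Definition cL := Bv * (3 * cK).+2 + 1.

Lemma run_addto F p v u : v != u0 -> u != u0 -> u != v -> (F u).1 + (F v).1 <= Bv ->
  run (AddTo v u) F p cL
    (upd (upd F v (0, (F v).2)) u ((F u).1 + (F v).1, (F u).2)) p.
Proof.
move=> nv nu ne le; have ne' : v != u by rewrite eq_sym.
pose G i := upd (upd F v (i, (F v).2)) u ((F u).1 + ((F v).1 - i), (F u).2).
have eGv i : G i v = (i, (F v).2) by rewrite /G updC // upd_same.
have e0 : G 0 = upd (upd F v (0, (F v).2)) u ((F u).1 + (F v).1, (F u).2).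
  by rewrite /G subn0.
have ex : G (F v).1 = F.
  by rewrite /G subnn addn0 -!surjective_pairing !upd_id.
rewrite -e0 -{1}ex.
apply: run_le (@run_loop _ _ G (fun=> p) (2 * cK) (F v).1 _ _) _.
- by move=> i _; rewrite ev_Nz eGv.
- move=> i lt; rewrite mul2n -addnn.
  apply: run_seq; first exact: run_dec.
  have -> : upd (G i.+1) v ((G i.+1 v).1.-1, (G i.+1 v).2) =
      upd (upd F v (i, (F v).2)) u ((F u).1 + ((F v).1 - i.+1), (F u).2).
    by rewrite eGv /G (updC _ _ _ ne') upd_upd.
  have := @run_inc (upd (upd F v (i, (F v).2)) u ((F u).1 + ((F v).1 - i.+1), (F u).2)) p u nu.
  rewrite upd_same upd_upd /= -addnS subnSK //; apply; lia.
- by rewrite /cL leq_add2r leq_mul //; lia.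
Qed.

Lemma run_subto F p v u : v != u0 -> u != u0 -> u != v -> (F v).1 <= Bv ->
  run (SubTo v u) F p cL
    (upd (upd F v (0, (F v).2)) u ((F u).1 - (F v).1, (F u).2)) p.
Proof.
move=> nv nu ne le; have ne' : v != u by rewrite eq_sym.
pose G i := upd (upd F v (i, (F v).2)) u ((F u).1 - ((F v).1 - i), (F u).2).
have eGv i : G i v = (i, (F v).2) by rewrite /G updC // upd_same.
have e0 : G 0 = upd (upd F v (0, (F v).2)) u ((F u).1 - (F v).1, (F u).2).
  by rewrite /G subn0.
have ex : G (F v).1 = F.
  by rewrite /G subnn subn0 -!surjective_pairing !upd_id.
rewrite -e0 -{1}ex.
apply: run_le (@run_loop _ _ G (fun=> p) (2 * cK) (F v).1 _ _) _.
- by move=> i _; rewrite ev_Nz eGv.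
- move=> i lt; rewrite mul2n -addnn.
  apply: run_seq; first exact: run_dec.
  have -> : upd (G i.+1) v ((G i.+1 v).1.-1, (G i.+1 v).2) =
      upd (upd F v (i, (F v).2)) u ((F u).1 - ((F v).1 - i.+1), (F u).2).
    by rewrite eGv /G (updC _ _ _ ne') upd_upd.
  have := @run_dec (upd (upd F v (i, (F v).2)) u ((F u).1 - ((F v).1 - i.+1), (F u).2)) p u nu.
  rewrite upd_same upd_upd /= /G.
  by have -> : ((F u).1 - ((F v).1 - i.+1)).-1 = (F u).1 - ((F v).1 - i) by lia.
- by rewrite /cL leq_add2r leq_mul //; lia.
Qed.

(** A counter is destroyed by reading it: its value is counted into [u] and [t] together and then
    poured back from [t]. *)
Definition Fetch v u t :=
  Seq (PushV u)
 (Seq (While (Nz v) (Seq (Dec v) (Seq (Inc u) (Inc t)))) (AddTo t v)).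

Lemma run_fetch F p v u t : v != u0 -> u != u0 -> t != u0 ->
  u != v -> t != v -> t != u -> (F v).1 <= Bv -> size (F u).2 < Dp ->
  F t = (0, [::]) ->
  run (Fetch v u t) F p (cK + 2 * cL) (upd F u ((F v).1, (F u).1 :: (F u).2)) p.
Proof.
move=> nv nu nt uv tv tu le lt et.
have vu : v != u by rewrite eq_sym.
have vt : v != t by rewrite eq_sym.
have ut : u != t by rewrite eq_sym.
set x := (F v).1.
pose G i := upd (upd (upd F v (i, (F v).2)) u (x - i, (F u).1 :: (F u).2)) t (x - i, [::]).
have eGv i : G i v = (i, (F v).2) by rewrite /G !(upd_other _ _ vt, upd_other _ _ vu) upd_same.
have eGu i : G i u = (x - i, (F u).1 :: (F u).2).
  by rewrite /G (upd_other _ _ ut) upd_same.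
have eGt i : G i t = (x - i, [::]) by rewrite /G upd_same.
have -> : cK + 2 * cL = cK + (cL + cL) by lia.
have ex : upd F u (0, (F u).1 :: (F u).2) = G x.
  rewrite /G subnn /x -surjective_pairing upd_id -et.
  by rewrite -(upd_other F (0, (F u).1 :: (F u).2) tu) upd_id.
apply: run_seq (run_pushv _ _ _) _ => //; rewrite ex.
apply: (run_seq (F2 := G 0) (p2 := p)).
  apply: run_le (@run_loop _ _ G (fun=> p) (3 * cK) x _ _) _.
  - by move=> i _; rewrite ev_Nz eGv.
  - move=> i li; have -> : 3 * cK = cK + (cK + cK) by lia.
    apply: run_seq (run_dec _ _) _ => //; rewrite eGv /=.
    apply: run_seq (run_inc _ _ _) _ => //.
      by rewrite upd_other // eGu /=; lia.
    rewrite (upd_other _ _ uv) eGu /=.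
    have -> : G i = upd (upd (upd (G i.+1) v (i, (F v).2)) u
      (x - i, (F u).1 :: (F u).2)) t (x - i, [::]).
      apply/ffunP=> z; rewrite !ffunE; case: (z == t) => //; case: (z == u) => //.
      by case: (z == v).
    have := @run_inc (upd (upd (G i.+1) v (i, (F v).2)) u
      (x - i, (F u).1 :: (F u).2)) p t nt.
    rewrite (upd_other _ _ tu) (upd_other _ _ tv) eGt /= subnSK //; apply; lia.
  - by rewrite /cL leq_add2r leq_mul.
have := @run_addto (G 0) p t v nt nv vt; rewrite eGt eGv /= subn0 add0n => h.
have -> : upd F u (x, (F u).1 :: (F u).2) =
   upd (upd (G 0) t (0, [::])) v (x, (F v).2); last exact: h.
apply/ffunP=> z; rewrite !ffunE subn0.
case: (z =P v) => [->|_]; first by rewrite (negbTE vu) -surjective_pairing.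
by case: (z =P t) => // ->; rewrite (negbTE tu).
Qed.

Lemma scan_right F p k (t : pred isym) :
  (forall i, i < k -> t (read_input w (p + i))) -> ~~ t (read_input w (p + k)) ->
  p + k <= (size w).+1 ->
  run (While (In _ t) (Act (Mv _ MoveR))) F p (3 * k + 1) F (p + k).
Proof.
elim: k p => [|k IH] p ht hk le.
  by rewrite addn0 in hk *; exact: run_whileF.
have -> : 3 * k.+1 + 1 = (1 + (3 * k + 1)).+2 by lia.
apply: (run_whileT (F2 := F) (p2 := p.+1)); first by have := ht 0 isT; rewrite addn0.
  have -> : p.+1 = move_input w MoveR p by rewrite /=; lia.
  exact: run_mv.
rewrite -(addSnnS p); apply: IH; rewrite ?addSnnS // => i lt.
by rewrite addSnnS; apply: ht.
Qed.

Definition home : cmd V :=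
  While (In _ (fun a => if a is IEnd then false else true)) (Act (Mv _ MoveL)).

Lemma run_home F p : (forall i, i < p -> read_input w i.+1 <> IEnd) ->
  run home F p (3 * p + 1) F 0.
Proof.
elim: p => [|p IH] hp; first exact: run_whileF.
have -> : 3 * p.+1 + 1 = (1 + (3 * p + 1)).+2 by lia.
apply: (run_whileT (F2 := F) (p2 := p)); last apply: IH.
- by rewrite /=; move: (hp p (ltnSn p)); case: read_input.
- exact: (run_mv p.+1 MoveL).
by move=> i lt; apply: hp; lia.
Qed.
End NatStacks.

(** * An imperative language and its compilation *)

Section RowInput.
Variables (rows : seq (seq isym)) (n : nat).
Hypothesis size_row : forall i, i < size rows -> size (nth [::] rows i) = n.

Definition word := flatten [seq rcons r ISep | r <- rows].

Lemma size_word : size word = size rows * n.+1.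
Proof.
rewrite /word; elim: rows size_row => //= r rs IH h.
by rewrite size_cat size_rcons (h 0) // IH // => i lt; apply: (h i.+1).
Qed.

Lemma nth_word i j : i < size rows -> j < n.+1 ->
  nth IEnd word (i * n.+1 + j) = nth IEnd (rcons (nth [::] rows i) ISep) j.
Proof.
rewrite /word; elim: rows i size_row => // r rs IH i h /= lti ltj.
rewrite nth_cat size_rcons (h 0) //; case: i lti => [|i] lti; first by rewrite ltj.
rewrite ltnNge mulSn -addnA leq_addr /= addKn; apply: IH => //.
by move=> k lt; apply: (h k.+1).
Qed.

Lemma read_cell i j : i < size rows -> j < n ->
  read_input word (i * n.+1 + j).+1 = nth IEnd (nth [::] rows i) j.
Proof.
move=> lti ltj; rewrite /read_input size_word /=.
have -> : (size rows * n.+1 < (i * n.+1 + j).+1) = false.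
  by have := leq_mul lti (leqnn n.+1); lia.
by rewrite nth_word //; [rewrite nth_rcons size_row // ltj|lia].
Qed.

Lemma read_sep i : i < size rows -> read_input word (i.+1 * n.+1) = ISep.
Proof.
move=> lti; rewrite /read_input size_word.
have -> : (size rows * n.+1 < i.+1 * n.+1) = false.
  by have := leq_mul lti (leqnn n.+1); lia.
rewrite mulSn /= addnC nth_word // nth_rcons size_row // ltnn eqxx //.
Qed.

Hypothesis row_sym : forall i j, i < size rows -> j < n ->
  exists b, nth IEnd (nth [::] rows i) j = bitsym b.

Lemma read_inside p : p < size word -> read_input word p.+1 <> IEnd.
Proof.
rewrite size_word => lt.
have lti : p %/ n.+1 < size rows by rewrite ltn_divLR.
rewrite (divn_eq p n.+1); have := ltn_pmod p (ltn0Sn n).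
rewrite ltnS leq_eqVlt => /orP[/eqP->|ltj].
  have -> : (p %/ n.+1 * n.+1 + n).+1 = (p %/ n.+1).+1 * n.+1 by rewrite mulSn; lia.
  by rewrite read_sep.
by rewrite read_cell //; have [[] ->] := row_sym lti ltj.
Qed.
End RowInput.

Section Imp.
Variable X : finType.
Notation env := {ffun X -> nat * seq nat}.
Implicit Types (E : env) (x : X).

Inductive iexp := Var of X | Zero | Succ of iexp | Plus of iexp & iexp | Minus of iexp & iexp.

(* [Rd x i j] stores in [x] whether the entry in row [i] and column [j] of the
   input is 1. *)
Inductive icmd :=
  | ISkip
  | Asg of X & iexp
  | Rd of X & iexp & iexp
  | IPush of X
  | IPop of X
  | ISeq of icmd & icmd
  | IIf of iexp & icmd & icmd
  | IWhile of iexp & icmd.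

Fixpoint ev (E : env) e :=
  match e with
  | Var x => (E x).1
  | Zero => 0
  | Succ e => (ev E e).+1
  | Plus e1 e2 => ev E e1 + ev E e2
  | Minus e1 e2 => ev E e1 - ev E e2
  end.

Fixpoint esz e :=
  match e with
  | Var _ | Zero => 1
  | Succ e => (esz e).+1
  | Plus e1 e2 | Minus e1 e2 => (esz e1 + esz e2).+1
  end.

Fixpoint ces c :=
  match c with
  | ISkip | IPush _ | IPop _ => 0
  | Asg _ e => esz e
  | Rd _ e1 e2 => maxn (esz e1) (esz e2)
  | ISeq c1 c2 => maxn (ces c1) (ces c2)
  | IIf e c1 c2 => maxn (esz e) (maxn (ces c1) (ces c2))
  | IWhile e c => maxn (esz e) (ces c)
  end.

Section Exec.
Variables (R C B D : nat) (rd : nat -> nat -> bool).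

Definition seta (E : env) x a : env := upd E x (a, (E x).2).

Inductive iexec : icmd -> env -> nat -> env -> Prop :=
  | IXSkip E : iexec ISkip E 0 E
  | IXAsg E x e : ev E e <= B -> iexec (Asg x e) E 1 (seta E x (ev E e))
  | IXRd E x e1 e2 : ev E e1 < R -> ev E e2 < C ->
      iexec (Rd x e1 e2) E 1 (seta E x (rd (ev E e1) (ev E e2)))
  | IXPush E x : size (E x).2 < D ->
      iexec (IPush x) E 1 (upd E x (0, (E x).1 :: (E x).2))
  | IXPop E x k s : (E x).2 = k :: s -> iexec (IPop x) E 1 (upd E x (k, s))
  | IXSeq c1 c2 E1 E2 E3 t1 t2 : iexec c1 E1 t1 E2 -> iexec c2 E2 t2 E3 ->
      iexec (ISeq c1 c2) E1 (t1 + t2) E3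
  | IXIf e c1 c2 E E' t : iexec (if 0 < ev E e then c1 else c2) E t E' ->
      iexec (IIf e c1 c2) E t.+1 E'
  | IXWhileF e c E : ev E e = 0 -> iexec (IWhile e c) E 1 E
  | IXWhileT e c E1 E2 E3 t1 t2 : 0 < ev E1 e -> iexec c E1 t1 E2 ->
      iexec (IWhile e c) E2 t2 E3 -> iexec (IWhile e c) E1 (t1 + t2).+1 E3.
End Exec.

Definition track : finType := (X + 'I_3)%type.
(** [tA] is the evaluation stack of expressions, [tT] holds one operand, and [tU] is the auxiliary
    track of the counters. *)
Definition tA : track := inr (Ordinal (isT : 0 < 3)).
Definition tT : track := inr (Ordinal (isT : 1 < 3)).
Definition tU : track := inr (Ordinal (isT : 2 < 3)).

Definition emb (E : env) (a t : nat * seq nat) : {ffun track -> nat * seq nat} :=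
  [ffun v : track => match v with
    | inl x => E x
    | inr i => if i == 0 :> nat then a else if i == 1 :> nat then t else (0, [::])
    end].

Notation nil0 := (0, [::]) (only parsing).

Lemma upd_embA E a t b : upd (emb E a t) tA b = emb E b t.
Proof. by apply/ffunP=> -[x|[[|[|[|i]]] h]] //; rewrite /upd /emb !ffunE. Qed.

Lemma upd_embT E a t b : upd (emb E a t) tT b = emb E a b.
Proof. by apply/ffunP=> -[x|[[|[|[|i]]] h]] //; rewrite /upd /emb !ffunE. Qed.

Lemma upd_embX E a t x b : upd (emb E a t) (inl x) b = emb (upd E x b) a t.
Proof. by apply/ffunP=> -[y|[[|[|[|i]]] h]] //; rewrite /upd /emb !ffunE. Qed.

Lemma embA E a t : emb E a t tA = a. Proof. by rewrite ffunE. Qed.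
Lemma embT E a t : emb E a t tT = t. Proof. by rewrite ffunE. Qed.
Lemma embX E a t x : emb E a t (inl x) = E x. Proof. by rewrite ffunE. Qed.
Definition embE := (embA, embT, embX).

Notation "c1 ;; c2" := (Seq c1 c2) (at level 60, right associativity).

Fixpoint ecomp e : cmd track :=
  match e with
  | Var x => Fetch tU (inl x : track) tA tT
  | Zero => PushV tA
  | Succ e => ecomp e ;; Inc tU tA
  | Plus e1 e2 => ecomp e1 ;; ecomp e2 ;; AddTo tU tA tT ;; PopV tA ;; AddTo tU tT tA
  | Minus e1 e2 => ecomp e1 ;; ecomp e2 ;; AddTo tU tA tT ;; PopV tA ;; SubTo tU tT tA
  end.

Definition store_top x : cmd track := Clear (inl x : track) ;; AddTo tU tA (inl x : track) ;; PopV tA.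

Definition not_sep a := if a is ISep then false else true.
Definition is_one a := if a is I1 then true else false.

Definition right : cmd track := Act (Mv _ MoveR).

(** The left end marker acts as the separator before row 0: after [i] passes to the next separator,
    one more move reaches the first entry of row [i]. *)
Definition row_loop : cmd track :=
  While (Nz tA) (Dec tU tA ;; right ;; While (In _ not_sep) right).

Definition col_loop : cmd track := While (Nz tT) (Dec tU tT ;; right).

Definition read_top : cmd track :=
  AddTo tU tA tT ;; PopV tA ;; row_loop ;; right ;; col_loop ;;
  If (In _ is_one) (Inc tU tA) (Skip _) ;; home _.

(** The value of a condition stays on [tA] for the test and is popped on every way out of it, so
    statements start and end with an empty evaluation stack. *)
Fixpoint icomp c : cmd track :=
  match c with
  | ISkip => Skip _
  | Asg x e => ecomp e ;; store_top x
  | Rd x e1 e2 => ecomp e1 ;; ecomp e2 ;; read_top ;; store_top x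
  | IPush x => PushV (inl x : track)
  | IPop x => PopV (inl x : track)
  | ISeq c1 c2 => icomp c1 ;; icomp c2
  | IIf e c1 c2 => ecomp e ;; If (Nz tA) (PopV tA ;; icomp c1) (PopV tA ;; icomp c2)
  | IWhile e c => ecomp e ;; While (Nz tA) (PopV tA ;; icomp c ;; ecomp e) ;; PopV tA
  end.

(** * Correctness and cost of the compilation *)

Section Compile.
Variables (rows : seq (seq isym)) (C B D ES : nat).
Hypothesis size_row : forall i, i < size rows -> size (nth [::] rows i) = C.
Hypothesis row_sym : forall i j, i < size rows -> j < C ->
  exists b, nth IEnd (nth [::] rows i) j = bitsym b.
Hypothesis B_gt0 : 0 < B.
Let w := word rows.
Definition rdw i j := is_one (nth IEnd (nth [::] rows i) j).
(** Only assigned values are bounded by [B]; an intermediate value may grow with the size of its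
    expression, up to the bound of [ev_le]. *)
Definition Bv := ES * B.+1.
Definition Dp := D + 2 * ES + 2.
Let cK := cK Bv Dp.
(** One unit that dominates every building block: a loop counting down a value up to [Bv] whose body
    is a few primitives and one pass over a row, or a single pass over the whole input. *)
Definition cZ := Bv * (5 * cK + 3 * size w + 20) + 10 * cK + 3 * size w + 20.

Notation run := (run w tU Bv Dp).

Definition okE (E : env) := forall x,
  [&& (E x).1 <= B, size (E x).2 <= D & all (fun k => k <= B) (E x).2].

Lemma ev_le E e : okE E -> ev E e <= esz e * B.+1.
Proof.
move=> ok; elim: e => [x||e IH|e1 IH1 e2 IH2|e1 IH1 e2 IH2] //=.
- by case/and3P: (ok x) => *; lia.
- lia.
- by rewrite mulSn mulnDl; lia.
- by rewrite mulSn mulnDl; lia.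
Qed.

Lemma cL_le : cL Bv Dp <= cZ.
Proof.
rewrite /cL /cZ -/cK; have := leq_mul (leqnn Bv) (_ : (3 * cK).+2 <= 5 * cK + 3 * size w + 20).
move/(_ _)=> h; have := h ltac:(lia); lia.
Qed.

Lemma ecompP e E a p : okE E -> esz e <= ES -> size a.2 + esz e <= Dp ->
  run (ecomp e) (emb E a nil0) p (3 * esz e * cZ) (emb E (ev E e, a.1 :: a.2) nil0) p.
Proof.
have hL := cL_le; have hK : cK <= cZ by rewrite /cZ; lia.
move=> ok; elim: e a => [x||e IH|e1 IH1 e2 IH2|e1 IH1 e2 IH2] a /= hE hD.
- have le : ev E (Var x) <= Bv.
    by apply: leq_trans (ev_le (Var x) ok) _; rewrite /Bv leq_mul.
  have := @run_fetch _ w tU Bv Dp (emb E a nil0) p (inl x : track) tA tT isT isT isT isT isT isT.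
  rewrite !embE upd_embA => r; apply: run_le (r _ _ _) _ => //; first lia.
  by rewrite -/cK; lia.
- have := @run_pushv _ w tU Bv Dp (emb E a nil0) p tA isT; rewrite !embE upd_embA => r.
  by apply: run_le (r _) _; rewrite -/cK; lia.
- have le : ev E (Succ e) <= Bv.
    by apply: leq_trans (ev_le (Succ e) ok) _; rewrite /Bv leq_mul.
  have r1 := IH a (ltnW hE) ltac:(lia).
  have := @run_inc _ w tU Bv Dp (emb E (ev E e, a.1 :: a.2) nil0) p tA isT.
  rewrite !embE upd_embA => r2; apply: run_le (run_seq r1 (r2 le)) _.
  by rewrite -/cK; lia.
- have le : ev E (Plus e1 e2) <= Bv.
    by apply: leq_trans (ev_le (Plus e1 e2) ok) _; rewrite /Bv leq_mul.
  have r1 := IH1 a ltac:(lia) ltac:(lia).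
  have r2 := IH2 (ev E e1, a.1 :: a.2) ltac:(lia) ltac:(move=> /=; lia).
  have := @run_addto _ w tU Bv Dp (emb E (ev E e2, ev E e1 :: a.1 :: a.2) nil0) p tA tT isT isT isT.
  rewrite !embE upd_embA upd_embT add0n /= => r3.
  have := @run_popv _ w tU Bv Dp (emb E (0, ev E e1 :: a.1 :: a.2) (ev E e2, [::])) p tA _ _ isT.
  rewrite !embE /= => /(_ _ _ erefl); rewrite upd_embA => r4.
  have := @run_addto _ w tU Bv Dp (emb E (ev E e1, a.1 :: a.2) (ev E e2, [::])) p tT tA isT isT isT.
  rewrite !embE upd_embT upd_embA /= => r5; move: le => /= le.
  have := run_seq r1 (run_seq r2 (run_seq (r3 ltac:(lia)) (run_seq r4 (r5 ltac:(lia))))).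
  by move/run_le; apply; rewrite -/cK; lia.
- have le1 : ev E e1 <= Bv.
    by apply: leq_trans (ev_le e1 ok) _; rewrite /Bv leq_mul //; lia.
  have le2 : ev E e2 <= Bv.
    by apply: leq_trans (ev_le e2 ok) _; rewrite /Bv leq_mul //; lia.
  have r1 := IH1 a ltac:(lia) ltac:(lia).
  have r2 := IH2 (ev E e1, a.1 :: a.2) ltac:(lia) ltac:(move=> /=; lia).
  have := @run_addto _ w tU Bv Dp (emb E (ev E e2, ev E e1 :: a.1 :: a.2) nil0) p tA tT isT isT isT.
  rewrite !embE upd_embA upd_embT add0n /= => r3.
  have := @run_popv _ w tU Bv Dp (emb E (0, ev E e1 :: a.1 :: a.2) (ev E e2, [::])) p tA _ _ isT.
  rewrite !embE /= => /(_ _ _ erefl); rewrite upd_embA => r4.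
  have := @run_subto _ w tU Bv Dp (emb E (ev E e1, a.1 :: a.2) (ev E e2, [::])) p tT tA isT isT isT.
  rewrite !embE upd_embT upd_embA /= => r5.
  have := run_seq r1 (run_seq r2 (run_seq (r3 ltac:(lia)) (run_seq r4 (r5 ltac:(lia))))).
  by move/run_le; apply; rewrite -/cK; lia.
Qed.

Lemma store_topP x E b k l p : b <= Bv ->
  run (store_top x) (emb E (b, k :: l) nil0) p (3 * cZ) (emb (seta E x b) (k, l) nil0) p.
Proof.
have hL := cL_le; have hK : cK <= cZ by rewrite /cZ; lia.
move=> le.
have := @run_clear _ w tU Bv Dp (emb E (b, k :: l) nil0) p (inl x : track) isT.
rewrite !embE upd_embX => r1.
have := @run_addto _ w tU Bv Dp (emb (upd E x (0, (E x).2)) (b, k :: l) nil0) p tA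
  (inl x : track) isT isT isT.
rewrite !embE upd_embA upd_embX upd_same upd_upd /= add0n => r2.
have := @run_popv _ w tU Bv Dp (emb (seta E x b) (0, k :: l) nil0) p tA _ _ isT.
rewrite embA => /(_ _ _ erefl); rewrite upd_embA => r3.
have := run_seq r1 (run_seq (r2 le) r3).
by move/run_le; apply; rewrite -/cK; lia.
Qed.

Lemma size_w_row i j : i < size rows -> j < C -> (i * C.+1 + j).+1 < size w.
Proof.
by move=> lti ltj; rewrite (size_word size_row); have := leq_mul lti (leqnn C.+1); lia.
Qed.

Lemma read_topP E i j k l : i < size rows -> j < C -> i <= Bv -> j <= Bv -> 0 < Bv ->
  run read_top (emb E (j, i :: k :: l) nil0) 0 (7 * cZ)
    (emb E (nat_of_bool (rdw i j), k :: l) nil0) 0.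
Proof.
have hL := cL_le; have hK : cK <= cZ by rewrite /cZ; lia.
move=> lti ltj lei lej Bv_gt0; have lt_w := size_w_row lti ltj.
have := @run_addto _ w tU Bv Dp (emb E (j, i :: k :: l) nil0) 0 tA tT isT isT isT.
rewrite !embE upd_embA upd_embT add0n /= => /(_ lej) r1.
have := @run_popv _ w tU Bv Dp (emb E (0, i :: k :: l) (j, [::])) 0 tA _ _ isT.
rewrite embA => /(_ _ _ erefl); rewrite upd_embA => r2.
have r3 : run row_loop (emb E (i, k :: l) (j, [::])) 0 cZ
   (emb E (0, k :: l) (j, [::])) (i * C.+1).
  have := @run_loop _ w tU Bv Dp (Nz tA) (Dec tU tA ;; right ;; While (In _ not_sep) right)
    (fun m => emb E (m, k :: l) (j, [::])) (fun m => (i - m) * C.+1) (cK + (1 + (3 * C + 1))) i.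
  rewrite subnn subn0 => r; apply: run_le (r _ _) _.
  - by move=> m _; rewrite ev_Nz embA.
  - move=> m ltm; have := @run_dec _ w tU Bv Dp (emb E (m.+1, k :: l) (j, [::]))
      ((i - m.+1) * C.+1) tA isT; rewrite embA upd_embA /= => d1.
    have -> : (i - m) * C.+1 = ((i - m.+1) * C.+1).+1 + C.
      by rewrite -[i - m]subnSK // mulSn; lia.
    have lt2 : i - m.+1 < size rows by lia.
    have lt3 := leq_mul lt2 (leqnn C.+1).
    apply: run_seq d1 _; apply: run_seq.
      have := @run_mv _ w tU Bv Dp (emb E (m, k :: l) (j, [::])) ((i - m.+1) * C.+1) MoveR.
      have -> : move_input w MoveR ((i - m.+1) * C.+1) = ((i - m.+1) * C.+1).+1.
        by rewrite /= (size_word size_row); lia.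
      exact.
    apply: scan_right.
    + move=> q ltq; rewrite addSn (read_cell size_row) //.
      by have [[] ->] := row_sym lt2 ltq.
    + have -> : ((i - m.+1) * C.+1).+1 + C = (i - m.+1).+1 * C.+1 by rewrite mulSn; lia.
      by rewrite (read_sep size_row).
    + by rewrite (size_word size_row); lia.
  - have leC : C <= size w by rewrite (size_word size_row); nia.
    by have := leq_mul lei (_ : (cK + (1 + (3 * C + 1))).+2 <= 5 * cK + 3 * size w + 20);
      rewrite /cZ => /(_ _) h; have := h ltac:(lia); lia.
have r4 : run right (emb E (0, k :: l) (j, [::])) (i * C.+1) 1
    (emb E (0, k :: l) (j, [::])) (i * C.+1).+1.
  have := @run_mv _ w tU Bv Dp (emb E (0, k :: l) (j, [::])) (i * C.+1) MoveR.
  have -> : move_input w MoveR (i * C.+1) = (i * C.+1).+1 by rewrite /=; lia.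
  exact.
have r5 : run col_loop (emb E (0, k :: l) (j, [::])) (i * C.+1).+1 cZ
    (emb E (0, k :: l) nil0) (i * C.+1 + j).+1.
  have := @run_loop _ w tU Bv Dp (Nz tT) (Dec tU tT ;; right)
    (fun m => emb E (0, k :: l) (m, [::])) (fun m => (i * C.+1 + (j - m)).+1) (cK + 1) j.
  rewrite subnn subn0 addn0 => r; apply: run_le (r _ _) _.
  - by move=> m _; rewrite ev_Nz embT.
  - move=> m ltm; have := @run_dec _ w tU Bv Dp (emb E (0, k :: l) (m.+1, [::]))
      (i * C.+1 + (j - m.+1)).+1 tT isT; rewrite embT upd_embT /= => d1.
    apply: run_seq d1 _.
    have := @run_mv _ w tU Bv Dp (emb E (0, k :: l) (m, [::])) (i * C.+1 + (j - m.+1)).+1 MoveR.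
    have -> : move_input w MoveR (i * C.+1 + (j - m.+1)).+1 = (i * C.+1 + (j - m)).+1.
      by rewrite /=; lia.
    exact.
  - by have := leq_mul lej (_ : (cK + 1).+2 <= 5 * cK + 3 * size w + 20);
      rewrite /cZ => /(_ _) h; have := h ltac:(lia); lia.
have r6 : run (If (In _ is_one) (Inc tU tA) (Skip _)) (emb E (0, k :: l) nil0) (i * C.+1 + j).+1
    cK.+2 (emb E (nat_of_bool (rdw i j), k :: l) nil0) (i * C.+1 + j).+1.
  apply: run_if; rewrite /= (read_cell size_row) // /rdw; case: is_one.
    have := @run_inc _ w tU Bv Dp (emb E (0, k :: l) nil0) (i * C.+1 + j).+1 tA isT.
    by rewrite embA upd_embA; apply.
  by apply: (run_le (n := 0)) => //; apply: run_skip.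
have r7 : run (home _) (emb E (nat_of_bool (rdw i j), k :: l) nil0) (i * C.+1 + j).+1 cZ
   (emb E (nat_of_bool (rdw i j), k :: l) nil0) 0.
  apply: (run_le (n := 3 * (i * C.+1 + j).+1 + 1)); last by rewrite /cZ; lia.
  by apply: run_home => q ltq; apply: (read_inside size_row row_sym); rewrite -/w; lia.
have := run_seq r1 (run_seq r2 (run_seq r3 (run_seq r4 (run_seq r5 (run_seq r6 r7))))).
have h20 : 20 <= cZ by rewrite /cZ; lia.
by move/run_le; apply; rewrite -/cK; lia.
Qed.

(** The most expensive step is [Rd]: two expressions at [3 * ES * cZ] each, then reading and
    storing. *)
Definition cI := (6 * ES + 12) * cZ.

Definition emb0 E := emb E nil0 nil0.

Lemma okE_upd E x a : okE E ->
  [&& a.1 <= B, size a.2 <= D & all (fun k => k <= B) a.2] -> okE (upd E x a).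
Proof. by move=> ok ha y; rewrite ffunE; case: ifP. Qed.

Lemma okE_seta E x a : okE E -> a <= B -> okE (seta E x a).
Proof.
by move=> ok le; apply: okE_upd => //=; case/and3P: (ok x) => _ -> ->; rewrite le.
Qed.

Lemma does_loop_seq (V : finType) ww H b (c d : cmd V) s1 n1 s2 n2 s3 :
  ev_test ww b s1 -> does ww H c s1 n1 s2 -> does ww H (While b c ;; d) s2 n2 s3 ->
  does ww H (While b c ;; d) s1 (n1 + n2).+2 s3.
Proof.
move=> hb [t1 le1 e1] [t2 le2 e2].
inversion e2 as [| |c1 c2 s s' s'' u1 u2 f1 f2| | | |]; subst.
exists ((t1 + u1).+2 + u2); first lia.
by apply: XSeq f2; apply: XWhileT hb e1 f1.
Qed.

Lemma run_loop_seq b (c d : cmd track) F1 p1 n1 F2 p2 n2 F3 p3 :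
  ev_test w b (enc F1 p1) -> run c F1 p1 n1 F2 p2 ->
  run (While b c ;; d) F2 p2 n2 F3 p3 ->
  run (While b c ;; d) F1 p1 (n1 + n2).+2 F3 p3.
Proof.
by move=> hb r1 r2 /r1[d1 /r2[d2 o]]; split=> //; apply: does_loop_seq d1 d2.
Qed.

Definition wloop e c := While (Nz tA) (PopV tA ;; icomp c ;; ecomp e) ;; PopV tA.

Lemma run_popA E b p : run (PopV tA) (emb E (b, [:: 0]) nil0) p cZ (emb0 E) p.
Proof.
have := @run_popv _ w tU Bv Dp (emb E (b, [:: 0]) nil0) p tA _ _ isT.
rewrite embA => /(_ _ _ erefl); rewrite upd_embA => r; apply: run_le r _.
by rewrite -/cK /cZ; lia.
Qed.

Lemma cZ_gt0 : 0 < cZ. Proof. by rewrite /cZ; lia. Qed.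

(** The last clause strengthens the induction for loops. The semantics re-enters [IWhile] before its
    condition is evaluated, the compiled code after it; so a second run is provided that starts with
    the value already on [tA] and is cheaper by one evaluation. *)
Lemma iexecP c E t E' : iexec (size rows) C B D rdw c E t E' ->
  0 < ES -> ces c <= ES -> okE E ->
  [/\ okE E', run (icomp c) (emb0 E) 0 (t * cI) (emb0 E') 0 &
      if c is IWhile e c0 then
        exists2 n, n + 3 * ES * cZ <= t * cI &
        run (wloop e c0) (emb E (ev E e, [:: 0]) nil0) 0 n (emb0 E') 0
      else True].
Proof.
have hZ := cZ_gt0.
have hcI : cI = 6 * (ES * cZ) + 12 * cZ by rewrite /cI mulnDl mulnA.
move=> ex ES_gt0.
have hBv a e E0 : okE E0 -> esz e <= ES -> a <= ev E0 e -> a <= Bv.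
  move=> ok le; move/leq_trans; apply; apply: leq_trans (ev_le e ok) _.
  by rewrite /Bv leq_mul.
have ecp e E0 : okE E0 -> esz e <= ES ->
    run (ecomp e) (emb0 E0) 0 (3 * ES * cZ) (emb E0 (ev E0 e, [:: 0]) nil0) 0.
  move=> ok le; apply: run_le (ecompP 0 ok le (a := nil0) _) _.
    by rewrite /= /Dp; lia.
  by rewrite leq_mul // leq_mul.
elim: ex => {c E t E'} /=.
- by move=> E _ ok; split=> //; apply: run_skip.
- move=> E x e le1 le ok; split=> //; first exact: okE_seta.
  have r := run_seq (ecp _ _ ok le) (store_topP x 0 (hBv _ _ _ ok le (leqnn _))).
  by apply: (run_le r); rewrite hcI -!mulnA; lia.
- move=> E x e1 e2 lt1 lt2; rewrite geq_max => /andP[le1 le2] ok; split=> //.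
    by apply: okE_seta => //; case: rdw.
  have h2 := @ecompP e2 E (ev E e1, [:: 0]) 0 ok le2.
  have h3 := @read_topP E (ev E e1) (ev E e2) 0 [::] lt1 lt2
    (hBv _ _ _ ok le1 (leqnn _)) (hBv _ _ _ ok le2 (leqnn _)).
  have Bv0 : 0 < Bv by rewrite /Bv; nia.
  have le3 : rdw (ev E e1) (ev E e2) <= Bv by case: rdw.
  have := run_seq (ecp _ _ ok le1) (run_seq (h2 _) (run_seq (h3 Bv0)
     (store_topP x 0 le3))).
  move=> r; apply: run_le (r _) _; first by rewrite /= /Dp; lia.
  have : 3 * esz e2 * cZ <= 3 * (ES * cZ) by rewrite -mulnA leq_mul // leq_mul.
  by rewrite hcI -!mulnA; lia.
- move=> E x lt _ ok; have /and3P[h1 h2 h3] := ok x; split=> //.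
    by apply: okE_upd => //; rewrite /= lt h1.
  have := @run_pushv _ w tU Bv Dp (emb0 E) 0 (inl x : track) isT.
  rewrite embX upd_embX => r; apply: run_le (r _) _; first by rewrite /Dp; lia.
  by rewrite hcI -/cK /cZ; lia.
- move=> E x k s ek _ ok; have := ok x; rewrite ek /= => /and3P[h1 h2 /andP[h3 h4]].
  split=> //; first by apply: okE_upd => //=; rewrite h3 h4; lia.
  have := @run_popv _ w tU Bv Dp (emb0 E) 0 (inl x : track) k s isT.
  rewrite embX upd_embX => r; apply: run_le (r ek) _.
  by rewrite hcI -/cK /cZ; lia.
- move=> c1 c2 E1 E2 E3 t1 t2 _ IH1 _ IH2; rewrite geq_max => /andP[le1 le2] ok.
  have [ok1 r1 _] := IH1 le1 ok; have [ok2 r2 _] := IH2 le2 ok1.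
  by split=> //; rewrite mulnDl; apply: run_seq r1 r2.
- move=> e c1 c2 E E' t _ IH; rewrite !geq_max => /and3P[le le1 le2] ok.
  have [|ok1 r1 _] := IH _ ok; first by case: ifP.
  split=> //; apply: (run_le (n := 3 * ES * cZ + (cZ + t * cI).+2)); last first.
    by rewrite [t.+1 * _]mulSn [X in _ <= X + _]hcI -!mulnA; lia.
  apply: run_seq (ecp _ _ ok le) _; apply: run_if; rewrite ev_Nz embA.
  by case: (0 < ev E e) r1 => r1; apply: run_seq (run_popA _) r1.
- move=> e c E e0; rewrite geq_max => /andP[le1 le2] ok.
  have r : run (wloop e c) (emb E (ev E e, [:: 0]) nil0) 0 (1 + cZ) (emb0 E) 0.
    apply: run_seq (run_popA _); apply: run_whileF.
    by rewrite ev_Nz embA e0.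
  split=> //; last by exists (1 + cZ) => //; rewrite hcI -!mulnA; lia.
  apply: run_le (run_seq (ecp _ _ ok le1) r) _.
  by rewrite hcI -!mulnA; lia.
- move=> e c E1 E2 E3 t1 t2 gt0 _ IH1 _ IH2 le ok.
  have /andP[le1 le2] : (esz e <= ES) && (ces c <= ES) by rewrite -geq_max.
  have [ok1 r1 _] := IH1 le2 ok; have [ok2 r2 [n len rn]] := IH2 le ok1.
  have r : run (wloop e c) (emb E1 (ev E1 e, [:: 0]) nil0) 0
      ((cZ + (t1 * cI + 3 * ES * cZ)) + n).+2 (emb0 E3) 0.
    apply: run_loop_seq rn; first by rewrite ev_Nz embA.
    apply: run_seq (run_popA _) _; apply: run_seq r1 _; exact: ecp.
  have hn : ((cZ + (t1 * cI + 3 * ES * cZ)) + n).+2 + 3 * ES * cZ <= (t1 + t2).+1 * cI.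
    by rewrite [_.+1 * cI]mulSn mulnDl [X in _ <= X + _]hcI -!mulnA in len *; lia.
  split=> //; last by exists ((cZ + (t1 * cI + 3 * ES * cZ)) + n).+2.
  by apply: run_le (run_seq (ecp _ _ ok le1) r) _; rewrite addnC.
Qed.

End Compile.
End Imp.

(** * Rooting the tree *)

Section Rooting.
Variables (m : nat) (e : rel 'I_m.+1).
Notation n := m.+1.
Let r : 'I_n := ord0.
Hypothesis tree : is_tree e.

Let e_sym u v : e u v = e v u. Proof. by case: tree. Qed.

Definition walk k v := [exists p : k.-tuple 'I_n, path e r p && (last r p == v)].

Lemma walk_ex v : exists k, walk k v.
Proof.
case: tree => _ _ _ /(_ r v)/connectP[p hp ->] _.
by exists (size p); apply/existsP; exists (in_tuple p); rewrite hp /=.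
Qed.

Definition dep v := ex_minn (walk_ex v).

Lemma dep_walk v : walk (dep v) v. Proof. by rewrite /dep; case: ex_minnP. Qed.

Lemma dep_min v k : walk k v -> dep v <= k.
Proof. by rewrite /dep; case: ex_minnP => i _ h /h. Qed.

Lemma dep_edge u v : e u v -> dep v <= (dep u).+1.
Proof.
move=> euv; apply: dep_min; have /existsP[p /andP[hp /eqP hl]] := dep_walk u.
apply/existsP; exists [tuple of rcons p v].
by rewrite rcons_path hp hl euv last_rcons eqxx.
Qed.

Lemma dep_root : dep r = 0.
Proof.
apply/eqP; rewrite -leqn0; apply: dep_min; apply/existsP; exists [tuple].
by rewrite /= eqxx.
Qed.

Lemma par_ex v : v != r -> exists u, e u v && (dep v == (dep u).+1).
Proof.
move=> nr; have /existsP[p /andP[hp /eqP hl]] := dep_walk v.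
case: p => p /= /eqP sp in hp hl; case/lastP: p sp hp hl => [|p y] sp hp hl.
  by rewrite -hl eqxx in nr.
rewrite last_rcons in hl; rewrite {y}hl in sp hp.
move: hp; rewrite rcons_path => /andP[hp he].
exists (last r p); rewrite he /= eqn_leq dep_edge //= -sp size_rcons ltnS.
by apply: dep_min; apply/existsP; exists (in_tuple p); rewrite hp /=.
Qed.

Definition par v := odflt r [pick u | e u v && (dep v == (dep u).+1) & v != r].

Lemma parP v : v != r -> e (par v) v /\ dep v = (dep (par v)).+1.
Proof.
move=> nr; rewrite /par; case: pickP => [u /andP[/andP[h /eqP ->]] //|no].
by have [u hu] := par_ex nr; have := no u; rewrite hu nr.
Qed.

Lemma par_root : par r = r.
Proof. by rewrite /par; case: pickP => // u; rewrite eqxx andbF. Qed.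

(** The pairs (v, par v) and (par v, v) with v not the root are adjacent, and they are distinct
    because depths differ by one. There are 2(n - 1) of them, which is the prescribed number of
    adjacent pairs, so there are no others. *)
Lemma edge_par u v :
  e u v = ((u != r) && (par u == v)) || ((v != r) && (par v == u)).
Proof.
pose V := [set v : 'I_n | v != r].
pose T1 := [set (v, par v) | v in V]; pose T2 := [set (par v, v) | v in V].
have cV : #|V| = m by have := cardsC1 r; rewrite card_ord /V; congr (_ = _); apply: eq_card => x; rewrite !inE.
have c1 : #|T1| = m by rewrite card_imset // => x y [].
have c2 : #|T2| = m by rewrite card_imset // => x y [].
have dis : [disjoint T1 & T2].
  apply/pred0P=> p /=; apply/negP=> /andP[/imsetP[x xV ->] /imsetP[y yV [e1 e2]]].
  rewrite !inE in xV yV; have [_ d1] := parP xV; have [_ d2] := parP yV.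
  by move: d1 d2; rewrite e2 -e1; lia.
pose A := [set p : 'I_n * 'I_n | e p.1 p.2].
have sA : T1 :|: T2 = A.
  apply/eqP; rewrite eqEcard; apply/andP; split.
    apply/subsetP=> p; rewrite inE => /orP[] /imsetP[x]; rewrite inE => /parP[h _] ->;
      by rewrite inE //= e_sym.
  by case: tree => _ _ _ _ ->; rewrite cardsU (disjoint_setI0 dis) cards0 c1 c2; lia.
have -> : e u v = ((u, v) \in A) by rewrite inE.
rewrite -sA inE; congr (_ || _).
  apply/imsetP/andP => [[x]|[h /eqP <-]]; first by rewrite inE => h [-> ->].
  by exists u; rewrite ?inE.
apply/imsetP/andP => [[x]|[h /eqP <-]]; first by rewrite inE => h [-> ->].
by exists v; rewrite ?inE.
Qed.
End Rooting.

(** * Feasible colours, Euler tours and the evaluation procedure *)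

Section Rooted.
Variables (m : nat) (e : rel 'I_m.+1) (L : 'I_m.+1 -> {set 'I_m.+1}).
Notation n := m.+1.
Notation r := (ord0 : 'I_n).
Variables (par : 'I_n -> 'I_n) (dep : 'I_n -> nat).
Hypothesis par_root : par r = r.
Hypothesis dep_root : dep r = 0.
Hypothesis dep_par : forall v, v != r -> dep v = (dep (par v)).+1.
Hypothesis edge_par : forall u v,
  e u v = ((u != r) && (par u == v)) || ((v != r) && (par v == u)).

Definition child v y := (y != r) && (par y == v).

Lemma child_dep v y : child v y -> dep y = (dep v).+1.
Proof. by case/andP=> /dep_par -> /eqP ->. Qed.

(** Valid at the root as well: there [par] returns the root itself, which is not a child. The
    program can therefore recognise children without treating the root apart. *)
Lemma edge_child v y : e v y && (y != par v) = child v y.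
Proof.
rewrite edge_par /child; case: (y =P par v) => [->|ne]; last first.
  rewrite andbT; have -> : par v == y = false by apply/eqP=> h; case: ne.
  by rewrite andbF.
rewrite andbF; apply/esym/negbTE/negP => /andP[nr /eqP h].
have [vr|nv] := eqVneq v r; first by rewrite vr par_root eqxx in nr.
by have := dep_par nr; have := dep_par nv; rewrite h; lia.
Qed.

Lemma edge_parent v : v != r -> e v (par v).
Proof. by move=> nv; rewrite edge_par nv eqxx. Qed.

Lemma edge_sym u v : e u v = e v u.
Proof. by rewrite !edge_par orbC. Qed.

Lemma iter_par k v : k <= dep v -> dep (iter k par v) + k = dep v.
Proof.
elim: k => [|k IH] lt; first by rewrite addn0.
have := IH (ltnW lt); have [->|nr] := eqVneq (iter k par v) r; rewrite iterS.
  by rewrite dep_root; lia.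
by rewrite (dep_par nr); lia.
Qed.

(** The ancestors of [v] realise every depth from 0 to [dep v], and depth takes at most [n]
    values. *)
Lemma dep_lt v : dep v < n.
Proof.
have : size (iota 0 (dep v).+1) <= size (map dep (enum 'I_n)).
  apply: uniq_leq_size; first exact: iota_uniq.
  move=> k; rewrite mem_iota /= add0n ltnS => le.
  apply/mapP; exists (iter (dep v - k) par v); first by rewrite mem_enum.
  by have := @iter_par (dep v - k) v (leq_subr _ _); lia.
by rewrite size_iota size_map size_enum_ord.
Qed.

Lemma tree_ind (P : 'I_n -> Prop) :
  (forall v, (forall y, child v y -> P y) -> P v) -> forall v, P v.
Proof.
move=> h v; have [k le] := ubnP (n - dep v); elim: k v le => // k IH v le.
apply: h => y /child_dep d; apply: IH; have := dep_lt v; have := dep_lt y; lia.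
Qed.

Lemma tree_ind_down (P : 'I_n -> Prop) :
  P r -> (forall v, v != r -> P (par v) -> P v) -> forall v, P v.
Proof.
move=> h0 h v; have [k le] := ubnP (dep v); elim: k v le => // k IH v le.
have [->//|nr] := eqVneq v r; apply: h => //; apply: IH.
by have := dep_par nr; lia.
Qed.

(** The fuel [n - dep v] never runs out since depths stay below [n], and it drops by exactly one
    from a vertex to its child. *)
Fixpoint feask k v : {set 'I_n} :=
  if k is k'.+1 then
    [set c in L v | [forall y, child v y ==> (feask k' y :\ c != set0)]]
  else set0.

(* The colours of [v] that extend to a list colouring of its subtree. *)
Definition feas v := feask (n - dep v) v.

Lemma feasE v :
  feas v = [set c in L v | [forall y, child v y ==> (feas y :\ c != set0)]].
Proof.
rewrite {1}/feas; have := dep_lt v; case E: (n - dep v) => [|k] lt; first by lia.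
apply/setP=> c; rewrite !inE; congr (_ && _); apply: eq_forallb => y.
case cy: (child v y) => //=; rewrite /feas (child_dep cy).
by have -> : n - (dep v).+1 = k by lia.
Qed.

Lemma in_feas v c :
  reflect (c \in L v /\ forall y, child v y -> feas y :\ c != set0) (c \in feas v).
Proof.
rewrite feasE inE; apply: (iffP andP) => -[h1 h2]; split=> //.
  by move=> y cy; have := forallP h2 y; rewrite cy.
by apply/forallP => y; apply/implyP; apply: h2.
Qed.

Fixpoint colk k v :=
  if k is k'.+1 then odflt ord0 [pick c in feas v :\ colk k' (par v)]
  else odflt ord0 [pick c in feas v].

(** A list colouring is feasible at every vertex by induction from the leaves. Conversely colours
    are chosen from the root downwards: feasibility of the colour of the parent says precisely that
    the child has a feasible colour different from it. *)
Lemma feas_root : reflect (list_colourable e L) (feas r != set0).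
Proof.
apply: (iffP idP) => [ne|[c [hL hc]]]; last first.
  suff h v : c v \in feas v by apply/set0Pn; exists (c r).
  elim/tree_ind: v => v IH; apply/in_feas; split=> // y cy.
  apply/set0Pn; exists (c y); rewrite !inE IH // andbT.
  by apply: hc; move: cy; rewrite -edge_child edge_sym => /andP[].
pose c v := colk (dep v) v.
have h v : c v \in feas v /\ (v != r -> c v != c (par v)).
  elim/tree_ind_down: v => [|v nr [hp _]].
    split; last by rewrite eqxx.
    rewrite /c dep_root /=; case: pickP => // h; case/set0Pn: ne => x hx.
    by have := h x; rewrite /= hx.
  have cv : child (par v) v by rewrite /child nr /=.
  rewrite {1 2}/c dep_par //=; case: pickP => [x|no] /=.
    by rewrite !inE => /andP[].
  have /in_feas[_ /(_ _ cv)/set0Pn[x hx]] := hp.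
  by have := no x; rewrite /= hx.
exists c; split=> [v|u v].
  by have [/in_feas[]] := h v.
rewrite edge_par => /orP[/andP[nr /eqP <-]|/andP[nr /eqP <-]].
  by have [_ /(_ nr)] := h u.
by have [_ /(_ nr)] := h v; rewrite eq_sym.
Qed.

(* All that the parent of [v] has to know: whether there is no feasible colour
   (0), only the colour c (c+1), or a choice (n+1). *)
Definition code v : nat :=
  if feas v == set0 then 0
  else if [pick c | feas v == [set c]] is Some c then (c : nat).+1 else n.+1.

Lemma code0 v : (code v == 0) = (feas v == set0).
Proof. by rewrite /code; case: (feas v == set0) => //; case: pickP. Qed.

Lemma code1 v (c : 'I_n) : (code v == c.+1) = (feas v == [set c]).
Proof.
rewrite /code; case: ifP => [/eqP ->|ne].
  by apply/esym/negbTE; rewrite eq_sym; apply/set0Pn; exists c; rewrite inE.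
case: pickP => [c' /eqP ->|no]; last first.
  by rewrite no; apply/negbTE; have := ltn_ord c; lia.
rewrite eqSS; apply/eqP/eqP => [/val_inj -> //|/setP/(_ c')].
by rewrite !inE eqxx => /esym/eqP ->.
Qed.

Lemma feas_block v c : (feas v :\ c == set0) = (code v == 0) || (code v == c.+1).
Proof.
by rewrite code0 code1 setD_eq0 subset1 orbC.
Qed.

Definition desc v x := (dep v <= dep x) && (iter (dep x - dep v) par x == v).

Definition sz v := #|[set x | desc v x]|.

Lemma desc_refl v : desc v v.
Proof. by rewrite /desc leqnn subnn /=. Qed.

Lemma desc_child v x : desc v x = (x == v) || [exists y, child v y && desc y x].
Proof.
apply/idP/orP => [/andP[le /eqP h]|[/eqP->|/existsP[y /andP[cy /andP[le /eqP h]]]]].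
- move: le; rewrite leq_eqVlt => /orP[/eqP eq|lt].
    by left; move: h; rewrite eq subnn /= => ->.
  right; apply/existsP; exists (iter (dep x - dep v).-1 par x).
  have := @iter_par (dep x - dep v).-1 x ltac:(lia); set y := iter _ _ _ => dy.
  have ey : par y = v by rewrite -h /y -iterS prednK //; lia.
  rewrite /child ey eqxx andbT /desc; apply/andP; split.
    by apply/eqP => yr; move: dy; rewrite yr dep_root; lia.
  apply/andP; split; first by lia.
  by have -> : dep x - dep y = (dep x - dep v).-1 by lia.
- exact: desc_refl.
have := child_dep cy; case/andP: cy => _ /eqP py dy.
rewrite /desc; apply/andP; split; first by lia.
by rewrite (_ : dep x - dep v = (dep x - dep y).+1) ?iterS ?h ?py //; lia.
Qed.

Lemma desc_uniq y y' x : desc y x -> desc y' x -> dep y = dep y' -> y = y'.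
Proof. by move=> /andP[_ /eqP ey] /andP[_ /eqP ey'] h; rewrite -[LHS]ey h ey'. Qed.

Lemma szE v : sz v = (\sum_(y | child v y) sz y).+1.
Proof.
have cardE (A : pred 'I_n) : #|[set x | A x]| = \sum_x (A x : nat).
  by rewrite cardsE -sum1_card big_mkcond; apply: eq_bigr => x _; rewrite unfold_in; case: (A x).
rewrite /sz cardE; under [in RHS]eq_bigr => y _ do rewrite cardE.
have s1 : \sum_x (x == v) = 1.
  by rewrite -cardE (_ : [set x | x == v] = [set v]) ?cards1 //; apply/setP=> x; rewrite !inE.
rewrite exchange_big /=.
transitivity (\sum_x ((x == v) + \sum_(y | child v y) desc y x)); last first.
  by rewrite big_split /= s1.
apply: eq_bigr => x _.
rewrite desc_child; case: existsP => [[y /andP[cy dy]]|no].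
  rewrite orbT (bigD1 y) //= dy big1 ?addn0; last first.
    move=> z /andP[cz nz]; case dz: (desc z x) => //; case/eqP: nz.
    by apply: desc_uniq dz dy _; rewrite (child_dep cy) (child_dep cz).
  case: eqP => // xv; have := child_dep cy; rewrite -xv.
  by case/andP: dy => le _; lia.
rewrite orbF big1 ?addn0 // => y cy; case dy: (desc y x) => //.
by case: no; exists y; rewrite cy.
Qed.

Lemma sz_le v : sz v <= n.
Proof. by rewrite /sz (leq_trans (max_card _)) // card_ord. Qed.

(** The number of turns from entering [v] to leaving it: every edge below [v] is crossed twice, and
    the edge to the parent once on the way out. *)
Definition tl v := (2 * sz v).-1.

Lemma tlE v : tl v = (\sum_(y | child v y) (tl y).+1).+1.
Proof.
rewrite {1}/tl szE mulnS big_distrr /=; congr _.+1.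
by apply: eq_bigr => y _; rewrite /tl szE; lia.
Qed.

Lemma tl_gt0 v : 0 < tl v. Proof. by rewrite tlE. Qed.

Lemma tl_lt v : tl v < 2 * n.
Proof. by rewrite /tl; have := sz_le v; lia. Qed.
Definition nbrs v := [seq y <- enum 'I_n | e v y].

Lemma mem_nbrs v y : (y \in nbrs v) = e v y.
Proof. by rewrite mem_filter mem_enum andbT. Qed.

(** The rule of a rotation system: after arriving from [a.1], leave through the cyclically next
    neighbour. On a tree this follows the Euler tour with no memory beyond the current directed
    edge. *)
Definition turn (a : 'I_n * 'I_n) := (a.2, path.next (nbrs a.2) a.1).

Lemma next_last (T : eqType) (p c : T) s1 s2 : uniq (p :: s1 ++ c :: s2) ->
  path.next (p :: s1 ++ c :: s2) (last p s1) = c.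
Proof.
move=> us; rewrite next_nth -cat_cons mem_cat mem_last.
have u1 : uniq (p :: s1) by move: us; rewrite -cat_cons cat_uniq => /andP[].
by rewrite orTb index_cat mem_last index_last // [LHS]/= nth_cat ltnn subnn.
Qed.

Lemma next_end (T : eqType) (p : T) s : uniq (p :: s) ->
  path.next (p :: s) (last p s) = p.
Proof. by move=> us; rewrite next_nth mem_last index_last // nth_default. Qed.

Lemma desc_trans v y x : child v y -> desc y x -> desc v x.
Proof. by move=> cy dy; rewrite desc_child; apply/orP; right; apply/existsP; exists y; rewrite cy. Qed.

(** With the neighbours rotated so that the parent comes first, the children follow one by one and
    the last leads back to the parent. The second half ensures that the directed edge leaving [v] is
    not met early, so that it can serve as a stopping test. *)
Lemma tourP v : v != r ->
  iter (tl v) turn (par v, v) = (v, par v) /\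
  forall k, k < tl v -> desc v (iter k turn (par v, v)).2.
Proof.
elim/tree_ind: v => v IH nr.
have [i cs ei] : rot_to_spec (nbrs v) (par v).
  by apply: rot_to; rewrite mem_nbrs edge_parent.
have un : uniq (par v :: cs) by rewrite -ei rot_uniq filter_uniq ?enum_uniq.
have nx x : path.next (nbrs v) x = path.next (par v :: cs) x.
  by rewrite -ei next_rot // filter_uniq ?enum_uniq.
have ch y : (y \in cs) = child v y.
  rewrite -edge_child -mem_nbrs -(mem_rot i (nbrs v)) ei inE.
  by case: eqP => [->|] /=; [rewrite (negbTE (proj1 (andP un)))|rewrite andbT].
have tot : tl v = (\sum_(c <- cs) (tl c).+1).+1.
  rewrite tlE big_uniq /=; last by case/andP: un.
  by congr _.+1; apply: eq_bigl => y; rewrite ch.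
(* [s1] lists the children already toured and [s2] those still to come; [last (par v) s1] is the
   neighbour from which the tour has just come back. *)
suff h s2 s1 : cs = s1 ++ s2 ->
    iter (\sum_(c <- s2) (tl c).+1).+1 turn (last (par v) s1, v) = (v, par v) /\
    forall k, k <= \sum_(c <- s2) (tl c).+1 ->
      desc v (iter k turn (last (par v) s1, v)).2.
  by have [h1 h2] := h cs [::] erefl; rewrite tot; split=> // k /h2.
elim: s2 s1 => [|c s2 IHs] s1 ecs.
  rewrite big_nil cats0 in ecs *; rewrite -ecs /turn /= nx next_end //; split=> // k.
  by rewrite leqn0 => /eqP ->; apply: desc_refl.
have cc : child v c by rewrite -ch ecs mem_cat mem_head orbT.
have /andP[cr /eqP pc] := cc.
have [t1 t2] := IH c cc cr; rewrite pc in t1 t2.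
have st : turn (last (par v) s1, v) = (v, c).
  by rewrite /turn /= nx ecs next_last // -ecs.
have jump : iter (tl c).+1 turn (last (par v) s1, v) = (last (par v) (rcons s1 c), v).
  by rewrite iterSr st t1 last_rcons.
have [h1 h2] := IHs (rcons s1 c) ltac:(by rewrite cat_rcons).
rewrite big_cons; split.
  by rewrite addnC -addSn iterD jump h1.
move=> k le; have [lt|ge] := leqP (tl c).+1 k.
  have -> : k = (k - (tl c).+1) + (tl c).+1 by lia.
  by rewrite iterD jump; apply: h2; lia.
case: k {le} ge => [|k] ge; first exact: desc_refl.
by rewrite iterSr st; apply: desc_trans cc (t2 _ _); lia.
Qed.

Lemma turn_edge a : e a.1 a.2 -> e (turn a).1 (turn a).2.
Proof. by move=> h; rewrite /= -mem_nbrs mem_next mem_nbrs edge_sym. Qed.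

Lemma iter_turn_edge k a : e a.1 a.2 -> e (iter k turn a).1 (iter k turn a).2.
Proof. by move=> h; elim: k => // k IH; rewrite iterS; apply: turn_edge. Qed.

Lemma par_not_desc v : v != r -> ~~ desc v (par v).
Proof. by move=> nr; apply/nandP; left; rewrite (dep_par nr) ltnn. Qed.

(* The order in which light children are visited: by size of the subtree,
   measured as the length of its Euler tour, then by index. *)
Definition pos y := tl y * n.+1 + y.

Lemma posE y : pos y = tl y * n.+1 + y. Proof. by []. Qed.

Lemma pos_inj y z : pos y = pos z -> y = z.
Proof.
move=> h; apply: val_inj; have := congr1 (modn^~ n.+1) h.
by rewrite /pos !modnMDl !modn_small // ltnS ltnW.
Qed.

Lemma pos_tl y z : pos y <= pos z -> tl y <= tl z.
Proof.
rewrite /pos => le; rewrite leqNgt; apply/negP => lt.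
have := leq_mul lt (leqnn n.+1); have := ltn_ord z; rewrite mulSn; lia.
Qed.

(** * Heavy paths and the abstract evaluation machine *)

Definition hv v := [pick y | child v y && [forall z, child v z ==> (pos z <= pos y)]].

Lemma hvP v :
  if hv v is Some h then child v h /\ forall z, child v z -> pos z <= pos h
  else forall z, ~~ child v z.
Proof.
rewrite /hv; case: pickP => [h /andP[ch /forallP al]|no z].
  by split=> // z cz; have := al z; rewrite cz.
apply/negP => cz; case: (arg_maxnP pos cz) => y cy al.
have := no y; rewrite (cy : child v y) /= => /negbT/negP; apply.
by apply/forallP => t; apply/implyP; apply: al.
Qed.

Definition light v y := child v y && (hv v != Some y).

Lemma lightE v y : light v y = child v y && (hv v != Some y). Proof. by []. Qed.

Definition descend x j := iter j (fun v => odflt v (hv v)) x.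

Lemma descendS x j : descend x j.+1 = odflt (descend x j) (hv (descend x j)).
Proof. by []. Qed.

Lemma dep_descend x j :
  (forall i, i < j -> hv (descend x i) != None) -> dep (descend x j) = dep x + j.
Proof.
elim: j => [|j IH] h; first by rewrite addn0.
rewrite /descend iterS -/(descend x j); have := hvP (descend x j).
have := h j (ltnSn j); case: (hv _) => // y _ [cy _] /=.
by rewrite (child_dep cy) IH ?addnS // => i lt; apply: h; lia.
Qed.

(** Each step along the heavy path increases the depth, so [n] steps would exceed [dep_lt]. *)
Lemma plen_ex x : exists j, hv (descend x j) == None.
Proof.
have [/existsP[j h]|no] := boolP [exists j : 'I_n, hv (descend x j) == None]; first by exists j.
have := @dep_descend x n _; have := dep_lt (descend x n); move=> lt h.
suff : n <= dep (descend x n) by lia.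
rewrite h ?leq_addl // => i lti; apply: contra no => hi.
by apply/existsP; exists (Ordinal lti).
Qed.

Definition plen x := ex_minn (plen_ex x).

Lemma plen_hv x j : j <= plen x -> (hv (descend x j) == None) = (j == plen x).
Proof.
rewrite /plen; case: ex_minnP => k hk mk le.
have [->//|ne] := eqVneq j k; apply/negbTE/negP => /mk; lia.
Qed.

Lemma dep_hpath x j : j <= plen x -> dep (descend x j) = dep x + j.
Proof. by move=> le; apply: dep_descend => i lt; rewrite plen_hv; lia. Qed.

Lemma plen_lt x : plen x < n.
Proof. by have := dep_lt (descend x (plen x)); rewrite dep_hpath //; lia. Qed.

(* A frame handles the heavy path that starts at [fx]; its current vertex is at
   depth [fj] on that path, [fh] is the code of the heavy child of this vertex,
   [ff] the code of the feasible colours found so far, [fc] the colour under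
   test, and the next light child is the one of size [fs] and index at least
   [fy]. *)
Record frame := Fr { fx : 'I_n; fj : nat; fh : nat; ff : nat; fc : nat; fs : nat; fy : nat }.

(** Evaluation begins at the leaf that ends the heavy path. A leaf has no heavy child, and the code
    [n.+1] stands in for it because it blocks no colour. *)
Definition start y := Fr y (plen y) n.+1 0 0 0 0.

Definition at_colour f c := Fr (fx f) (fj f) (fh f) (ff f) c 0 0.

(** Code 0 blocks all colours, so the vertex is finished at once. Keeping [ff] is right: no colour
    can have been found before, hence it is still 0. *)
Definition resume f k :=
  if k == 0 then at_colour f n
  else if k == (fc f).+1 then at_colour f (fc f).+1
  else Fr (fx f) (fj f) (fh f) (ff f) (fc f) (fs f) (fy f).+1.

Definition cand v k c := [&& (inord c : 'I_n) \in L v, k != 0 & k != c.+1].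

Definition vertex f := descend (fx f) (fj f).

(** A result sits in [ff] once [fc] has reached [n]; it becomes [fh] of the next vertex up the path
    or, at the head, goes to the caller. Setting [ff] to [n.+1] and [fc] to [n] is the early stop at
    the second feasible colour. *)
Definition mstep (st : frame * seq frame) : option (frame * seq frame) :=
  let: (f, stk) := st in
  let v := vertex f in
  if n <= fc f then
    if fj f is j.+1 then Some (Fr (fx f) j (ff f) 0 0 0 0, stk)
    else if stk is g :: stk' then Some (resume g (ff f), stk') else None
  else if ~~ cand v (fh f) (fc f) then Some (at_colour f (fc f).+1, stk)
  else if 2 * n <= fs f then
    Some (if ff f == 0 then Fr (fx f) (fj f) (fh f) (fc f).+1 (fc f).+1 0 0
          else Fr (fx f) (fj f) (fh f) n.+1 n 0 0, stk)
  else if n <= fy f then Some (Fr (fx f) (fj f) (fh f) (ff f) (fc f) (fs f).+1 0, stk)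
  else if light v (inord (fy f)) && (tl (inord (fy f)) == fs f)
    then Some (start (inord (fy f)), f :: stk)
  else Some (Fr (fx f) (fj f) (fh f) (ff f) (fc f) (fs f) (fy f).+1, stk).

Definition mrun k st := iter k (obind mstep) (Some st).

Lemma mrunS k st : mrun k.+1 st = obind (mrun k) (mstep st).
Proof.
rewrite /mrun iterSr /=; case: (mstep st) => //=.
by elim: k => //= k ->.
Qed.

Definition reach k st st' := exists2 i, i <= k & mrun i st = Some st'.

Lemma reach_refl k st : reach k st st. Proof. by exists 0. Qed.

Lemma reach_trans k1 k2 st1 st2 st3 :
  reach k1 st1 st2 -> reach k2 st2 st3 -> reach (k1 + k2) st1 st3.
Proof.
case=> i1 l1 e1 [i2 l2 e2]; exists (i1 + i2); first by rewrite leq_add.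
by rewrite /mrun addnC iterD -/(mrun i1 st1) e1.
Qed.

Lemma reach_le k k' st st' : reach k st st' -> k <= k' -> reach k' st st'.
Proof. by case=> i l h le; exists i => //; apply: leq_trans le. Qed.

Lemma reach_step k st st1 st2 :
  mstep st = Some st1 -> reach k st1 st2 -> reach k.+1 st st2.
Proof. by move=> h [i l hi]; exists i.+1 => //; rewrite mrunS h. Qed.

Definition blocks k c := (k == 0) || (k == c.+1).

Lemma feas_blocks v (c : 'I_n) :
  (c \in feas v) = (c \in L v) && [forall y, child v y ==> ~~ blocks (code y) c].
Proof.
apply/in_feas/andP => -[h1 h2]; split=> //.
  apply/forallP => y; apply/implyP => cy; rewrite /blocks -feas_block; exact: h2.
by move=> y cy; have := forallP h2 y; rewrite cy /blocks -feas_block.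
Qed.

(** * Cost of one vertex: colours against light children *)

Section Visit.
Variables (v : 'I_n) (A : nat).
Definition hcode := if hv v is Some h then code h else n.+1.

(** These are the light children really called when colour [c] is scanned from position [q]; the
    first blocking child ends the scan and is itself counted. *)
Definition visits c q y := [&& light v y, q <= pos y &
  [forall z, light v z && (q <= pos z < pos y) ==> ~~ blocks (code z) c]].

Definition eval_cost y := A * tl y ^ 3.

Hypothesis IH : forall y, light v y -> forall stk,
  exists h, reach (eval_cost y) (start y, stk) (Fr y 0 h (code y) n 0 0, stk).

Lemma sum_sub (P Q : pred 'I_n) (F : 'I_n -> nat) : (forall y, P y -> Q y) ->
  \sum_(y < n | P y) F y <= \sum_(y < n | Q y) F y.
Proof.
move=> h; rewrite !(big_mkcond _ F) leq_sum // => y _.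
by case hp: (P y) => //; rewrite h.
Qed.

Lemma visits_next c q :
  (forall z, light v z -> pos z = q -> ~~ blocks (code z) c) ->
  forall y, visits c q.+1 y -> visits c q y && (pos y != q).
Proof.
move=> hz y /and3P[ly lt /forallP al]; rewrite /visits ly (ltnW lt) /=.
apply/andP; split; last by rewrite neq_ltn lt orbT.
apply/forallP => z; apply/implyP => /and3P[lz le1 le2].
have [eq|ne] := eqVneq (pos z) q; first exact: hz.
by have := al z; rewrite lz le2 ltn_neqAle eq_sym ne le1.
Qed.

(** The pair (s, y) is read as a number [q] in radix [n.+1], since y runs up to [n] before s
    advances. Each step without a call raises [q] by one. A call costs the evaluation plus two
    steps, of which one is paid by the increase of [q]. *)
Lemma scan x j f c s y stk : descend x j = v -> c < n -> cand v hcode c ->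
  s <= 2 * n -> y <= n -> (s = 2 * n -> y = 0) ->
  let q := s * n.+1 + y in
  exists2 st', reach (2 * n * n.+1 - q + \sum_(z < n | visits c q z) (eval_cost z).+1)
                     (Fr x j hcode f c s y, stk) (st', stk) &
  [\/ (forall z, light v z -> q <= pos z -> ~~ blocks (code z) c) /\
         st' = Fr x j hcode f c (2 * n) 0,
      (exists z, light v z /\ code z = 0) /\ st' = Fr x j hcode f n 0 0
    | (exists z, light v z /\ code z = c.+1) /\ st' = Fr x j hcode f c.+1 0 0].
Proof.
move=> ev ltc cn; have [k] := ubnP (2 * n * n.+1 - (s * n.+1 + y)).
elim: k s y => // k IHk s y lek les ley hsy q.
have [es|lts] := eqVneq s (2 * n).
  rewrite /q es (hsy es); exists (Fr x j hcode f c (2 * n) 0); first exact: reach_refl.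
  constructor 1; split=> // z _; rewrite addn0 => le.
  have := tl_lt z; have := ltn_ord z; move: le; rewrite /pos => le l1 l2.
  by have := leq_mul l2 (leqnn n.+1); rewrite mulSn; lia.
have {}lts : s < 2 * n by rewrite ltn_neqAle lts.
have ltq : q < 2 * n * n.+1.
  by have := leq_mul lts (leqnn n.+1); rewrite mulSn /q; lia.
have step0 : mstep (Fr x j hcode f c s y, stk) =
   if n <= y then Some (Fr x j hcode f c s.+1 0, stk)
   else if light v (inord y) && (tl (inord y) == s) then Some (start (inord y), Fr x j hcode f c s y :: stk)
   else Some (Fr x j hcode f c s y.+1, stk).
  rewrite /mstep /vertex /= ev leqNgt ltc /= cn /= leqNgt lts //.
(* The case in which nothing at position [q] blocks the colour: the visit made at [q], if any, is
   split off the sum, and the rest is the induction hypothesis at [q.+1]. *)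
have move_on s' y' k0 : s' * n.+1 + y' = q.+1 -> s' <= 2 * n -> y' <= n ->
    (s' = 2 * n -> y' = 0) ->
    (forall z, light v z -> pos z = q -> ~~ blocks (code z) c) ->
    k0 <= (\sum_(z < n | visits c q z && (pos z == q)) (eval_cost z).+1).+1 ->
    reach k0 (Fr x j hcode f c s y, stk) (Fr x j hcode f c s' y', stk) ->
    exists2 st', reach (2 * n * n.+1 - q + \sum_(z < n | visits c q z) (eval_cost z).+1)
                     (Fr x j hcode f c s y, stk) (st', stk) &
  [\/ (forall z, light v z -> q <= pos z -> ~~ blocks (code z) c) /\
         st' = Fr x j hcode f c (2 * n) 0,
      (exists z, light v z /\ code z = 0) /\ st' = Fr x j hcode f n 0 0
    | (exists z, light v z /\ code z = c.+1) /\ st' = Fr x j hcode f c.+1 0 0].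
  move=> eq' les' ley' hsy' nb lek0 rk; have := IHk s' y' _ les' ley' hsy'.
  rewrite eq' => /(_ ltac:(lia))[st' r o]; exists st'.
    apply: reach_le (reach_trans rk r) _.
    rewrite [X in _ <= _ + X](bigID (fun z => pos z == q)) /=.
    have arith M p k1 a b d : p < M -> k1 <= a.+1 -> b <= d ->
      k1 + (M - p.+1 + b) <= M - p + (a + d) by lia.
    by apply: arith => //; apply: sum_sub (visits_next nb).
  case: o => [[h ->]|h|h]; [constructor 1|by constructor 2|by constructor 3].
  split=> // z lz le; have [eqz|ne] := eqVneq (pos z) q; first exact: nb.
  by apply: h => //; rewrite ltn_neqAle eq_sym ne.
have [ge|lty] := leqP n y.
  apply: (move_on s.+1 0 1) => //.
  - by rewrite /q mulSn; lia.
  - move=> z _ hz; have := congr1 (modn^~ n.+1) hz.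
    rewrite /pos /q !modnMDl !modn_small; have := ltn_ord z; lia.
  - by apply: (reach_step (k := 0)) (reach_refl _ _); rewrite step0 ge.
have [/andP[lz /eqP tz]|no] := boolP (light v (inord y) && (tl (inord y) == s)).
  have pz : pos (inord y) = q by rewrite /pos tz inordK.
  have [h rz] := IH lz (Fr x j hcode f c s y :: stk).
  have vz : visits c q (inord y).
    rewrite /visits lz pz leqnn /=; apply/forallP => z; apply/implyP => /and3P[_ l1 l2].
    lia.
  have r1 : reach (eval_cost (inord y)).+2 (Fr x j hcode f c s y, stk)
      (resume (Fr x j hcode f c s y) (code (inord y)), stk).
    have : reach 1 (Fr (inord y) 0 h (code (inord y)) n 0 0, Fr x j hcode f c s y :: stk)
      (resume (Fr x j hcode f c s y) (code (inord y)), stk).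
      by apply: (reach_step (k := 0)) (reach_refl _ _); rewrite /= leqnn.
    move/(reach_trans rz) => r2; apply: reach_step (reach_le r2 _); last by rewrite addn1.
    by rewrite step0 leqNgt lty /= lz tz eqxx.
  have le1 : (eval_cost (inord y)).+1 <= \sum_(z < n | visits c q z && (pos z == q)) (eval_cost z).+1.
    by rewrite (bigD1 (inord y)) /= ?leq_addr // vz pz eqxx.
  have le2 := sum_sub (fun z => (eval_cost z).+1) (fun z (hz : visits c q z && (pos z == q)) => proj1 (andP hz)).
  move: r1; rewrite /resume; case: eqP => [c0|/eqP n0].
    move=> r1; exists (Fr x j hcode f n 0 0); first by apply: reach_le r1 _; lia.
    by constructor 2; split=> //; exists (inord y).
  case: eqP => [c1|/eqP n1] r1.
    exists (Fr x j hcode f c.+1 0 0); first by apply: reach_le r1 _; lia.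
    by constructor 3; split=> //; exists (inord y).
  apply: (move_on s y.+1 (eval_cost (inord y)).+2) => //.
  - by rewrite /q; lia.
  - by move=> h1; rewrite h1 ltnn in lts.
  - move=> z l1; rewrite -pz => /pos_inj ->; rewrite /blocks /= negb_or n0 //.
apply: (move_on s y.+1 1) => //.
- by rewrite /q; lia.
- by move=> h1; rewrite h1 ltnn in lts.
- move=> z l1 pz; case/negP: no.
  have ez : z = inord y.
    have := congr1 (modn^~ n.+1) pz; rewrite /pos /q !modnMDl !modn_small; try (have := ltn_ord z; lia).
    by move=> <-; rewrite inord_val.
  rewrite -ez l1; apply/eqP; move: pz; rewrite /pos /q ez inordK // => /eqP.
  by rewrite eqn_add2r eqn_mul2r => /eqP.
- by apply: (reach_step (k := 0)) (reach_refl _ _); rewrite step0 leqNgt lty (negbTE no).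
Qed.
(** Children of code 0 are deliberately ignored: such a child ends the vertex when first called, so
    it must not be charged once per colour. With this reading [active] contains every colour that is
    scanned. *)
Definition zc (c : 'I_n) := cand v hcode c && [forall y, light v y ==> (code y != c.+1)].

Definition active (c : 'I_n) :=
  cand v hcode c && (#|[set c' : 'I_n | zc c' & c' < c]| < 2).

Lemma cand_feas (c : 'I_n) : (c \in feas v) =
  cand v hcode c && [forall y, light v y ==> ~~ blocks (code y) c].
Proof.
rewrite feas_blocks /cand inord_val -andbA; congr (_ && _).
have hb : (hcode != 0) && (hcode != c.+1) =
    [forall y, (hv v == Some y) ==> ~~ blocks (code y) c].
  rewrite /hcode; case: (hv v) => [h|].
    rewrite -negb_or; apply/idP/forallP => [nb y|/(_ h)]; last by rewrite eqxx.
    by apply/implyP => /eqP [<-].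
  have -> : n.+1 != c.+1 by rewrite eqSS neq_ltn ltn_ord orbT.
  by apply/esym/forallP.
rewrite hb; have hvc y : hv v = Some y -> child v y.
  by move=> ey; have := hvP v; rewrite ey => -[].
apply/forallP/andP => [h|[/forallP h1 /forallP h2] y].
  split; apply/forallP => y; apply/implyP.
    by move/eqP/hvc => cy; have := h y; rewrite cy.
  by case/andP=> cy _; have := h y; rewrite cy.
apply/implyP => cy; have [ey|ne] := eqVneq (hv v) (Some y).
  by have := h1 y; rewrite ey eqxx.
by have := h2 y; rewrite /light cy ne.
Qed.

(** What [ff] records when colour [c] comes up: at most one smaller colour is feasible, since a
    second would have ended the vertex. *)
Definition found c f :=
  (f = 0 /\ forall d : 'I_n, d < c -> d \notin feas v) \/
  exists d : 'I_n, [/\ d < c, d \in feas v, f = d.+1 &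
    forall d' : 'I_n, d' < c -> d' \in feas v -> d' = d].

Lemma found_code f : found n f -> f = code v.
Proof.
case=> [[-> h]|[d [_ hd -> h]]]; apply/esym/eqP.
  by rewrite code0; apply/eqP/setP => d; rewrite inE; apply/negbTE/h.
rewrite code1; apply/eqP/setP => d'; rewrite inE.
by apply/idP/eqP => [/h -> //|->].
Qed.

Lemma found_next (c : 'I_n) f : found c f -> c \notin feas v -> found c.+1 f.
Proof.
move=> fd nc; have lt (d : 'I_n) : d < c.+1 -> d \in feas v -> d < c.
  rewrite ltnS leq_eqVlt => /orP[/eqP/val_inj->|//]; by rewrite (negbTE nc).
case: fd => [[-> h]|[d [l1 l2 -> h]]]; [left|right].
  by split=> // d ltd; apply/negP => hd; have := h d (lt d ltd hd); rewrite hd.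
exists d; split=> //; first exact: ltnW.
by move=> d' lt' hd; apply: h => //; apply: lt.
Qed.

Definition base := 2 * n * n.+1 + 2.

(** The hypothesis on [zc] holds because an unblocked colour that has been passed was either
    accepted or met a child of code 0, and the latter leaves no further colour. *)
Lemma colours x j h f c stk : descend x j = v -> h = hcode -> c <= n -> found c f ->
  (forall d : 'I_n, d < c -> zc d -> d \in feas v) ->
  reach ((n - c) * base + \sum_(d : 'I_n | (c <= d) && active d) \sum_(y | visits d 0 y) (eval_cost y).+1)
    (Fr x j h f c 0 0, stk) (Fr x j h (code v) n 0 0, stk).
Proof.
move=> ev -> {h}; have [k] := ubnP (n - c).
elim: k c f => // k IHk c f lek lec fd zf.
have [ec|nec] := eqVneq c n.
  by rewrite ec in fd *; rewrite -(found_code fd); apply: reach_refl.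
have ltc : c < n by rewrite ltn_neqAle nec.
pose c' := Ordinal ltc.
have sumS : \sum_(d : 'I_n | (c < d) && active d) \sum_(y | visits d 0 y) (eval_cost y).+1 +
    (active c') * \sum_(y | visits c 0 y) (eval_cost y).+1 <=
    \sum_(d : 'I_n | (c <= d) && active d) \sum_(y | visits d 0 y) (eval_cost y).+1.
  case ac: (active c'); last first.
    by rewrite addn0; apply: sum_sub => d /andP[l ->]; rewrite ltnW.
  rewrite mul1n [leqRHS](bigD1 c') /= ?leqnn // addnC leq_add2l.
  apply: sum_sub => d /andP[l ->]; rewrite ltnW //=.
  by apply/eqP => dc; rewrite dc ltnn in l.
have mulS : (n - c) * base = base + (n - c.+1) * base by rewrite -mulSn subnSK.
have next st' n1 f' : reach n1 (Fr x j hcode f c 0 0, stk) (Fr x j hcode f' c.+1 0 0, stk) ->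
    st' = (Fr x j hcode (code v) n 0 0, stk) ->
    n1 <= base + (active c') * \sum_(y | visits c 0 y) (eval_cost y).+1 ->
    found c.+1 f' -> (zc c' -> c' \in feas v) ->
    reach ((n - c) * base + \sum_(d : 'I_n | (c <= d) && active d) \sum_(y | visits d 0 y) (eval_cost y).+1)
      (Fr x j hcode f c 0 0, stk) st'.
  move=> r1 -> le1 fd' zf'; have := IHk c.+1 f' ltac:(lia) ltc fd' _.
  move=> r2; have {}r2 := r2 _; apply: reach_le (reach_trans r1 (r2 _)) _.
    move=> d; rewrite ltnS leq_eqVlt => /orP[/eqP dc|]; last exact: zf.
    by have -> : d = c' by apply: val_inj.
  rewrite mulS; have arith a b s1 s2 s3 : n1 <= a + s1 -> s2 + s1 <= s3 ->
    n1 + (b + s2) <= a + b + s3 by lia.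
  exact: arith le1 sumS.
have e1 : mstep (Fr x j hcode f c 0 0, stk) =
    if ~~ cand v hcode c then Some (Fr x j hcode f c.+1 0 0, stk)
    else mstep (Fr x j hcode f c 0 0, stk).
  by rewrite /= /vertex /= ev leqNgt ltc /=; case: cand.
case cn: (cand v hcode c); last first.
  have nf : c' \notin feas v by rewrite cand_feas cn.
  apply: (next _ 1 f) => //.
  - by apply: (reach_step (k := 0)) (reach_refl _ _); rewrite e1 cn.
  - exact: (@found_next c').
  - by rewrite /zc cn.
(* The smaller colours in [zc] are all feasible, and [found] allows at most one of those. *)
have ac : active c'.
  rewrite /active cn /=; apply: (@leq_ltn_trans #|[set d in feas v | d < c]|).
    apply/subset_leq_card/subsetP => d; rewrite !inE => /andP[hz hd].
    by rewrite hd zf.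
  case: fd => [[_ h]|[d [_ _ _ h]]].
    rewrite (_ : [set d in feas v | d < c] = set0) ?cards0 //.
    by apply/setP => d; rewrite !inE; apply/negP => /andP[hd /h]; rewrite hd.
  rewrite (leq_ltn_trans (subset_leq_card (_ : _ \subset [set d]))) ?cards1 //.
  by apply/subsetP => d'; rewrite !inE => /andP[hd /h ->].
rewrite ac mul1n in sumS next.
have [//|//|//|st' r o] := @scan x j f c 0 0 stk ev ltc cn.
rewrite subn0 in r.
have base_ge : 2 * n * n.+1 + 1 <= base by rewrite /base; lia.
case: o => [[nb es]|[[z [lz cz]] es]|[[z [lz cz]] es]]; last 1 first.
- rewrite es in r; apply: (next _ _ _ r) => //.
  + by rewrite leq_add2r; lia.
  + apply: (@found_next c') => //; rewrite cand_feas cn /=; apply/negP => /forallP/(_ z).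
    by rewrite lz /blocks cz eqxx orbT.
  + by case/andP=> _ /forallP/(_ z); rewrite lz cz eqxx.
- have cf : c' \in feas v.
    rewrite cand_feas cn /=; apply/forallP => z; apply/implyP => lz.
    by apply: nb.
  rewrite es in r; case: (fd) => [[f0 h]|[d [ltd hd ef h]]].
    apply: (next _ (_ + 1) c.+1); [|by []| | |by []].
    + apply: reach_trans r (reach_step (k := 0) _ (reach_refl _ _)).
      by rewrite /= /vertex /= ev leqNgt ltc cn /= leqnn f0.
    + by move: base_ge; set b := base; set s := bigop _ _ _; lia.
    + right; exists c'; split=> // d ltd hd; apply: val_inj => /=.
      by have := contraTN (h d) hd; move: ltd; rewrite ltnS -leqNgt; lia.
  have ecode : code v = n.+1.
    rewrite /code; case: eqP => [f0|_]; first by rewrite f0 inE in hd.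
    case: pickP => // d' /eqP fe; move: cf hd; rewrite fe !inE => /eqP <- /eqP dc.
    by rewrite dc /= ltnn in ltd.
  apply: reach_le (reach_trans r (reach_step (k := 0) _ (reach_refl _ _))) _.
    by rewrite /= /vertex /= ev leqNgt ltc cn /= leqnn ef ecode.
  rewrite mulS; move: base_ge sumS; set b := base; set s1 := bigop _ _ _.
  set s2 := bigop _ _ _; set s3 := bigop _ _ _; set u := (n - c.+1) * b.
  by move: (2 * n * n.+1) => M; clearbody b s1 s2 s3 u; clear; lia.
(* A light child without feasible colours was met, so [v] has none either and [ff], still 0, is
   already its code. *)
have fe : feas v = set0.
  apply/setP => d; rewrite inE cand_feas; apply/negP => /andP[_ /forallP/(_ z)].
  by rewrite lz /blocks cz.
have f0 : f = code v.
  case: fd => [[-> _]|[d [_ hd _ _]]]; last by rewrite fe inE in hd.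
  by apply/esym/eqP; rewrite code0 fe.
rewrite es f0 in r *; apply: reach_le r _.
rewrite mulS; move: base_ge sumS; set b := base; set s1 := bigop _ _ _.
set s2 := bigop _ _ _; set s3 := bigop _ _ _; set u := (n - c.+1) * b.
by move: (2 * n * n.+1) => M; clearbody b s1 s2 s3 u; clear; lia.
Qed.

(* A colour reaches the light child [y] only if it is blocked by a light child
   that is not smaller, or is one of the first two that no light child blocks. *)
Lemma card_first2 (P : pred 'I_n) :
  #|[set c : 'I_n | P c & #|[set d : 'I_n | P d & d < c]| < 2]| <= 2.
Proof.
set B := [set c | _]; pose below (c : 'I_n) := #|[set d : 'I_n | P d & d < c]|.
have inj : {in B &, injective (fun c => inord (below c) : 'I_2)}.
  have mono (c c' : 'I_n) : P c -> c < c' -> below c < below c'.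
    move=> Pc lt; apply: proper_card; apply/properP; split.
      by apply/subsetP => d; rewrite !inE => /andP[-> h]; apply: ltn_trans lt.
    by exists c; rewrite !inE ?Pc ?lt // ltnn andbF.
  move=> c c'; rewrite !inE => /andP[Pc lc] /andP[Pc' lc'] /(congr1 val) /=.
  rewrite !inordK // => eb; apply: val_inj => /=.
  case: (ltngtP c c') => // lt.
    by have := mono c c' Pc lt; rewrite eb ltnn.
  by have := mono c' c Pc' lt; rewrite eb ltnn.
by rewrite -(card_in_imset inj) (leq_trans (max_card _)) // card_ord.
Qed.

Definition size_rank y := #|[set z | child v z & pos y <= pos z]|.

Lemma heavy_of_light y : light v y -> exists2 h, hv v = Some h & pos y <= pos h.
Proof.
case/andP=> cy _; have := hvP v; case: (hv v) => [h [_ al]|/(_ y)]; last by rewrite cy.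
by exists h => //; apply: al.
Qed.

Lemma size_rank_split y : light v y -> #|[set z | light v z & pos y <= pos z]|.+1 <= size_rank y.
Proof.
move=> ly; have [h eh le] := heavy_of_light ly.
have ch : child v h by have := hvP v; rewrite eh => -[].
rewrite /size_rank (cardsD1 h [set z | child v z & _]) inE ch le add1n ltnS.
apply/subset_leq_card/subsetP => z; rewrite !inE /light eh => /andP[/andP[-> nz] ->].
by rewrite !andbT; apply/eqP => zh; rewrite zh eqxx in nz.
Qed.

(** The two first unblocked colours contribute 2, and each light child from [y] on contributes the
    one colour it blocks. The heavy child counts in [size_rank] but not among these, which turns the
    2 into 1. *)
Lemma visit_count y : light v y ->
  #|[set c : 'I_n | active c & visits c 0 y]| <= (size_rank y).+1.
Proof.
move=> ly.
pose Z := [set c : 'I_n | zc c & #|[set d : 'I_n | zc d & d < c]| < 2].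
pose U := [set (inord (code z).-1 : 'I_n) | z in [set z | light v z & pos y <= pos z]].
apply: (@leq_trans #|Z :|: U|).
  apply/subset_leq_card/subsetP => c; rewrite !inE => /andP[/andP[cn ac] /and3P[_ _ /forallP vis]].
  have [hz|] := boolP (zc c); first by rewrite ac.
  rewrite /zc cn /= negb_forall => /existsP[z]; rewrite negb_imply negbK => /andP[lz /eqP cz].
  apply/imsetP; exists z; last by rewrite cz /= inord_val.
  rewrite inE lz leqNgt; apply/negP => lt; have := vis z.
  by rewrite lz lt /blocks cz eqxx orbT.
rewrite cardsU (leq_trans (leq_subr _ _)) //.
have hU : #|U| <= #|[set z | light v z & pos y <= pos z]| := leq_imset_card _ _.
apply: leq_trans (leq_add (card_first2 zc) hU) _.
by rewrite add2n ltnS size_rank_split.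
Qed.

Lemma size_rank_tl y : light v y -> size_rank y * tl y < tl v.
Proof.
move=> ly; rewrite [tl v]tlE ltnS /size_rank -sum1_card big_distrl /= (big_mkcond (child v)) /= big_mkcond.
apply: leq_sum => z _; rewrite inE; case: (child v z) => //=.
by case: ifP => // /pos_tl; rewrite mul1n; apply: leqW.
Qed.

Lemma size_rank_gt1 y : light v y -> 1 < size_rank y.
Proof.
move=> ly; apply: leq_trans (size_rank_split ly); rewrite ltnS card_gt0.
by apply/set0Pn; exists y; rewrite inE ly leqnn.
Qed.

(** With p the rank and a = A t^3, the inequality (p + 1)(a + 1) <= 2pa needs p >= 2, which the
    heavy child provides, and a >= 3, which is why [2 < A] is required. Then 2p <= p^2 and p t <=
    [tl v]. *)
Lemma visit_cost : 2 < A ->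
  \sum_(d < n | active d) \sum_(y | visits d 0 y) (eval_cost y).+1 <=
  \sum_(y | light v y) A * tl v ^ 2 * tl y.
Proof.
move=> A3; rewrite (eq_bigr (fun d : 'I_n => \sum_(y | light v y && visits d 0 y) (eval_cost y).+1)); last first.
  move=> d _; apply: eq_bigl => y; rewrite /visits; by case: (light v y).
under eq_bigr => d _ do rewrite big_mkcondr /=.
rewrite exchange_big /=; apply: leq_sum => y ly.
rewrite -big_mkcondr /= sum_nat_const.
have -> : #|[pred d | active d & visits d 0 y]| = #|[set c : 'I_n | active c & visits c 0 y]|.
  by apply: eq_card => d; rewrite !inE.
apply: leq_trans (leq_mul (visit_count ly) (leqnn _)) _.
have t0 := tl_gt0 y; have r1 := size_rank_gt1 ly; have le := ltnW (size_rank_tl ly).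
rewrite /eval_cost; set t := tl y in t0 le *; set p := size_rank y in r1 le *.
apply: (@leq_trans (2 * p * (A * t ^ 3))).
  have : 2 < A * t ^ 3 by rewrite (leq_trans A3) // leq_pmulr // expn_gt0 t0.
  move: (A * _) => a; nia.
apply: (@leq_trans (A * (p * t) ^ 2 * t)); last by rewrite leq_mul // leq_mul // leq_sqr.
rewrite expnMn (_ : t ^ 3 = t ^ 2 * t) ?expnSr //.
have : 2 * p <= p ^ 2 by rewrite expnS expn1 leq_mul.
move: (p ^ 2) (t ^ 2) => pp tt; nia.
Qed.
End Visit.

(* The k-th largest child has size at most s / k and is evaluated at most k + 1
   times (once if k = 1), which is what the cubic bound absorbs. *)
Lemma eval_path A : n * base + 3 <= A -> forall v x j stk, j <= plen x ->
  descend x j = v -> exists h,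
  reach (A * tl v ^ 3) (start x, stk) (Fr x j h (code v) n 0 0, stk).
Proof.
move=> leA; elim/tree_ind => v IH x j stk lej ev.
exists (hcode v).
have IHl y : light v y -> forall stk, exists h,
    reach (eval_cost A y) (start y, stk) (Fr y 0 h (code y) n 0 0, stk).
  by case/andP=> cy _ stk'; apply: IH.
(* The heavy child is evaluated first, within the same frame, and hands over its code in one step;
   at the leaf of the path [start] is already the required state. *)
have [k rk lek] : exists2 k, reach k (start x, stk) (Fr x j (hcode v) 0 0 0 0, stk) &
    k <= \sum_(y | child v y && ~~ light v y) A * tl v ^ 2 * tl y + 1.
  have := hvP v; rewrite /hcode; case ehv: (hv v) => [h|] hp.
    case: hp => ch _; have ltj : j < plen x.
      by rewrite ltn_neqAle lej andbT -(plen_hv lej) ev ehv.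
    have eh : descend x j.+1 = h by rewrite /descend iterS -/(descend x j) ev ehv.
    have [h' r] := IH h ch x j.+1 stk ltj eh.
    exists (A * tl h ^ 3 + 1).
      apply: reach_trans r (reach_step (k := 0) _ (reach_refl _ _)).
      by rewrite /= leqnn.
    rewrite leq_add2r (bigD1 h) /=; last by rewrite ch /light ehv eqxx andbF.
    apply: leq_trans (leq_addr _ _); rewrite expnSr mulnA leq_mul // leq_mul // leq_sqr.
    rewrite [tl v]tlE (bigD1 h) //=; apply: leqW; apply: leq_trans (leq_addr _ _).
    exact: leqnSn.
  exists 0; last by [].
  have -> : j = plen x by apply/eqP; rewrite -(plen_hv lej) ev ehv.
  exact: reach_refl.
have rc := @colours v A IHl x j (hcode v) 0 0 stk ev erefl (leq0n _) _ _.
have {}rc := rc ltac:(by left) ltac:(by []).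
apply: reach_le (reach_trans rk rc) _; rewrite subn0.
have vc := @visit_cost v A ltac:(lia).
have sp : \sum_(y | child v y) A * tl v ^ 2 * tl y =
   \sum_(y | light v y) A * tl v ^ 2 * tl y +
   \sum_(y | child v y && ~~ light v y) A * tl v ^ 2 * tl y.
  rewrite (bigID (light v)) /=; congr (_ + _); apply: eq_bigl => y.
  by rewrite /light; case: (child v y).
(* The tours of the children sum to at most [tl v - 1]. The surplus [A * tl v ^ 2] is at least [A]
   and pays for the steps of [v] itself. *)
have st : \sum_(y | child v y) A * tl v ^ 2 * tl y + A * tl v ^ 2 <= A * tl v ^ 3.
  rewrite -big_distrr /= -mulnSr [A * tl v ^ 3](_ : _ = A * tl v ^ 2 * tl v); last by rewrite expnSr mulnA.
  rewrite leq_mul // [leqRHS]tlE ltnS; apply: leq_sum => y _; exact: leqnSn.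
have A1 : A <= A * tl v ^ 2 by rewrite leq_pmulr // expn_gt0 tl_gt0.
move: vc st A1 lek leA; rewrite sp /=; set s1 := bigop _ _ _; set s2 := bigop _ _ _.
set s3 := bigop _ _ _; set a3 := A * _ ^ 3; set a2 := A * _ ^ 2; set bb := n * base.
clearbody s1 s2 s3 a3 a2 bb; clear; lia.
Qed.
Lemma eval_root A : n * base + 3 <= A -> exists f,
  [/\ reach (A * (2 * n) ^ 3) (start r, [::]) (f, [::]), mstep (f, [::]) = None
    & ff f = code r].
Proof.
move=> leA; have [h r1] := eval_path leA (j := 0) [::] (leq0n (plen r)) erefl.
exists (Fr r 0 h (code r) n 0 0); split=> //=; last by rewrite leqnn.
apply: reach_le r1 _; rewrite leq_mul // leq_exp2r // ltnW //; exact: tl_lt.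
Qed.

(** * Invariant of the frame stack and its logarithmic depth *)

Definition okf f := [&& fj f <= plen (fx f), fh f <= n.+1, ff f <= n.+1,
  fc f <= n, fs f <= 2 * n & fy f <= n].

Fixpoint oks x stk :=
  if stk is g :: stk' then
    [&& okf g, fc g < n, fy g < n, light (vertex g) x & oks (fx g) stk']
  else x == r.

Definition wf_state (st : frame * seq frame) := okf st.1 && oks (fx st.1) st.2.

Lemma wf_start : wf_state (start r, [::]).
Proof. by rewrite /wf_state /okf /= !leqnn /= eqxx. Qed.

Lemma wf_step st st' : wf_state st -> mstep st = Some st' -> wf_state st'.
Proof.
case: st => -[x j h f c s y] stk /andP[/= ok os].
case/and5P: ok => /= hj hh hf hc /andP[hs hy].
have okA (j' h' f' c' s' y' : nat) : j' <= plen x -> h' <= n.+1 -> f' <= n.+1 ->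
    c' <= n -> s' <= 2 * n -> y' <= n -> wf_state (Fr x j' h' f' c' s' y', stk).
  by move=> *; rewrite /wf_state /okf /= os; apply/andP; split=> //; do !(apply/andP; split=> //).
rewrite /vertex /=; case: (ltnP c n) => [ltc|gec]; last first.
  case: j hj {okA} (okA) => [|j] hj okA.
    case: stk os okA => [//|g stk] /= /and5P[okg c1 y1 lg os] _ [<-].
    case/and5P: okg => g1 g2 g3 g4 /andP[g5 g6].
    rewrite /resume /at_colour /wf_state /okf; case: eqP => _ /=; first by rewrite g1 g2 g3 leqnn os.
    by case: eqP => _ /=; rewrite g1 g2 g3 ?c1 ?g4 ?g5 ?y1 os.
  by move=> [<-]; apply: okA => //; lia.
case: (cand _ _ _) => /=; last by case=> <-; apply: okA.
case: (leqP (2 * n) s) => hs2.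
  by case: ifP => _ [<-]; apply: okA => //; lia.
case: (leqP n y) => hy2; first by case=> <-; apply: okA.
case: ifP => [/andP[lz _] [<-]|_ [<-]]; last exact: okA.
rewrite /wf_state /okf /= !leqnn /=; apply/and5P; split=> //.
by apply/and5P; split=> //; apply/andP.
Qed.

Lemma tl_descend x j : tl (descend x j) <= tl x.
Proof.
elim: j => // j IH; apply: leq_trans IH; rewrite /descend iterS -/(descend x j).
have := hvP (descend x j); case: (hv _) => [h [ch _]|//] /=.
rewrite [leqRHS]tlE (bigD1 h) //=; apply: leqW; apply: leq_trans (leq_addr _ _).
exact: leqnSn.
Qed.

(** Every frame starts at a light child of the vertex where the frame below waits. That vertex also
    has a heavy child at least as large, so the tour length at least halves; along the path itself
    it does not grow. *)
Lemma oks_depth x stk : oks x stk -> tl x * 2 ^ size stk <= tl r.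
Proof.
elim: stk x => [|g stk IH] x /=; first by move/eqP->; rewrite muln1.
case/and5P=> _ _ _ lx /IH; apply: leq_trans; rewrite expnS mulnA leq_mul //.
apply: leq_trans (tl_descend (fx g) (fj g)); apply: leq_trans (ltnW (size_rank_tl lx)).
by rewrite mulnC leq_mul // size_rank_gt1.
Qed.

Lemma wf_depth st : wf_state st -> size st.2 <= trunc_log 2 (2 * n).
Proof.
case/andP=> _ /oks_depth le; apply: trunc_log_max => //.
apply: leq_trans (ltnW (tl_lt r)); apply: leq_trans le.
by rewrite leq_pmull // tl_gt0.
Qed.
End Rooted.

(** * The program and its correctness *)

Section Wp.
Variable X : finType.
Notation env := {ffun X -> nat * seq nat}.
Implicit Types (E : env) (x y : X).

Lemma seta1 E x a y : (seta E x a y).1 = if y == x then a else (E y).1.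
Proof. by rewrite /seta ffunE; case: ifP. Qed.

Lemma seta2 E x a y : (seta E x a y).2 = (E y).2.
Proof. by rewrite /seta ffunE; case: eqP => // ->. Qed.

Fixpoint writes (c : icmd X) x :=
  match c with
  | ISkip => false
  | Asg y _ | Rd y _ _ | IPush y | IPop y => x == y
  | ISeq c1 c2 | IIf _ c1 c2 => writes c1 x || writes c2 x
  | IWhile _ c => writes c x
  end.

Definition same c E E' := forall x, ~~ writes c x -> E' x = E x.

Variables (R C B D : nat) (rd : nat -> nat -> bool) (N : nat).
Hypothesis N_gt1 : 1 < N.

Lemma iexec_same c E t E' : iexec R C B D rd c E t E' -> same c E E'.
Proof.
elim=> {c E t E'} //=.
- by move=> E x e _ y /= ny; rewrite /seta upd_other.
- by move=> E x e1 e2 _ _ y /= ny; rewrite /seta upd_other.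
- by move=> E x _ y /= ny; rewrite upd_other.
- by move=> E x k s _ y /= ny; rewrite upd_other.
- move=> c1 c2 E1 E2 E3 t1 t2 _ h1 _ h2 y /=; rewrite negb_or => /andP[n1 n2].
  by rewrite h2 // h1.
- by move=> e c1 c2 E E' t _ h y /=; rewrite negb_or => /andP[n1 n2]; apply: h; case: ifP.
- by move=> e c E1 E2 E3 t1 t2 _ _ h1 _ h2 y /= ny; rewrite h2 // h1.
Qed.

Definition wp c E k (Q : env -> Prop) :=
  exists t E', [/\ iexec R C B D rd c E t E', t <= N ^ k & Q E'].

Lemma wp_le c E k k' (Q Q' : env -> Prop) :
  wp c E k Q -> k <= k' -> (forall E', Q E' -> same c E E' -> Q' E') -> wp c E k' Q'.
Proof.
case=> t [E' [ex le q]] lek h; exists t, E'; split=> //; last exact: h (iexec_same ex).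
by rewrite (leq_trans le) // leq_pexp2l //; lia.
Qed.

Lemma wp_skip E k (Q : env -> Prop) : Q E -> wp (ISkip _) E k Q.
Proof. by exists 0, E; split=> //; apply: IXSkip. Qed.

Lemma wp_asg E x e k (Q : env -> Prop) :
  ev E e <= B -> Q (seta E x (ev E e)) -> wp (Asg x e) E k Q.
Proof.
move=> le q; exists 1, (seta E x (ev E e)); split=> //; first exact: IXAsg.
by rewrite expn_gt0; lia.
Qed.

Lemma wp_rd E x e1 e2 k (Q : env -> Prop) : ev E e1 < R -> ev E e2 < C ->
  Q (seta E x (rd (ev E e1) (ev E e2))) -> wp (Rd x e1 e2) E k Q.
Proof.
move=> l1 l2 q; exists 1, (seta E x (rd (ev E e1) (ev E e2))).
split=> //; first exact: IXRd.
by rewrite expn_gt0; lia.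
Qed.

Lemma wp_push E x k (Q : env -> Prop) : size (E x).2 < D ->
  Q (upd E x (0, (E x).1 :: (E x).2)) -> wp (IPush x) E k Q.
Proof.
move=> l q; exists 1, (upd E x (0, (E x).1 :: (E x).2)); split=> //.
  exact: IXPush.
by rewrite expn_gt0; lia.
Qed.

Lemma wp_pop E x a s k (Q : env -> Prop) : (E x).2 = a :: s ->
  Q (upd E x (a, s)) -> wp (IPop x) E k Q.
Proof.
move=> l q; exists 1, (upd E x (a, s)); split=> //; first exact: IXPop.
by rewrite expn_gt0; lia.
Qed.

Lemma wp_seq c1 c2 E k Q :
  wp c1 E k (fun E1 => wp c2 E1 k Q) -> wp (ISeq c1 c2) E k.+1 Q.
Proof.
case=> t1 [E1 [e1 l1 [t2 [E2 [e2 l2 q]]]]]; exists (t1 + t2), E2; split=> //.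
  exact: IXSeq e1 e2.
by rewrite expnS; nia.
Qed.

Lemma wp_if e c1 c2 E k Q :
  (0 < ev E e -> wp c1 E k Q) -> (ev E e = 0 -> wp c2 E k Q) ->
  wp (IIf e c1 c2) E k.+1 Q.
Proof.
move=> h1 h2.
have [t [E' [ex l q]]] : wp (if 0 < ev E e then c1 else c2) E k Q.
  by case: posnP => [/h2|/h1].
exists t.+1, E'; split=> //; first exact: IXIf.
by rewrite expnS; have : 0 < N ^ k by [rewrite expn_gt0; lia]; nia.
Qed.

Lemma wp_while (I : nat -> env -> Prop) i0 e c E a k (Q : env -> Prop) :
  I i0 E -> i0 < N ^ a ->
  (forall i E, I i E -> 0 < ev E e -> wp c E k (fun E' => exists2 i', i' < i & I i' E')) ->
  (forall i E, I i E -> ev E e = 0 -> Q E) ->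
  wp (IWhile e c) E (a + k.+1) Q.
Proof.
move=> hI lt hb hq.
suff [t [E' [ex le q]]] : exists t E',
    [/\ iexec R C B D rd (IWhile e c) E t E', t <= i0 * (N ^ k).+1 + 1 & Q E'].
  exists t, E'; split=> //; apply: leq_trans le _.
  have p : (N ^ k).+1 <= N ^ k.+1.
    by rewrite expnS; have : 0 < N ^ k by [rewrite expn_gt0; lia]; nia.
  by rewrite expnD; apply: leq_trans (leq_mul lt p); rewrite mulSn; lia.
have [j] := ubnP i0; elim: j i0 E {lt} hI => // j IH i0 E hI lt.
have [e0|e0] := posnP (ev E e).
  exists 1, E; split; [exact: IXWhileF|by rewrite addn1|exact: hq hI e0].
have [t1 [E1 [e1 l1 [i1 lt1 h1]]]] := hb _ _ hI e0.
have [|t2 [E2 [e2 l2 q]]] := IH i1 E1 h1; first by lia.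
exists (t1 + t2).+1, E2; split=> //; first exact: IXWhileT e0 e1 e2.
have := leq_mul lt1 (leqnn (N ^ k).+1); rewrite mulSn; lia.
Qed.

Fixpoint pure (c : icmd X) :=
  match c with
  | IPush _ | IPop _ => false
  | ISeq c1 c2 | IIf _ c1 c2 => pure c1 && pure c2
  | IWhile _ c => pure c
  | _ => true
  end.

Lemma iexec_pure c E t E' :
  iexec R C B D rd c E t E' -> pure c -> forall x, (E' x).2 = (E x).2.
Proof.
elim=> {c E t E'} //=.
- by move=> E x e _ _ y; rewrite seta2.
- by move=> E x e1 e2 _ _ _ y; rewrite seta2.
- by move=> c1 c2 E1 E2 E3 t1 t2 _ h1 _ h2 /andP[p1 p2] x; rewrite h2 // h1.
- by move=> e c1 c2 E E' t _ h /andP[p1 p2]; apply: h; case: ifP.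
- by move=> e c E1 E2 E3 t1 t2 _ _ h1 _ h2 p x; rewrite h2 // h1.
Qed.

Lemma wp_pure c E k Q : pure c -> wp c E k Q ->
  wp c E k (fun E' => Q E' /\ forall x, (E' x).2 = (E x).2).
Proof.
move=> p [t [E' [ex le q]]]; exists t, E'; split=> //; split=> //.
exact: iexec_pure ex p.
Qed.

Definition each (f : X -> icmd X) l := foldr (fun x c => ISeq (f x) c) (ISkip X) l.

Lemma wp_push_each l E : uniq l -> (forall x, x \in l -> size (E x).2 < D) ->
  wp (each (@IPush X) l) E (size l) (fun E' =>
    forall x, E' x = if x \in l then (0, (E x).1 :: (E x).2) else E x).
Proof.
elim: l E => [|y l IH] E /=; first by move=> _ _; apply: wp_skip.
case/andP=> ny ul hs; apply: wp_seq; apply: wp_push; first by rewrite hs ?mem_head.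
set E1 := upd E y _.
have e1 x : x != y -> E1 x = E x by move=> ne; rewrite /E1 upd_other.
apply: (wp_le (IH E1 ul _)) => // [x hx|E' h _ x].
  by rewrite e1; [apply: hs; rewrite inE hx orbT|apply: contraNneq ny => <-].
rewrite h inE; have [->|ne] /= := eqVneq x y; last by rewrite e1.
by rewrite (negbTE ny) /E1 upd_same.
Qed.

Lemma wp_pop_each l E : uniq l -> (forall x, x \in l -> (E x).2 <> [::]) ->
  wp (each (@IPop X) l) E (size l) (fun E' =>
    forall x, E' x = if x \in l then (head 0 (E x).2, behead (E x).2) else E x).
Proof.
elim: l E => [|y l IH] E /=; first by move=> _ _; apply: wp_skip.
case/andP=> ny ul hs; apply: wp_seq.
have := hs y (mem_head _ _); case ey: (E y).2 => [//|a s] _.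
apply: (@wp_pop _ _ _ _ _ _ ey); set E1 := upd E y _.
have e1 x : x != y -> E1 x = E x by move=> ne; rewrite /E1 upd_other.
apply: (wp_le (IH E1 ul _)) => // [x hx|E' h _ x].
  by rewrite e1; [apply: hs; rewrite inE hx orbT|apply: contraNneq ny => <-].
rewrite h inE; have [->|ne] /= := eqVneq x y; last by rewrite e1.
by rewrite (negbTE ny) /E1 upd_same ey.
Qed.
End Wp.

Local Notation X := 'I_26.
Local Notation "# k" := (@Ordinal 26 k isT) (at level 0, k at level 0).
(* The frame at the top of the stack is in [vA] to [vY] ([vA] is the parent of
   [vX]), the others lie below it on the same tracks, and [vG] counts them; the
   remaining variables are global. *)
Definition vA : X := #0.
Definition vX : X := #1.
Definition vJ : X := #2.
Definition vH : X := #3.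
Definition vF : X := #4.
Definition vC : X := #5.
Definition vS : X := #6.
Definition vY : X := #7.
Definition vG : X := #8.
Definition vR : X := #9.
Definition vGo : X := #10.
Definition vN : X := #11.
Definition vP : X := #12.
Definition vU : X := #13.
Definition vZ : X := #14.
Definition vQ : X := #15.
Definition vK : X := #16.
Definition vV : X := #17.
Definition vW : X := #18.
Definition vPP : X := #19.
Definition vVV : X := #20.
Definition vHV : X := #21.
Definition vHB : X := #22.
Definition vI : X := #23.
Definition vI2 : X := #24.
Definition vLT : X := #25.

Declare Scope imp_scope.
Delimit Scope imp_scope with imp.
Bind Scope imp_scope with icmd.
Notation "c1 ;; c2" := (ISeq c1 c2) (at level 60, right associativity) : imp_scope.
Notation "x <- e" := (Asg x e) (at level 55) : imp_scope.
Local Open Scope imp_scope.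

Local Notation one := (Succ (Zero X)).
Definition neq x y : iexp X := Plus (Minus (Var x) (Var y)) (Minus (Var y) (Var x)).

Lemma ev_neq E x y : (ev E (neq x y) == 0) = ((E x).1 == (E y).1).
Proof. by rewrite /=; lia. Qed.

(** One [turn]: the row of [vU] is searched cyclically from the column after [vP]. The search ends
    at the latest at [vP] itself, which is a neighbour. *)
Definition NEXT : icmd X :=
  vZ <- Var vP ;; vQ <- Zero _ ;;
  IWhile (Minus one (Var vQ))
    (vZ <- Succ (Var vZ) ;;
     IIf (Minus (Var vN) (Var vZ)) (ISkip _) (vZ <- Zero _) ;;
     Rd vQ (Var vU) (Var vZ)) ;;
  vP <- Var vU ;; vU <- Var vZ.

Definition SIZE : icmd X :=
  vP <- Var vV ;; vU <- Var vW ;; vK <- Zero _ ;;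
  IWhile (Plus (neq vP vW) (neq vU vV)) (NEXT ;; vK <- Succ (Var vK)).

(** The test [vHB <= vK] lets the later index win a tie, in agreement with [pos]. [vHV] holds the
    index plus one, and 0 means that there is no child. *)
Definition HEAVY : icmd X :=
  vHB <- Zero _ ;; vHV <- Zero _ ;; vI <- Zero _ ;;
  IWhile (Minus (Var vN) (Var vI))
    (Rd vQ (Var vVV) (Var vI) ;;
     IIf (Var vQ)
       (IIf (neq vI vPP)
         (vV <- Var vVV ;; vW <- Var vI ;; SIZE ;;
          IIf (Minus (Succ (Var vK)) (Var vHB))
            (vHB <- Var vK ;; vHV <- Succ (Var vI)) (ISkip _))
         (ISkip _))
       (ISkip _) ;;
     vI <- Succ (Var vI)).

Definition DOWN : icmd X := vPP <- Var vVV ;; vVV <- Minus (Var vHV) one.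

Definition PATHLEN : icmd X :=
  vPP <- Var vA ;; vVV <- Var vX ;; vJ <- Zero _ ;; HEAVY ;;
  IWhile (Var vHV) (DOWN ;; vJ <- Succ (Var vJ) ;; HEAVY).

(** A frame stores only the head of its path and a depth; the current vertex and its parent are
    recovered by walking down again. *)
Definition DESCEND : icmd X :=
  vPP <- Var vA ;; vVV <- Var vX ;; vI2 <- Var vJ ;;
  IWhile (Var vI2) (HEAVY ;; DOWN ;; vI2 <- Minus (Var vI2) one).

Definition RESET : icmd X := vS <- Zero _ ;; vY <- Zero _.

Definition fvars : seq X := [:: vA; vX; vJ; vH; vF; vC; vS; vY].
Definition PUSH : icmd X := each (@IPush X) fvars.
Definition POP : icmd X := each (@IPop X) fvars.

Definition RETURN : icmd X :=
  vR <- Var vF ;; POP ;; vG <- Minus (Var vG) one ;;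
  IIf (Var vR)
    (IIf (Plus (Minus (Var vR) (Succ (Var vC))) (Minus (Succ (Var vC)) (Var vR)))
       (vY <- Succ (Var vY))
       (vC <- Succ (Var vC) ;; RESET))
    (vC <- Var vN ;; RESET).

Definition FINISH : icmd X :=
  IIf (Var vJ)
    (vJ <- Minus (Var vJ) one ;; vH <- Var vF ;; vF <- Zero _ ;; vC <- Zero _ ;; RESET)
    (IIf (Var vG) RETURN (vGo <- Zero _)).

Definition CALL : icmd X :=
  vW <- Var vY ;; PUSH ;; vA <- Var vVV ;; vX <- Var vW ;; vH <- Succ (Var vN) ;;
  vG <- Succ (Var vG) ;; PATHLEN.

Definition LIGHT : icmd X :=
  vLT <- Zero _ ;; Rd vQ (Var vVV) (Var vY) ;;
  IIf (Var vQ)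
    (IIf (neq vY vPP)
      (HEAVY ;;
       IIf (Plus (Minus (Var vHV) (Succ (Var vY))) (Minus (Succ (Var vY)) (Var vHV)))
         (vV <- Var vVV ;; vW <- Var vY ;; SIZE ;;
          IIf (neq vK vS) (ISkip _) (vLT <- one))
         (ISkip _))
      (ISkip _))
    (ISkip _).

Definition CHILD : icmd X := LIGHT ;; IIf (Var vLT) CALL (vY <- Succ (Var vY)).

Definition FOUND : icmd X :=
  IIf (Var vF) (vF <- Succ (Var vN) ;; vC <- Var vN)
    (vF <- Succ (Var vC) ;; vC <- Succ (Var vC)) ;;
  RESET.

Definition CAND : icmd X :=
  vLT <- Zero _ ;; Rd vQ (Plus (Var vN) (Var vVV)) (Var vC) ;;
  IIf (Var vQ)
    (IIf (Var vH)
      (IIf (Plus (Minus (Var vH) (Succ (Var vC))) (Minus (Succ (Var vC)) (Var vH)))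
        (vLT <- one) (ISkip _)) (ISkip _)) (ISkip _).

Definition BODY : icmd X :=
  DESCEND ;;
  IIf (Minus (Var vN) (Var vC))
    (CAND ;;
     IIf (Var vLT)
       (IIf (Minus (Plus (Var vN) (Var vN)) (Var vS))
         (IIf (Minus (Var vN) (Var vY)) CHILD (vS <- Succ (Var vS) ;; vY <- Zero _))
         FOUND)
       (vC <- Succ (Var vC) ;; RESET))
    FINISH.

Definition MAIN : icmd X :=
  vH <- Succ (Var vN) ;; PATHLEN ;; vGo <- one ;; IWhile (Var vGo) BODY.

Section Specs.
Variables (m : nat) (e : rel 'I_m.+1) (L : 'I_m.+1 -> {set 'I_m.+1}).
Notation n := m.+1.
Variables (par : 'I_n -> 'I_n) (dep : 'I_n -> nat).
Hypothesis par_root : par ord0 = ord0.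
Hypothesis dep_root : dep ord0 = 0.
Hypothesis dep_par : forall v, v != ord0 -> dep v = (dep (par v)).+1.
Hypothesis edge_par : forall u v,
  e u v = ((u != ord0) && (par u == v)) || ((v != ord0) && (par v == u)).

Variables (B D N : nat) (rd : nat -> nat -> bool).
Hypothesis rd_edge : forall u v : 'I_n, rd u v = e u v.
Hypothesis rd_list : forall u c : 'I_n, rd (n + u) c = (c \in L u).
Hypothesis B_big : 2 * n + 2 <= B.
Hypothesis N_big : 2 * n + 4 <= N.
Hypothesis D_big : trunc_log 2 (2 * n) < D.

Notation wp := (wp (2 * n) n B D rd N).
Notation env := {ffun X -> nat * seq nat}.
Implicit Types E : env.

Let N_gt1 : 1 < N. Proof. by lia. Qed.

Local Notation sseq := (wp_seq N_gt1).
Local Notation sasg := (@wp_asg _ _ _ _ _ _ _ N_gt1 _ _ _ _ _).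
Local Notation srd := (@wp_rd _ _ _ _ _ _ _ N_gt1 _ _ _ _ _ _).
Local Notation sif := (wp_if N_gt1).
Local Notation sle := (wp_le N_gt1).
Local Notation swhile := (wp_while N_gt1).
Local Notation sskip := (@wp_skip _ _ _ _ _ _ _ _ _ _).

Lemma rot_enum_nth p i : p < n -> i < n ->
  nth ord0 (rot p.+1 (enum 'I_n)) i = (if p.+1 + i < n then p.+1 + i else p.+1 + i - n) :> nat.
Proof.
move=> ltp lti; rewrite /rot nth_cat size_drop size_enum_ord nth_drop.
case: ltnP => h1; case: ltnP => h2; try (exfalso; lia).
  by rewrite nth_enum_ord.
by rewrite nth_take ?nth_enum_ord; lia.
Qed.

(** Rotating the vertices so that [p] comes last rotates the neighbour list likewise. The cyclic
    successor of the last neighbour [p] is then the first neighbour in the rotated order. *)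
Lemma next_nbrs (u p : 'I_n) i : e u p -> i < n ->
  let l := rot p.+1 (enum 'I_n) in
  e u (nth ord0 l i) -> (forall j, j < i -> ~~ e u (nth ord0 l j)) ->
  path.next (nbrs e u) p = nth ord0 l i.
Proof.
move=> eup lti l ei no.
have sl : size l = n by rewrite size_rot size_enum_ord.
have fl : exists k, filter (e u) l = rot k (nbrs e u).
  exists (size (filter (e u) (take p.+1 (enum 'I_n)))).
  have -> : nbrs e u = filter (e u) (take p.+1 (enum 'I_n)) ++ filter (e u) (drop p.+1 (enum 'I_n)).
    by rewrite -filter_cat cat_take_drop.
  by rewrite rot_size_cat /l /rot filter_cat.
have un : uniq (nbrs e u) by rewrite filter_uniq // enum_uniq.
have [k fk] := fl; rewrite -(next_rot k un) -fk.
have ul : uniq (filter (e u) l) by rewrite fk rot_uniq.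
have el : l = take i l ++ nth ord0 l i :: drop i.+1 l.
  by rewrite -drop_nth ?sl // cat_take_drop.
have t0 : filter (e u) (take i l) = [::].
  apply/eqP; rewrite -(negbK (_ == _)) -has_filter; apply/negP => /hasP[x].
  case/(nthP ord0) => j; rewrite size_take sl lti => ltj; rewrite nth_take // => <-.
  by apply/negP/no.
have lastl : last (nth ord0 l i) (drop i.+1 l) = p.
  have -> : last (nth ord0 l i) (drop i.+1 l) = last ord0 l by rewrite [in RHS]el last_cat.
  rewrite -nth_last sl; apply: val_inj; rewrite /= rot_enum_nth //.
  by rewrite ifF; lia.
have f2 : filter (e u) l = nth ord0 l i :: filter (e u) (drop i.+1 l).
  by rewrite [in LHS]el filter_cat t0 /= ei.
have l2 : last (nth ord0 l i) (filter (e u) (drop i.+1 l)) = p.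
  have [q eq] : exists q, drop i.+1 l = q by eexists.
  move: lastl; rewrite eq; case/lastP: q {eq} => [//|q y].
  by rewrite last_rcons => ->; rewrite filter_rcons eup last_rcons.
by rewrite f2 -[X in path.next _ X]l2 next_end // -f2.
Qed.
Ltac look := rewrite /= ?seta1 /=.

Lemma next_spec E (u p : 'I_n) : (E vN).1 = n -> (E vP).1 = p -> (E vU).1 = u ->
  e u p ->
  wp NEXT E 12 (fun E' => (E' vP).1 = u /\ (E' vU).1 = path.next (nbrs e u) p).
Proof.
move=> hN hP hU eup.
set l := rot p.+1 (enum 'I_n).
pose zz j := if p + j < n then p + j else p + j - n.
have lz j : j < n -> nth ord0 l j = zz j.+1 :> nat.
  by move=> lt; rewrite rot_enum_nth // /zz addnS.
have lp : e u (nth ord0 l m).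
  suff -> : nth ord0 l m = p by [].
  by apply: val_inj; rewrite /= lz // /zz ifF; have := ltn_ord p; lia.
(* [zz j] is p + j modulo n. Either the first [j] columns after [p] have been rejected, or the last
   one inspected is the neighbour sought. *)
pose I i E := [/\ (E vN).1 = n, (E vU).1 = u &
  exists j, [/\ (E vZ).1 = zz j, j <= n &
   ([/\ (E vQ).1 = 0, i = n - j & forall k, k < j -> ~~ e u (nth ord0 l k)]) \/
   ([/\ (E vQ).1 = 1, i = 0, 0 < j, e u (nth ord0 l j.-1) &
        forall k, k < j.-1 -> ~~ e u (nth ord0 l k)])]].
apply: sseq; apply: sasg; first by rewrite /= hP; have := ltn_ord p; lia.
apply: sseq; apply: sasg => //.
apply: sseq; apply: (sle (k := 1 + 5) (Q := fun E => I 0 E /\ (E vQ).1 = 1)) => //.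
  apply: (swhile (I := I) (i0 := n)) => //.
  - rewrite /I; look; split=> //; exists 0; split=> //; last by left; rewrite subn0.
    by rewrite hP /zz addn0 ltn_ord.
  - by rewrite expn1; lia.
  - move=> i {hN hP hU}E [hN hU [j [hZ lej [[hQ -> no]|[hQ]]]]] /=; rewrite hQ // => _.
    have ltj : j < n.
      rewrite ltn_neqAle lej andbT; apply/eqP => ej; have := no m.
      by rewrite ej lp => /(_ (ltnSn _)).
    apply: sseq; apply: sasg; first by rewrite /= hZ /zz; have := ltn_ord p; case: ifP; lia.
    apply: sseq.
    have done_Z E1 : (E1 vN).1 = n -> (E1 vU).1 = u -> (E1 vZ).1 = zz j.+1 ->
      wp (Rd vQ (Var vU) (Var vZ)) E1 2 (fun E' => exists2 i', i' < n - j & I i' E').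
      move=> h1 h2 h3; apply: srd; rewrite /= ?h2 ?h3 -?lz //; try (have := ltn_ord u; lia).
      rewrite rd_edge; case ej: (e u _); [exists 0; first lia|exists (n - j.+1); first lia];
        rewrite /I; look; split=> //; exists j.+1; split=> //.
        by right; split.
      left; split=> // k; rewrite ltnS leq_eqVlt => /orP[/eqP->|]; last exact: no.
      by rewrite ej.
    apply: sif; look; rewrite hN hZ => hc.
      apply: sskip; apply: sle (done_Z _ _ _ _) _ _ => //; look => //.
      by move: hc; rewrite /zz; case: ifP; case: ifP; lia.
    apply: sasg => //; apply: sle (done_Z _ _ _ _) _ _ => //; look => //.
    by move: hc; rewrite /zz; have := ltn_ord p; case: ifP; case: ifP; lia.
  - move=> i E' [h1 h2 [j [hZ lej [[hQ] _ _|[hQ i0 j0 ej no]]]]] /=; first by rewrite hQ.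
    move=> _; split=> //; split=> //; exists j; split=> //; by right.
move=> E' [[h1 h2 [j [hZ lej [[hQ] _ _|[hQ _ j0 ej no]]]]] hQ'] _; first by rewrite hQ in hQ'.
apply: sseq; apply: sasg; first by rewrite /= h2; have := ltn_ord u; lia.
apply: sasg; look; rewrite ?hZ.
  by rewrite /zz; have := ltn_ord p; case: ifP; lia.
split=> //; rewrite (next_nbrs eup (i := j.-1)) //; try lia.
by rewrite lz ?prednK //; lia.
Qed.
Local Notation child := (child par).
Local Notation tl := (tl par dep).
Local Notation hv := (hv par dep).
Local Notation pos := (pos par dep).
Local Notation light := (light par dep).
Local Notation descend := (descend par dep).
Local Notation plen := (plen dep_root dep_par).

Lemma B_ord (v : 'I_n) : v.+1 <= B. Proof. by have := ltn_ord v; lia. Qed.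

Lemma tl_le v : tl v < 2 * n. Proof. exact: tl_lt. Qed.

Lemma size_spec E (v w : 'I_n) : child v w -> (E vN).1 = n -> (E vV).1 = v ->
  (E vW).1 = w -> wp SIZE E 20 (fun E' => (E' vK).1 = tl w).
Proof.
move=> cw hN hV hW; have /andP[nr /eqP pw] := cw.
have [t1 t2] := tourP par_root dep_root dep_par edge_par nr; rewrite pw in t1 t2.
have evw : e v w by have := cw; rewrite -(edge_child par_root dep_root dep_par edge_par) => /andP[].
pose I i E := [/\ (E vN).1 = n, (E vV).1 = v, (E vW).1 = w &
  exists k, [/\ (E vP).1 = (iter k (turn e) (v, w)).1, (E vU).1 = (iter k (turn e) (v, w)).2,
    (E vK).1 = k & i + k = tl w]].
apply: sseq; apply: sasg; first by rewrite /= hV; have := B_ord v; lia.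
apply: sseq; apply: sasg; first by look; rewrite hW; have := B_ord w; lia.
apply: sseq; apply: sasg => //.
apply: (sle (k := 1 + 14) (Q := fun E => (E vK).1 = tl w)) => //.
apply: (swhile (I := I) (i0 := tl w)).
- by rewrite /I; look; split=> //; exists 0; rewrite addn0.
- by rewrite expn1; have := tl_le w; lia.
- move=> i {hN hV hW}E [hN hV hW [k [hP hU hK ik]]].
  rewrite lt0n [ev _ _]/(_ + _) addn_eq0 !ev_neq hP hU hV hW => ne.
  have ltk : k < tl w.
    case: i ik => [|i] ik; last by lia.
    have ek : k = tl w by lia.
    by move: ne; rewrite ek t1 /= !eqxx.
  have edge := iter_turn_edge edge_par k (evw : e (v, w).1 (v, w).2).
  rewrite (edge_sym edge_par) in edge.
  apply: sseq; apply: (sle (next_spec hN hP hU edge)) => // E1 [h1 h2] sm.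
  have eK : E1 vK = E vK by apply: sm.
  apply: sasg; look; rewrite eK hK; first by have := tl_le w; lia.
  exists (i.-1); first by lia.
  rewrite /I; look; rewrite (sm vN) // (sm vV) // (sm vW) //; split=> //; exists k.+1; split=> //; last by lia.
move=> i {hN hV hW}E [hN hV hW [k [hP hU hK ik]]] /eqP.
rewrite [ev _ _]/(_ + _) addn_eq0 !ev_neq hP hU hV hW => /andP[/eqP e1 /eqP e2].
(* Had the loop stopped before [tl w] turns, the current edge would point to [v], making the parent
   [v] a descendant of [w]. *)
rewrite hK; case: (leqP (tl w) k) => [|ltk]; first by lia.
have := t2 k ltk; rewrite (val_inj e2) => dv.
by have := par_not_desc dep_par nr; rewrite pw dv.
Qed.

Definition hcn v := if hv v is Some h then (h : nat).+1 else 0.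

Lemma heavy_spec E (v : 'I_n) : (E vN).1 = n -> (E vPP).1 = par v -> (E vVV).1 = v ->
  wp HEAVY E 36 (fun E' => (E' vHV).1 = hcn v).
Proof.
move=> hN hPP hVV.
pose best (i : nat) hb hw := (hb = 0 /\ hw = 0 /\ forall z, child v z -> i <= z) \/
  exists h : 'I_n, [/\ hb = tl h, hw = h.+1, child v h, h < i &
    forall z, child v z -> z < i -> pos z <= pos h].
pose I j E := [/\ (E vN).1 = n, (E vPP).1 = par v, (E vVV).1 = v &
  exists i, [/\ (E vI).1 = i, i <= n, i + j = n & best i (E vHB).1 (E vHV).1]].
do 3 (apply: sseq; apply: sasg => //).
apply: (sle (k := 1 + 30) (Q := fun E => (E vHV).1 = hcn v)) => //.
apply: (swhile (I := I) (i0 := n)).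
- rewrite /I; look; split=> //; exists 0; split=> //.
  by left; split=> //; split.
- by rewrite expn1; lia.
- move=> j {hN hPP hVV}E [hN hPP hVV [i [hI lei ij hb]]] /=; rewrite hN hI => lti'.
  have lti : i < n by lia.
  pose y := Ordinal lti.
  have fin E1 : (E1 vN).1 = n -> (E1 vPP).1 = par v -> (E1 vVV).1 = v ->
      (E1 vI).1 = i -> best i.+1 (E1 vHB).1 (E1 vHV).1 ->
      wp (vI <- Succ (Var vI)) E1 27 (fun E' => exists2 i', i' < j & I i' E').
    move=> h1 h2 h3 h4 h5; apply: sasg; look; rewrite h4; first by lia.
    exists j.-1; first by lia.
    by rewrite /I; look; split=> //; exists i.+1; split=> //; lia.
  have skip E1 : ~~ child v y -> (E1 vN).1 = n -> (E1 vPP).1 = par v -> (E1 vVV).1 = v ->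
      (E1 vI).1 = i -> (E1 vHB).1 = (E vHB).1 -> (E1 vHV).1 = (E vHV).1 ->
      wp (vI <- Succ (Var vI)) E1 27 (fun E' => exists2 i', i' < j & I i' E').
    move=> ny h1 h2 h3 h4 h5 h6; apply: fin => //; rewrite h5 h6.
    have nz z : child v z -> z <> y by move=> cz zy; move: ny; rewrite -zy cz.
    case: hb => [[-> [-> al]]|[h [-> -> ch lth al]]]; [left|right].
      split=> //; split=> // z cz; rewrite ltn_neqAle al // andbT.
      by apply/eqP => iz; apply: (nz z cz); apply: val_inj.
    exists h; split=> //; first exact: leqW.
    move=> z cz; rewrite ltnS leq_eqVlt => /orP[/eqP iz|]; last exact: al.
    by case: (nz z cz); apply: val_inj.
  have cy : child v y = e v y && (y != par v).
    by rewrite (edge_child par_root dep_root dep_par edge_par).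
  apply: sseq; apply: srd; rewrite /= ?hVV ?hI //.
    by have := ltn_ord v; lia.
  rewrite (rd_edge v y); apply: sseq.
  apply: sif; look; case evy: (e v y) => // _; last first.
    by apply: sskip; apply: skip; look => //; rewrite cy evy.
  apply: sif; [rewrite lt0n|move/eqP]; rewrite ev_neq; look; rewrite hI hPP => hy; last first.
    by apply: sskip; apply: skip; look => //; rewrite cy evy /= negbK.
  have {}cy : child v y by rewrite cy evy.
  apply: sseq; apply: sasg; look; first by rewrite hVV; have := B_ord v; lia.
  apply: sseq; apply: sasg; look; first by rewrite hI; lia.
  apply: sseq; apply: sle (size_spec cy _ _ _) _ _ => //; look => //.
  move=> E1 hK sm.
  have eN : (E1 vN).1 = n by rewrite sm //; look.
  have ePP : (E1 vPP).1 = par v by rewrite sm //; look.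
  have eVV : (E1 vVV).1 = v by rewrite sm //; look.
  have eI : (E1 vI).1 = i by rewrite sm //; look.
  have eHB : (E1 vHB).1 = (E vHB).1 by rewrite sm //; look.
  have eHV : (E1 vHV).1 = (E vHV).1 by rewrite sm //; look.
  have pos_lt a b : tl a < tl b -> pos a <= pos b.
    rewrite !posE => lt; have := leq_mul lt (leqnn n.+1); rewrite mulSn.
    by have := ltn_ord a; lia.
  apply: sif; rewrite /= hK eHB => cmp.
    apply: sseq; apply: sasg; look; first by rewrite hK; have := tl_le y; lia.
    apply: sasg; look; first by rewrite eI; lia.
    apply: fin; look => //; rewrite hK eI; right; exists y; split=> //.
    move=> z cz; rewrite ltnS leq_eqVlt => /orP[/eqP zi|ltz].
      by have -> : z = y by apply: val_inj.
    case: hb => [[_ [_ al]]|[h [eb _ ch lth al]]].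
      by have := al z cz; lia.
    apply: leq_trans (al z cz ltz) _; rewrite eb in cmp.
    have : tl h <= tl y by lia.
    rewrite leq_eqVlt => /orP[/eqP eq|]; last exact: pos_lt.
    rewrite !posE eq leq_add2l; exact: ltnW.
  apply: sskip; apply: fin => //; rewrite eHB eHV; right.
  case: hb => [[hb _]|[h [eb ev ch lth al]]]; first by rewrite hb in cmp; lia.
  exists h; split=> //; first exact: leqW.
  move=> z cz; rewrite ltnS leq_eqVlt => /orP[/eqP zi|ltz]; last exact: al.
  have -> : z = y by apply: val_inj.
  by apply: pos_lt; move/eqP: cmp; rewrite eb subn_eq0.
move=> j {hN hPP hVV}E [hN hPP hVV [i [hI lei ij hb]]] /=; rewrite hN hI => ni.
have ei : i = n by lia.
rewrite /hcn; have := hvP par dep v; rewrite ei in hb.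
case: hb => [[_ [-> al]]|[h [_ -> ch _ al]]]; case ehv: (hv v) => [h'|] hp //.
- by case: hp => ch _; have := al h' ch; have := ltn_ord h'; lia.
- case: hp => ch' al'; congr (_.+1); congr val; apply: (@pos_inj _ par dep).
  by apply/eqP; rewrite eqn_leq al' // al.
- by have := hp h; rewrite ch.
Qed.
Lemma down_step x j : j < plen x -> exists h : 'I_n,
  [/\ hcn (descend x j) = h.+1, descend x j.+1 = h & par h = descend x j].
Proof.
move=> lt; have := plen_hv (ltnW lt); have := hvP par dep (descend x j).
rewrite /hcn descendS.
case ehv: (hv (descend x j)) => [h|] hp; last by rewrite eqxx; move/esym/eqP; lia.
by move=> _; exists h; split=> //; case: hp => /andP[_ /eqP].
Qed.

Lemma pathlen_spec E (x : 'I_n) : (E vN).1 = n -> (E vA).1 = par x -> (E vX).1 = x ->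
  wp PATHLEN E 50 (fun E' => (E' vJ).1 = plen x).
Proof.
move=> hN hA hX.
pose I i E := (E vN).1 = n /\ exists j, [/\ (E vJ).1 = j, j <= plen x, i + j = plen x,
  (E vVV).1 = descend x j & (E vHV).1 = hcn (descend x j)].
apply: sseq; apply: sasg; look; first by rewrite hA; have := B_ord (par x); lia.
apply: sseq; apply: sasg; look; first by rewrite hX; have := B_ord x; lia.
apply: sseq; apply: sasg; look => //.
apply: sseq; apply: sle (@heavy_spec _ x _ _ _) _ _ => //; look => //.
move=> E1 hHV sm.
have eN : (E1 vN).1 = n by rewrite sm //; look.
have eJ : (E1 vJ).1 = 0 by rewrite sm //; look.
have eVV : (E1 vVV).1 = x by rewrite sm //; look.
apply: (sle (k := 1 + 42) (Q := fun E => (E vJ).1 = plen x)) => //.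
apply: (swhile (I := I) (i0 := plen x)).
- by split=> //; exists 0; rewrite addn0; split.
- by rewrite expn1; have := plen_lt dep_root dep_par x; lia.
- move=> i {E1 hN hA hX hHV sm eN eJ eVV}E [hN [j [hJ lej ij hVV hHV]]] /=; rewrite hHV => gt0.
  have ltj : j < plen x.
    rewrite ltn_neqAle lej andbT -(plen_hv lej); move: gt0.
    by rewrite /hcn; case: (hv _).
  have [h [eh dh ph]] := down_step ltj.
  have ltp := plen_lt dep_root dep_par x.
  apply: sseq; apply: sseq; apply: sasg; look.
    by rewrite hVV; have := B_ord (descend x j); lia.
  apply: sasg; look; rewrite hHV eh subn1 /=; first by have := B_ord h; lia.
  apply: sseq; apply: sasg; look; rewrite hJ; first by lia.
  apply: sle (@heavy_spec _ h _ _ _) _ _ => //; look => //; first by rewrite hVV ph.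
  move=> E1 hHV' sm; exists i.-1; first by lia.
  split; first by rewrite sm //; look.
  exists j.+1; split=> //; try lia.
  + by rewrite sm //; look.
  + by rewrite dh sm //; look.
  + by rewrite dh.
move=> i {E1 hN hA hX hHV sm eN eJ eVV}E [hN [j [hJ lej ij hVV hHV]]] /=; rewrite hHV hJ => h0.
apply/eqP; rewrite -(plen_hv lej); move: h0; rewrite /hcn.
by case: (hv _).
Qed.

Lemma descend_spec E (x : 'I_n) j : j <= plen x -> (E vN).1 = n ->
  (E vA).1 = par x -> (E vX).1 = x -> (E vJ).1 = j ->
  wp DESCEND E 50 (fun E' => (E' vPP).1 = par (descend x j) /\ (E' vVV).1 = descend x j).
Proof.
move=> lej hN hA hX hJ.
have ltp := plen_lt dep_root dep_par x.
pose I i E := [/\ (E vN).1 = n, (E vI2).1 = i & exists k, [/\ i + k = j,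
  (E vVV).1 = descend x k & (E vPP).1 = par (descend x k)]].
apply: sseq; apply: sasg; look; first by rewrite hA; have := B_ord (par x); lia.
apply: sseq; apply: sasg; look; first by rewrite hX; have := B_ord x; lia.
apply: sseq; apply: sasg; look; rewrite hJ; first by lia.
apply: (sle (k := 1 + 42) (Q := fun E => (E vPP).1 = par (descend x j) /\ (E vVV).1 = descend x j)) => //.
apply: (swhile (I := I) (i0 := j)).
- by rewrite /I; look; split=> //; exists 0; rewrite addn0.
- by rewrite expn1; lia.
- move=> i {hN hA hX hJ}E [hN hI [k [ik hVV hPP]]] /=; rewrite hI => gt0.
  have ltk : k < plen x by lia.
  have [h [eh dh ph]] := down_step ltk.
  apply: sseq; apply: sle (heavy_spec hN hPP hVV) _ _ => // E1 hHV sm.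
  have eI : (E1 vI2).1 = i by rewrite sm.
  have eN : (E1 vN).1 = n by rewrite sm.
  have eVV : (E1 vVV).1 = descend x k by rewrite sm.
  apply: sseq; apply: sseq; apply: sasg; look.
    by rewrite eVV; have := B_ord (descend x k); lia.
  apply: sasg; look; rewrite hHV eh subn1 /=; first by have := B_ord h; lia.
  apply: sasg; look; rewrite eI; first by lia.
  exists i.-1; first by lia.
  rewrite /I; look; split=> //; first by lia.
  exists k.+1; split=> //; first by lia.
  + by rewrite dh.
  + by rewrite dh ph.
move=> i {hN hA hX hJ}E [hN hI [k [ik hVV hPP]]] /=; rewrite hI => i0.
by have -> : j = k by lia.
Qed.

Lemma ev_diff k c : (0 < (k - c.+1) + (c.+1 - k)) = (k != c.+1).
Proof. by lia. Qed.

Lemma cand_spec E (v : 'I_n) c : c < n -> (E vN).1 = n -> (E vVV).1 = v -> (E vC).1 = c ->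
  wp CAND E 10 (fun E' => (E' vLT).1 = cand L v (E vH).1 c).
Proof.
move=> ltc hN hVV hC.
apply: sseq; apply: sasg => //; apply: sseq; apply: srd; look; rewrite ?hN ?hVV ?hC //.
  by have := ltn_ord v; lia.
have := rd_list v (inord c); rewrite inordK // => ->; rewrite /cand.
apply: sif; look; case: (_ \in _) => // _; last by apply: sskip; look.
apply: sif; look; last by move=> ->; apply: sskip; look.
rewrite lt0n => hH.
apply: sif; look; rewrite ?hC; last first.
  by move=> d0; apply: sskip; look; have := ev_diff (E vH).1 c; rewrite d0 => /esym/negbFE ->; rewrite andbF.
by rewrite ev_diff => hc; apply: sasg; look; [lia|rewrite hH hc].
Qed.

Lemma light_spec E (v : 'I_n) y : y < n -> (E vN).1 = n -> (E vPP).1 = par v ->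
  (E vVV).1 = v -> (E vY).1 = y ->
  wp LIGHT E 45 (fun E' => (E' vLT).1 = light v (inord y) && (tl (inord y) == (E vS).1)).
Proof.
move=> lty hN hPP hVV hY; pose w : 'I_n := inord y.
have ew : y = w by rewrite inordK.
have cw := edge_child par_root dep_root dep_par edge_par v w.
rewrite -/w lightE -cw.
apply: sseq; apply: sasg => //; apply: sseq; apply: srd; look; rewrite ?hVV ?hY //.
  by have := ltn_ord v; lia.
rewrite ew (rd_edge v w).
apply: sif; look; case evw: (e v w) => // _; last by apply: sskip; look.
apply: sif; [rewrite lt0n|move/eqP]; rewrite ev_neq; look; rewrite hY hPP ew => hy; last first.
  by apply: sskip; look; have -> : (w == par v) = true by [].
have hy' : w != par v by [].
rewrite evw hy' in cw; rewrite hy' /=.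
apply: sseq; apply: sle (@heavy_spec _ v _ _ _) _ _ => //; look => //.
move=> E1 hHV sm.
have eN : (E1 vN).1 = n by rewrite sm //; look.
have eVV : (E1 vVV).1 = v by rewrite sm //; look.
have eY : (E1 vY).1 = w by rewrite sm //; look; rewrite hY.
have eS : (E1 vS).1 = (E vS).1 by rewrite sm //; look.
have eLT : (E1 vLT).1 = 0 by rewrite sm //; look.
have hcE : (hcn v == w.+1) = (hv v == Some w).
  rewrite /hcn; case: (hv v) => [h|//]; rewrite eqSS.
  by apply/eqP/eqP => [/val_inj ->|[->]].
apply: sif; look; rewrite hHV eY; last first.
  move=> d0; apply: sskip; look; rewrite eLT -hcE.
  by have := ev_diff (hcn v) w; rewrite d0 => /esym/negbFE ->.
rewrite ev_diff hcE => hl; rewrite hl.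
apply: sseq; apply: sasg; look; first by rewrite eVV; have := B_ord v; lia.
apply: sseq; apply: sasg; look; first by rewrite eY; have := B_ord w; lia.
apply: sseq; apply: sle (@size_spec _ v w (esym cw) _ _ _) _ _ => //; look => //.
move=> E2 hK sm2.
have eS2 : (E2 vS).1 = (E vS).1 by rewrite sm2 //; look.
have eLT2 : (E2 vLT).1 = 0 by rewrite sm2 //; look.
apply: sif; [rewrite lt0n|move/eqP]; rewrite ev_neq hK eS2 => hs.
  by apply: sskip; rewrite eLT2 (negbTE hs).
by apply: sasg; look; [lia|rewrite hs].
Qed.
Local Notation frame := (frame m).
Local Notation start := (start dep_root dep_par).
Local Notation mstep := (mstep L dep_root dep_par).
Local Notation wf_state := (wf_state dep_root dep_par).

Definition fld (i : nat) (f : frame) : nat :=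
  match i with
  | 0 => par (fx f) | 1 => fx f | 2 => fj f | 3 => fh f
  | 4 => ff f | 5 => fc f | 6 => fs f | _ => fy f
  end.

Definition rep (st : frame * seq frame) E :=
  [/\ (E vN).1 = n, (E vG).1 = size st.2, (E vGo).1 = 1 &
    forall x, x \in fvars -> E x = (fld x st.1, map (fld x) st.2)].

Lemma in_fvars (P : X -> Prop) :
  P vA -> P vX -> P vJ -> P vH -> P vF -> P vC -> P vS -> P vY ->
  forall x, x \in fvars -> P x.
Proof.
move=> h0 h1 h2 h3 h4 h5 h6 h7 x; rewrite /fvars !inE.
by do 7 (case/orP => [/eqP->//|]); move/eqP->.
Qed.

Lemma in_hvars (P : X -> Prop) : P vA -> P vX -> P vJ -> P vH -> P vF ->
  forall x, x \in [:: vA; vX; vJ; vH; vF] -> P x.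
Proof.
move=> h0 h1 h2 h3 h4 x; rewrite !inE.
by do 4 (case/orP => [/eqP->//|]); move/eqP->.
Qed.

Lemma setaE E x a y : seta E x a y = if y == x then (a, (E x).2) else E y.
Proof. by rewrite /seta ffunE. Qed.

Lemma rep_same c st E E' : rep st E -> same c E E' ->
  all (fun x => ~~ writes c x) [:: vN, vG, vGo & fvars] -> rep st E'.
Proof.
move=> [h1 h2 h3 h4] sm /allP al.
have h x : x \in [:: vN, vG, vGo & fvars] -> E' x = E x by move=> /al; apply: sm. split; rewrite ?h // => x hx; rewrite h ?h4 //.
by rewrite 3!inE hx !orbT.
Qed.

Lemma reset_spec f stk E c k :
  (E vN).1 = n -> (E vG).1 = size stk -> (E vGo).1 = 1 -> 0 < k ->
  (forall x, x \in fvars -> (E x).2 = map (fld x) stk) ->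
  (forall x, x \in [:: vA; vX; vJ; vH; vF] -> (E x).1 = fld x f) -> (E vC).1 = c ->
  wp RESET E k (rep (Fr (fx f) (fj f) (fh f) (ff f) c 0 0, stk)).
Proof.
case: k => // k hN hG hGo _ hs hf hC.
apply: sseq; apply: sasg; look => //; apply: sasg; look => //.
split; look => //.
by apply: in_fvars; rewrite !setaE /= ?hs //;
  rewrite [LHS]surjective_pairing ?hs ?hC ?hf.
Qed.

Lemma rep_top st E x : rep st E -> x \in fvars -> (E x).1 = fld x st.1.
Proof. by case=> _ _ _ h hx; rewrite h. Qed.

Lemma rep_stk st E x : rep st E -> x \in fvars -> (E x).2 = map (fld x) st.2.
Proof. by case=> _ _ _ h hx; rewrite h. Qed.

Lemma depth_le st : wf_state st -> size st.2 < D /\ size st.2 <= 2 * n.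
Proof.
move=> /wf_depth le; split; first exact: leq_ltn_trans le _.
apply: leq_trans le _; have := trunc_logP (ltnSn 1) (isT : 0 < 2 * n).
by apply: leq_trans; apply: ltnW; apply: ltn_expl.
Qed.

Lemma return_spec f g stk E : rep (f, g :: stk) E -> wf_state (f, g :: stk) ->
  wp RETURN E 20 (rep (resume g (ff f), stk)).
Proof.
move=> hr iv; have iv0 := iv; have [hN hG hGo hf] := hr.
case/andP: iv => /= okf /and5P[okg cg yg _ _]; case/and5P: okf => _ _ hff _ _.
apply: sseq; apply: sasg; look; rewrite (rep_top hr) //=; first by lia.
apply: sseq.
apply: (sle (@wp_pop_each _ _ _ _ _ _ _ N_gt1 fvars _ _ _)) => // [x hx|].
  by rewrite seta2 (rep_stk hr).
move=> E1 hE1 _.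
have hE x : x \in fvars -> E1 x = (fld x g, map (fld x) stk).
  by move=> hx; rewrite hE1 hx seta2 (rep_stk hr).
have eN : (E1 vN).1 = n by rewrite hE1; look.
have eG : (E1 vG).1 = (size stk).+1 by rewrite hE1; look.
have eGo : (E1 vGo).1 = 1 by rewrite hE1; look.
have eR : (E1 vR).1 = ff f by rewrite hE1; look.
have szB : (size stk).+1 <= B.
  by have [_ /= le] := depth_le iv0; lia.
apply: sseq; apply: sasg; look; first by rewrite eG; lia.
have r E2 c k : (forall x, x != vG -> x != vC -> E2 x = E1 x) -> (E2 vC).2 = (E1 vC).2 ->
    (E2 vC).1 = c -> (E2 vG).1 = size stk -> 0 < k ->
    wp RESET E2 k (rep (Fr (fx g) (fj g) (fh g) (ff g) c 0 0, stk)).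
  move=> h1 h2 h3 h4 k0; apply: (reset_spec (E := E2) (f := g)) => //.
  - by rewrite h1.
  - by rewrite h1.
  - by apply: in_fvars; rewrite ?h2 ?h1 // hE.
  - by move=> x; rewrite !inE => hx; rewrite h1 ?hE //;
      move: hx; do 4 (case/orP => [/eqP->//|]); move/eqP->.
apply: sif; look; rewrite eR; last first.
  move=> r0; rewrite /resume r0 /=; apply: sseq; apply: sasg; look; first by rewrite eN; lia.
  apply: r => //; rewrite ?seta2 ?seta1 /= ?eG ?subn1 //.
  by move=> x n1 n2; rewrite !setaE (negbTE n1) (negbTE n2).
rewrite lt0n /resume => /negbTE ->.
apply: sif; look; rewrite eR (hE vC) //=; last first.
  move=> d0; have -> : ff f == (fc g).+1 by apply/negbFE; rewrite -ev_diff d0.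
  apply: sseq; apply: sasg; look; rewrite (hE vC) //=; first by lia.
  apply: r => //; rewrite ?seta2 ?seta1 /= ?eG ?subn1 ?(hE vC) //.
  by move=> x n1 n2; rewrite !setaE (negbTE n1) (negbTE n2).
rewrite ev_diff => /negbTE ->.
apply: sasg; look; rewrite (hE vY) //=; first by lia.
split; look; rewrite ?eG ?subn1 //.
by apply: in_fvars; rewrite !setaE /= hE.
Qed.

Lemma finish_spec f stk E : rep (f, stk) E -> wf_state (f, stk) -> n <= fc f ->
  wp FINISH E 22 (fun E' =>
    if mstep (f, stk) is Some st' then rep st' E'
    else (E' vGo).1 = 0 /\ (E' vF).1 = ff f).
Proof.
move=> hr iv lec; have [hN hG hGo hf] := hr; rewrite /= lec.
have /andP[/= /and5P[hj hh hff hc _] _] := iv.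
have ltp := plen_lt dep_root dep_par (fx f).
apply: sif; look; rewrite (rep_top hr) //=; case ej: (fj f) hj => [|j] hj // _.
  do 2 (apply: sseq; apply: sasg; look; rewrite ?(rep_top hr) //= ?ej; first by lia).
  do 2 (apply: sseq; apply: sasg; look => //).
  apply: (@reset_spec (Fr (fx f) j (ff f) 0 0 0 0)); look => //.
  - by move=> x hx; rewrite !seta2 (rep_stk hr).
  - by apply: in_hvars; rewrite !seta1 /= ?(rep_top hr) //= ?ej ?subn1.
apply: sif; look; rewrite hG; case: stk hr iv hG {hf} => [|g stk] hr iv hG //= _.
  by apply: sle (return_spec hr iv) _ _.
by apply: sasg; look => //; rewrite (rep_top hr).
Qed.

Lemma call_spec f stk E (v w : 'I_n) : rep (f, stk) E -> wf_state (f, stk) ->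
  par w = v -> (E vVV).1 = v -> fy f = w ->
  wp CALL E 58 (rep (start w, f :: stk)).
Proof.
move=> hr iv pw hVV hy; have [hN hG hGo hf] := hr.
have [hD hB] := depth_le iv; rewrite /= in hD hB.
apply: sseq; apply: sasg; look; rewrite (rep_top hr) //= hy; first by have := B_ord w; lia.
apply: sseq; apply: (sle (@wp_push_each _ _ _ _ _ _ _ N_gt1 fvars _ _ _)) => // [x hx|].
  by rewrite seta2 (rep_stk hr) // size_map.
move=> E1 hE1 _.
have hE x : x \in fvars -> E1 x = (0, map (fld x) (f :: stk)).
  by move=> hx; rewrite hE1 hx seta1 seta2 (rep_stk hr) // (negbTE (_ : x != vW)) ?(rep_top hr) //;
    apply: contraTneq hx => ->.
have eN : (E1 vN).1 = n by rewrite hE1; look.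
have eG : (E1 vG).1 = size stk by rewrite hE1; look.
have eGo : (E1 vGo).1 = 1 by rewrite hE1; look.
have eW : (E1 vW).1 = w by rewrite hE1; look.
have eVV : (E1 vVV).1 = v by rewrite hE1; look.
apply: sseq; apply: sasg; look; first by rewrite eVV; have := B_ord v; lia.
apply: sseq; apply: sasg; look; first by rewrite eW; have := B_ord w; lia.
apply: sseq; apply: sasg; look; first by rewrite eN; lia.
apply: sseq; apply: sasg; look; first by rewrite eG; lia.
set E2 := seta _ vG _.
have e2 : [/\ (E2 vN).1 = n, (E2 vA).1 = par w & (E2 vX).1 = w].
  by rewrite /E2; look; rewrite eN eVV eW pw.
case: e2 => e2N e2A e2X.
apply: (sle (wp_pure _ (pathlen_spec e2N e2A e2X))) => // E' [hJ hs] sm.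
split; rewrite ?sm //; rewrite /E2; look; rewrite ?eG //.
apply: in_fvars; [| |by rewrite [LHS]surjective_pairing hJ hs /E2 !seta2 hE| | | | |];
  by rewrite sm // /E2 ?setaE /= ?eVV ?eW ?eN ?hE //= ?pw.
Qed.

Lemma body_spec f stk E : rep (f, stk) E -> wf_state (f, stk) ->
  wp BODY E 68 (fun E' =>
    if mstep (f, stk) is Some st' then rep st' E'
    else (E' vGo).1 = 0 /\ (E' vF).1 = ff f).
Proof.
move=> hr iv; have [hN hG hGo hf] := hr.
have /andP[/= /and5P[hj hh hff hc /andP[hs hy]] _] := iv.
have tops := rep_top hr.
apply: sseq; apply: (sle (descend_spec hj hN _ _ _)) => //; try by rewrite tops.
move=> E1 [hPP hVV] sm.
have {hN hG hGo hf}hr : rep (f, stk) E1 by apply: rep_same hr sm isT.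
move: tops => _; have tops := rep_top hr; have [hN hG hGo hf] := hr.
set v := descend _ _ in hPP hVV; have ev : vertex par dep f = v by [].
apply: sif; look; rewrite hN tops //=; last first.
  by move=> lec; apply: sle (finish_spec hr iv _) _ _ => //; lia.
move=> ltc'; have ltc : fc f < n by lia.
apply: sseq; apply: (sle (cand_spec ltc hN hVV _)) => //; first by rewrite tops.
move=> E2 hLT sm2.
have {hN hG hGo hf}hr : rep (f, stk) E2 by apply: rep_same hr sm2 isT.
rewrite tops //= in hLT; move: tops => _; have tops := rep_top hr; have [hN hG hGo hf] := hr.
have hVV2 : (E2 vVV).1 = v by rewrite sm2.
have hPP2 : (E2 vPP).1 = par v by rewrite sm2.
rewrite [n <= fc f]leqNgt ltc /= ev.
have rst E3 f' c k : (forall x, x \in [:: vN; vG; vGo; vA; vX; vJ; vH] -> E3 x = E2 x) ->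
   (forall x, (E3 x).2 = (E2 x).2) -> (E3 vC).1 = c -> (E3 vF).1 = f' -> 0 < k ->
   wp RESET E3 k (rep (Fr (fx f) (fj f) (fh f) f' c 0 0, stk)).
  move=> h1 h2 h3 h4 k0; apply: (@reset_spec (Fr (fx f) (fj f) (fh f) f' c 0 0)) => //; try by rewrite h1.
    by move=> x hx; rewrite h2 (rep_stk hr).
  by apply: in_hvars; rewrite ?h4 ?h1 // tops.
apply: sif; look; rewrite hLT; case cn: (cand _ _ _ _) => //= _; last first.
  apply: sseq; apply: sasg; look; rewrite tops //=; first by lia.
  apply: rst => //; look => //; rewrite ?tops // => x; last by rewrite seta2.
  by rewrite setaE; case: eqP => // ->.
apply: sif; look; rewrite hN tops //=; last first.
  move=> ge; rewrite (_ : 2 * n <= fs f); last by lia.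
  apply: sseq; apply: sif; look; rewrite tops //=.
    rewrite lt0n => /negbTE ->; apply: sseq; apply: sasg; look; rewrite hN; first by lia.
    apply: sasg; look; rewrite hN; first by lia.
    apply: rst => //; look => // x; last by rewrite !seta2.
    by rewrite !setaE; case: eqP => [->//|_]; case: eqP => [->//|_].
  move=> ->; rewrite eqxx; apply: sseq; apply: sasg; look; rewrite tops //=; first by lia.
  apply: sasg; look; rewrite tops //=; first by lia.
  apply: rst => //; look => // x; last by rewrite !seta2.
  by rewrite !setaE; case: eqP => [->//|_]; case: eqP => [->//|_].
move=> lts'; have lts : fs f < 2 * n by lia.
rewrite [2 * n <= _]leqNgt lts /=.
apply: sif; look; rewrite hN tops //=; last first.
  move=> ge; rewrite (_ : n <= fy f); last by lia.
  apply: sseq; apply: sasg; look; rewrite tops //=; first by lia.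
  apply: sasg; look => //; split; look => //.
  by apply: in_fvars; rewrite !setaE /= hf.
move=> lty'; have lty : fy f < n by lia.
rewrite [n <= fy f]leqNgt lty /=.
apply: sseq; apply: (sle (light_spec lty hN hPP2 hVV2 _)) => //; first by rewrite tops.
move=> E3 hLT3 sm3.
have hr3 : rep (f, stk) E3 by apply: rep_same hr sm3 isT.
rewrite tops //= in hLT3; have hVV3 : (E3 vVV).1 = v by rewrite sm3.
apply: sif; look; rewrite hLT3; case lw: (light _ _ && _) => //= _.
  case/andP: lw => /andP[/andP[_ /eqP pw] _] _.
  by apply: sle (call_spec hr3 iv pw hVV3 _) _ _ => //; rewrite inordK.
apply: sasg; look; rewrite (rep_top hr3) //=; first by lia.
have [hN3 hG3 hGo3 hf3] := hr3.
split; look => //.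
by apply: in_fvars; rewrite !setaE /= hf3.
Qed.

Lemma main_spec E A s : (E vN).1 = n -> (forall x, x != vN -> E x = (0, [::])) ->
  n * base m + 3 <= A -> A * (2 * n) ^ 3 + 1 < N ^ s ->
  wp MAIN E (s + 74) (fun E' => (E' vF).1 = code L par dep ord0).
Proof.
move=> hN h0 leA leN.
have [f [[k lek hk] hf ef]] := eval_root L dep_root dep_par leA.
(* The predecessor [i.-1] reserves one extra round: after the last step of the abstract machine, the
   body runs once more, finds no successor state and clears [vGo]. *)
pose I i E := (exists st, [/\ rep st E, wf_state st & mrun L dep_root dep_par i.-1 st = Some (f, [::])] /\ 0 < i) \/
   (i = 0 /\ (E vGo).1 = 0 /\ (E vF).1 = ff f).
have e0 x : x != vN -> (E x).1 = 0 by move=> /h0 ->.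
have -> : s + 74 = (s + 69.+1 + 1).+3 by lia.
apply: sseq; apply: sasg; look; first by rewrite hN; lia.
apply: sseq; apply: (sle (wp_pure _ (@pathlen_spec _ ord0 _ _ _))) => //; look => //.
- by rewrite par_root e0.
- by rewrite e0.
- by lia.
move=> E1 [hJ hs] sm.
apply: sseq; apply: sasg; look; first by lia.
apply: (sle (k := s + 69.+1) (Q := fun E => (E vF).1 = ff f)) => //; last 2 first.
- lia.
- by move=> E' -> _.
apply: (swhile (I := I) (i0 := k.+1)).
- left; exists (start ord0, [::]); split=> //; split=> //; last exact: wf_start.
  split; look => //; rewrite ?sm //; look; rewrite ?hN ?e0 //.
  apply: in_fvars; rewrite setaE /=;
    [| |by rewrite [LHS]surjective_pairing hJ hs; look; rewrite seta2 h0| | | | |];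
    by rewrite sm // setaE /= ?hN ?h0 //= ?par_root.
- lia.
- move=> i E2 /= [[st [[hr iv hm] i0]]|[-> [-> _]]] //= _.
  case: i i0 hm => // i _ /= hm; case: st hr iv hm => g stk hr iv hm.
  apply: (sle (body_spec hr iv)) => // E3 + _.
  case: i hm => [|i] hm.
    move: hm => [-> ->]; rewrite hf => hgo; exists 0 => //; by right.
  rewrite mrunS in hm; case es: (mstep _) hm => [st'|//] hm hr'.
  by exists i.+1 => //; left; exists st'; split=> //; split=> //; apply: wf_step es.
move=> i E2 [[st [[hr _ _] _]]|[_ [_ ->]] //] /=.
by case: hr => _ _ -> _.
Qed.
End Specs.

(** * The machine on the encoded input *)

Local Notation var_track := (track 'I_26).
Local Notation var_scratch := (tU 'I_26).

Definition ES := ces MAIN.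

(** The largest expression is the loop test of [SIZE], a sum of two [neq] of size 7 each. *)
Lemma ES_val : ES = 15. Proof. by []. Qed.

(** The machine is not given [n]; it reads it off as the length of the first row. *)
Definition count_columns : cmd var_track :=
  Seq (right _)
 (Seq (While (In _ not_sep) (Seq (Inc var_scratch (inl vN : var_track)) (right _))) (home _)).

Definition machine_cmd : cmd var_track := Seq count_columns (icomp MAIN).

Definition tree_machine : TM := decider machine_cmd (Nz (inl vF : var_track)).

Section Input.
Variables (m : nat) (e : rel 'I_m.+1) (L : 'I_m.+1 -> {set 'I_m.+1}).
Notation n := m.+1.

Definition input_rows :=
  [seq [seq bitsym (e u v) | v <- enum 'I_n] | u <- enum 'I_n] ++
  [seq [seq bitsym (c \in L u) | c <- enum 'I_n] | u <- enum 'I_n].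

Lemma encode_rows : encode e L = word input_rows.
Proof. by rewrite /word map_cat flatten_cat -!(map_comp (fun r => rcons r ISep)). Qed.

Lemma size_map_enum T (f : 'I_n -> T) : size [seq f u | u <- enum 'I_n] = n.
Proof. by rewrite size_map size_enum_ord. Qed.

Lemma size_rows : size input_rows = 2 * n.
Proof. by rewrite size_cat !size_map_enum mul2n addnn. Qed.

Lemma nth_edge (u : 'I_n) : nth [::] input_rows u = [seq bitsym (e u v) | v <- enum 'I_n].
Proof.
rewrite nth_cat size_map_enum ltn_ord (nth_map u) ?size_enum_ord //.
by rewrite nth_ord_enum.
Qed.

Lemma nth_list (u : 'I_n) :
  nth [::] input_rows (n + u) = [seq bitsym (c \in L u) | c <- enum 'I_n].
Proof.
rewrite nth_cat size_map_enum ltnNge leq_addr /= addKn.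
by rewrite (nth_map u) ?size_enum_ord // nth_ord_enum.
Qed.

Lemma row_cases (P : seq isym -> Prop) :
  (forall f : 'I_n -> bool, P [seq bitsym (f v) | v <- enum 'I_n]) ->
  forall i, i < size input_rows -> P (nth [::] input_rows i).
Proof.
move=> hP i; rewrite size_rows => lt; case: (ltnP i n) => [lti|ge].
  by rewrite (nth_edge (Ordinal lti)).
have lti : i - n < n by lia.
have -> : i = n + Ordinal lti by rewrite /=; lia.
by rewrite nth_list.
Qed.

Lemma input_size i : i < size input_rows -> size (nth [::] input_rows i) = n.
Proof. by apply: (row_cases (P := fun r => size r = n)) => f; rewrite size_map_enum. Qed.

Lemma input_sym i j : i < size input_rows -> j < n ->
  exists b, nth IEnd (nth [::] input_rows i) j = bitsym b.
Proof.
move=> lti ltj; move: i lti; apply: (row_cases (P := fun r => exists b, nth IEnd r j = bitsym b)) => f.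
by exists (f (Ordinal ltj)); rewrite (nth_map (Ordinal ltj)) ?size_enum_ord //
  (nth_ord_enum _ (Ordinal ltj)).
Qed.

Lemma is_one_bitsym b : is_one (bitsym b) = b. Proof. by case: b. Qed.

Lemma input_edge (u v : 'I_n) : rdw input_rows u v = e u v.
Proof.
by rewrite /rdw nth_edge (nth_map v) ?size_enum_ord // nth_ord_enum is_one_bitsym.
Qed.

Lemma input_list (u c : 'I_n) : rdw input_rows (n + u) c = (c \in L u).
Proof.
by rewrite /rdw nth_list (nth_map c) ?size_enum_ord // nth_ord_enum is_one_bitsym.
Qed.

Let B := 2 * n + 2.
Let D := (trunc_log 2 (2 * n)).+1.
Let bv := Bv B ES.
Let dp := Dp D ES.
Let w := word input_rows.
Notation run := (run w var_scratch bv dp).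
Notation env := {ffun 'I_26 -> nat * seq nat}.

Definition env0 : env := [ffun=> (0, [::])].

Lemma count_columnsP : run count_columns (emb0 env0) 0
  (n * (cK bv dp + 6) + 10) (emb0 (seta env0 vN n)) 0.
Proof.
have sz := size_word input_size; have szr := size_rows.
have szw : size w = 2 * n * n.+1 by rewrite /w sz szr.
have lew : n < size w by rewrite szw leq_pmull.
have r1 : run (right _) (emb0 env0) 0 1 (emb0 env0) 1.
  have := @run_mv _ w var_scratch bv dp (emb0 env0) 0 MoveR.
  have -> : move_input w MoveR 0 = 1 by rewrite /=; lia.
  exact.
pose G j := emb0 (seta env0 vN (n - j)).
have e0 : seta env0 vN 0 = env0.
  by apply/ffunP => x; rewrite !ffunE; case: eqP.
have g0 : G 0 = emb0 (seta env0 vN n) by rewrite /G subn0.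
have gn : G n = emb0 env0 by rewrite /G subnn e0.
have := @run_loop _ w var_scratch bv dp (In _ not_sep) (Seq (Inc var_scratch (inl vN : var_track)) (right _))
  G (fun j => (n - j).+1) (cK bv dp + 1) n.
rewrite gn g0 subnn subn0 => r2.
have r3 : run (home _) (emb0 (seta env0 vN n)) n.+1 (3 * n.+1 + 1) (emb0 (seta env0 vN n)) 0.
  apply: run_home => i lti; apply: (read_inside input_size input_sym).
  by rewrite -/w; apply: leq_trans lti lew.
have := run_seq r1 (run_seq (r2 _ _) r3); move=> r; apply: run_le (r _ _) _.
- move=> j lej; rewrite /=; case: j lej => [|j] lej.
    rewrite subn0; have := read_sep input_size (i := 0).
    by rewrite mul1n szr => ->.
  have := @read_cell input_rows n input_size 0 (n - j.+1).
  rewrite mul0n add0n szr => -> //; try lia.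
  by have [|b ->] := @input_sym 0 (n - j.+1) _ ltac:(lia); [rewrite szr|case: b].
- move=> j ltj; apply: (run_seq (F2 := G j) (p2 := (n - j.+1).+1)).
    have := @run_inc _ w var_scratch bv dp (G j.+1) (n - j.+1).+1 (inl vN : var_track) isT.
    rewrite embX upd_embX seta1 eqxx => h.
    have -> : G j = emb (upd (seta env0 vN (n - j.+1)) vN
       ((n - j.+1).+1, (seta env0 vN (n - j.+1) vN).2)) (0, [::]) (0, [::]).
      by rewrite /G subnSK // /seta upd_upd upd_same.
    by apply: h; rewrite /bv /Bv ES_val /B; lia.
  have := @run_mv _ w var_scratch bv dp (G j) (n - j.+1).+1 MoveR.
  have -> : move_input w MoveR (n - j.+1).+1 = (n - j).+1.
    by rewrite /=; move: lew; set sw := size w; clearbody sw; lia.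
  exact.
- have -> : cK bv dp + 6 = (cK bv dp + 1).+2 + 3 by lia.
  by rewrite mulnDr; lia.
Qed.

Lemma okE0 : okE B D env0.
Proof. by move=> x; rewrite ffunE. Qed.

Lemma emb_env0 v : emb0 env0 v = (0, [::]).
Proof. by case: v => [x|[[|[|[|i]]] h]] //; rewrite /emb0 /emb !ffunE. Qed.

Lemma okF0 : okF var_scratch bv dp (emb0 env0).
Proof.
by split=> [|v]; rewrite emb_env0.
Qed.

Hypothesis tree : is_tree e.

Let N := 2 * n + 4.

(** The exponent 82 is the 74 of [main_spec] plus 8 for the number of abstract steps, bounded by
    N^8. *)
Definition steps := n * (cK bv dp + 6) + 10 + N ^ 82 * cI input_rows B D ES.

Lemma tree_machine_run : exists T,
  [/\ T <= steps.+2 * (2 * height bv dp + 6),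
      halts_at tree_machine (encode e L) T,
      space_within tree_machine (encode e L) T (height bv dp).+2
    & accepts_at tree_machine (encode e L) T <-> list_colourable e L].
Proof.
have pr := par_root tree; have dr := dep_root tree.
have dpar v (nv : v != ord0) := proj2 (parP tree nv).
have ep := edge_par tree.
have B0 : 0 < B by rewrite /B; lia.
have okN : okE B D (seta env0 vN n).
  by apply: okE_seta => //; [exact: okE0|rewrite /B; lia].
have lim : (n * base m + 3) * (2 * n) ^ 3 + 1 < N ^ 8.
  have h0 : 6 <= N by rewrite /N; lia.
  have h1 : base m <= N ^ 2 by rewrite /base /N expnS expn1; nia.
  have h2 : n * base m <= N ^ 3 by rewrite expnS leq_mul // /N; lia.
  have lin q p : q <= p -> 0 < p -> q + 3 <= N * p.
    move=> le p0; apply: leq_trans (leq_mul h0 (leqnn p)); clear -le p0; lia.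
  have N_pow k : 0 < N ^ k by rewrite expn_gt0 (leq_trans _ h0).
  have h3 : n * base m + 3 <= N ^ 4 := lin _ _ h2 (N_pow 3).
  have h4 : (2 * n) ^ 3 <= N ^ 3 by rewrite leq_exp2r // /N; lia.
  have h5 := leq_mul h3 h4; rewrite -expnD in h5.
  by rewrite -addnS (leq_trans _ (lin _ _ h5 (N_pow 7))) // leq_add2l.
have sz := size_rows.
have [||t [E' [ex let_ hF]]] := main_spec pr dr dpar ep input_edge input_list
    (leqnn _ : 2 * n + 2 <= B) (leqnn _ : 2 * n + 4 <= N) (ltnSn _ : _ < D)
    (E := seta env0 vN n) _ _ (leqnn _) lim.
- by rewrite seta1 eqxx.
- by move=> x ne; rewrite /seta upd_other // ffunE.
have {}ex : iexec (size input_rows) n B D (rdw input_rows) MAIN (seta env0 vN n) t E'.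
  by rewrite sz.
have [ok' r _] := iexecP input_size input_sym B0 ex (isT : 0 < ES) (leqnn _) okN.
have [[t1 le1 e1] _] := run_seq count_columnsP r okF0.
have ei : enc (emb0 env0) 0 = init_store _.
  by congr Store; apply/ffunP => v; rewrite [LHS]ffunE emb_env0 ffunE.
rewrite ei in e1.
have [T [h1 h2 h3 h4]] := decider_run (Nz (inl vF : var_track)) e1.
exists T; rewrite encode_rows; split=> //.
  apply: leq_trans h1 _; rewrite leq_mul // !ltnS (leq_trans le1) //.
  by rewrite /steps leq_add2l leq_mul.
rewrite /accepts_at in h4 *; rewrite h4 ev_Nz embX hF lt0n code0.
by split=> [/(feas_root L pr dr dpar ep)|/(feas_root L pr dr dpar ep)].
Qed.
End Input.

(** * Time and space bounds *)

Lemma trunc_log_lt k j : 0 < k -> k < 2 ^ j -> trunc_log 2 k < j.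
Proof.
move=> k0 lt; rewrite -(@ltn_exp2l 2) //; apply: leq_ltn_trans lt.
exact: trunc_logP.
Qed.

Lemma trunc_log_le k : 0 < k -> trunc_log 2 k <= k.
Proof. by move=> k0; apply/ltnW/trunc_log_lt => //; apply: ltn_expl. Qed.

Section Bounds.
Variables (m : nat) (e : rel 'I_m.+1) (L : 'I_m.+1 -> {set 'I_m.+1}).
Notation n := m.+1.
Let B := 2 * n + 2.
Let D := (trunc_log 2 (2 * n)).+1.
Let bv := Bv B ES.
Let dp := Dp D ES.
Let N := 2 * n + 4.

Lemma N_ge6 : 5 < N. Proof. by rewrite /N; lia. Qed.

Lemma N_pow k : 0 < N ^ k. Proof. by rewrite expn_gt0 /N; lia. Qed.

Lemma N2_ge : 36 <= N ^ 2. Proof. by have := N_ge6; rewrite expnS expn1; nia. Qed.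

(** Since N is at least 6, any factor up to 36 costs two exponents; this is how numerical constants
    disappear from the time bounds. *)
Lemma absorb c k : c <= 36 -> c * N ^ k <= N ^ (2 + k).
Proof. by move=> le; rewrite expnD leq_mul2r (leq_trans le N2_ge) orbT. Qed.

Lemma pow_mono j k : j <= k -> N ^ j <= N ^ k.
Proof. by move=> le; rewrite leq_pexp2l // (leq_trans _ N_ge6). Qed.

Lemma height_le : height bv dp <= N ^ 8.
Proof.
have h6 := N_ge6; have h36 := N2_ge.
have hbv : bv <= 15 * N by rewrite /bv /Bv ES_val /B /N; lia.
have hdp : dp <= N + 31.
  have := @trunc_log_le (2 * n) isT; rewrite /dp /Dp ES_val /D /N; lia.
have htl : trunc_log 2 bv.+1 <= bv.+1 by exact: trunc_log_le.
have h4 : N ^ 4 = N ^ 2 * N ^ 2 by rewrite -expnD.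
have hN2 : N ^ 2 = N * N by rewrite expnS expn1.
rewrite /height (expnD N 4 4); apply: leq_mul.
  by rewrite h4 hN2 in h36 *; nia.
by rewrite h4 hN2 in h36 *; nia.
Qed.

Lemma word_le : size (word (input_rows e L)) <= N ^ 2.
Proof.
rewrite (size_word (@input_size _ e L)) size_rows expnS expn1 leq_mul //.
  by rewrite /N leq_addr.
by rewrite /N; lia.
Qed.

Lemma bv_le : bv <= N ^ 3.
Proof.
apply: (@leq_trans (15 * N)); first by rewrite /bv /Bv ES_val /B /N; lia.
by rewrite (expnSr N 2) leq_mul // (leq_trans _ N2_ge).
Qed.

Lemma cK_le : cK bv dp <= N ^ 10.
Proof.
have lin h P : h <= P -> 0 < P -> 8 * h + 10 <= 18 * P by clear; lia.
exact: leq_trans (lin _ _ height_le (N_pow 8)) (absorb 8 (isT : 18 <= 36)).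
Qed.

Lemma cZ_le : cZ (input_rows e L) B D ES <= N ^ 16.
Proof.
have hw : size (word (input_rows e L)) <= N ^ 10.
  by apply: leq_trans word_le (pow_mono _).
have bnd c d : c + 3 + d <= 36 ->
    c * cK bv dp + 3 * size (word (input_rows e L)) + d <= N ^ 12.
  move=> le; rewrite (expnD N 2 10).
  apply: (@leq_trans ((c + 3 + d) * N ^ 10)).
    by rewrite !mulnDl !leq_add ?leq_mul ?cK_le ?leq_pmulr ?N_pow.
  by rewrite leq_mul // (leq_trans le N2_ge).
rewrite /cZ -/bv -/dp -[_ + 20]addnA -addnA [10 * _ + _]addnA.
apply: (@leq_trans (N ^ 15 + N ^ 15)).
  apply: leq_add; first by rewrite (expnD N 3 12) leq_mul ?bv_le ?bnd.
  by rewrite (leq_trans (bnd _ _ _)) // pow_mono.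
by rewrite addnn -mul2n expnS leq_mul // (leq_trans _ N_ge6).
Qed.

Lemma steps_le : steps e L <= N ^ 103.
Proof.
have ltnN : n <= N by rewrite /N; lia.
have lin K P : K <= P -> 0 < P -> n * (K + 6) + 10 <= N * (17 * P).
  by rewrite /N; clear; move: m => k le P0; nia.
have hI : cI (input_rows e L) B D ES <= N ^ 19.
  rewrite /cI ES_val (expnD N 3 16) leq_mul ?cZ_le // (expnS N 2).
  exact: leq_trans (leq_mul N_ge6 N2_ge).
have h1 : n * (cK bv dp + 6) + 10 <= N ^ 101.
  apply: leq_trans (lin _ _ cK_le (N_pow 10)) _.
  apply: leq_trans (leq_mul (leqnn N) (absorb 10 (isT : 17 <= 36))) _.
  by rewrite -expnS pow_mono.
have h2 : N ^ 82 * cI (input_rows e L) B D ES <= N ^ 101.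
  by rewrite (expnD N 82 19); apply: leq_mul (leqnn _) hI.
apply: leq_trans (leq_add h1 h2) _.
by rewrite addnn -mul2n (absorb 101 (isT : 2 <= 36)).
Qed.

Lemma time_le : (steps e L).+2 * (2 * height bv dp + 6) <= N ^ 115.
Proof.
have lin1 s P : s <= P -> 0 < P -> s.+2 <= 3 * P by clear; lia.
have lin2 h P : h <= P -> 0 < P -> 2 * h + 6 <= 8 * P by clear; lia.
rewrite (expnD N 105 10); apply: leq_mul.
  exact: leq_trans (lin1 _ _ steps_le (N_pow 103)) (absorb 103 (isT : 3 <= 36)).
exact: leq_trans (lin2 _ _ height_le (N_pow 8)) (absorb 8 (isT : 8 <= 36)).
Qed.

(** With l = [trunc_log 2 n], the stack depth gives a factor of at most l + 35 and the numeral
    length one of at most l + 9. The constant is 35 * 9 + 2, the value at l = 0. *)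
Lemma space_le : (height bv dp).+2 <= 317 * (trunc_log 2 n).+1 ^ 2.
Proof.
set l := trunc_log 2 n.
have ln : n < 2 ^ l.+1 by apply: trunc_log_ltn.
have h1 : trunc_log 2 (2 * n) <= l.+1.
  by rewrite -ltnS; apply: trunc_log_lt => //; rewrite expnS ltn_pmul2l.
have h2 : trunc_log 2 bv.+1 <= l + 7.
  rewrite -ltnS; apply: trunc_log_lt => //.
  have -> : 2 ^ (l + 7).+1 = 128 * 2 ^ l.+1 by rewrite -addSn addnC expnD.
  by rewrite /bv /Bv ES_val /B; move: (2 ^ l.+1) ln => P; lia.
rewrite /height /dp /Dp ES_val /D expnS expn1.
by move: (trunc_log 2 (2 * n)) (trunc_log 2 bv.+1) h1 h2 => a b; nia.
Qed.
End Bounds.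

Lemma pow_poly k : exists c, forall n, 0 < n -> (2 * n + 4) ^ k <= c * n ^ k.
Proof.
exists (6 ^ k) => n n0; rewrite -expnMn.
by case: k => // k; rewrite leq_exp2r //; lia.
Qed.

Theorem theorem9 :
  exists (M : TM) (k c : nat),
    forall (n : nat) (e : rel 'I_n) (L : 'I_n -> {set 'I_n}),
      is_tree e ->
      exists t : nat,
        [/\ t <= c * n ^ k + c,
            halts_at M (encode e L) t,
            space_within M (encode e L) t (c * (trunc_log 2 n).+1 ^ 2 + c)
          & (accepts_at M (encode e L) t <-> list_colourable e L)].
Proof.
have [c0 hc0] := pow_poly 115.
(* A single constant has to serve both bounds: [c0] covers the time and 317 the space. *)
exists tree_machine, 115, (c0 + 317) => n e L tree.
have n0 : 0 < n by case: tree.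
case: n n0 e L tree => // m _ e L tree.
have [t [h1 h2 h3 h4]] := tree_machine_run L tree.
exists t; split=> //.
  apply: leq_trans h1 _; apply: leq_trans (time_le e L) _.
  apply: leq_trans (hc0 m.+1 isT) _; apply: leq_trans (leq_addr _ _).
  by rewrite leq_mul2r leq_addr orbT.
move=> t' le; apply: leq_trans (h3 t' le) _.
apply: leq_trans (space_le m) _; apply: leq_trans (leq_addr _ _).
by rewrite leq_mul2r leq_addl orbT.
Qed.
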